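(* Let $f,g:\mathbb R^d\to\mathbb R$, $\mathcal B=\{x\in\mathbb R^d:\|x\|\le 1\}$ and $\mathcal C=\{x\in\mathbb R^d:g(x)\le 0\}$. Assume: (i) $\mathcal C$ is nonempty, closed and contained in $\operatorname{int}\mathcal B$; the initial point $x_0\in\mathcal B$ is arbitrary. (ii) On an open convex neighborhood $U$ of $\mathcal B$, $f$ is $\ell$-weakly convex and $G_f$-Lipschitz, with $\ell,G_f>0$. There is a stochastic oracle $\widetilde v(x;\xi)$, queried with fresh randomness $\xi$ at each call, such that for every query point $x$ measurable with respect to the past history $\mathcal F$, $\mathbb E[\widetilde v(x;\xi)\mid\mathcal F]=v(x)\in\partial f(x)$ and $\|\widetilde v(x;\xi)\|\le G_f$ almost surely. (iii) $g$ is continuously differentiable with $L_g$-Lipschitz gradient on $U$, $L_g>0$, with exactly available values and gradients; $G_g:=\max_{x\in\mathcal B}\|\nabla g(x)\|$. (iv) There are $\sigma_{\rm bd},\sigma_{\rm out}>0$ such that $\|\nabla g(z)\|\ge\sigma_{\rm bd}$ for all $z\in\mathcal B$ with $g(z)=0$, and $\operatorname{dist}(0,\nabla g(x)+N_{\mathcal B}(x))\ge\sigma_{\rm out}$ for all $x\in\mathcal B$ with $g(x)>0$. Choose $\lambda>G_f/\sigma_{\rm out}$, $\beta>\ell+\lambda L_g$, $m=\beta-\ell-\lambda L_g$. Put $\Psi_\lambda(x)=f(x)+\lambda[g(x)]_+$, $\Delta_\lambda=\Psi_\lambda(x_0)-\min_{x\in\mathcal B}\Psi_\lambda(x)$, $h_{\rm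 feas}=\lambda\sigma_{\rm out}-G_f$, $R=\sigma_{\rm bd}/L_g$, and for $x\in\mathcal B$ $$Q_{\lambda,\beta}(x)=\operatorname*{argmin}_{y\in\mathcal B}\Big\{\Psi_\lambda(y)+\frac\beta2\|y-x\|^2\Big\},\qquad \mathcal R_{\lambda,\beta}(x)=\beta\|x-Q_{\lambda,\beta}(x)\|.$$ Let $0<\epsilon<\min\{h_{\rm feas},\beta R,1\}$. Run the Penalized Proximal Subgradient Method with One Projection (described in the context) with $p(u)=\lambda[u]_+$, these $\beta,m$, and index set $\mathcal I=\{0,\dots,T-1\}$. Choose $$T=\max\Big\{2,\Big\lceil\frac{48\beta\Delta_\lambda}{\epsilon^2}\Big\rceil\Big\},$$ and $K\ge2$ an integer with $U_K(m,G_H,1/(6T))\le e_*$, where $U_K$, $G_H$, $e_*$ are defined in the context. Then $T=O(1+\beta\Delta_\lambda/\epsilon^2)$, $K$ can be chosen with $K=\widetilde O(\epsilon^{-2})$ for fixed problem parameters, and with these choices the following holds. The output $\hat x$ is exactly feasible, $\hat x\in\mathcal C$. With probability at least $2/3$, the final projection is unique (i.e. $\mathcal P_{\mathcal C}(x_J)$ is a single point), $\mathcal R_{\lambda,\beta}(x_J)\le\epsilon$, and there exist $y\in\mathcal C$, $v\in\partial f(y)$ and $\mu\in[0,\lambda]$ such that $$\|\hat x-y\|\le\frac{2\epsilon}{\beta},\qquad \|v+\mu\nabla g(y)\|\le\epsilon,\qquad \mu g(y)=0.$$ For fixed problem parameters, the algorithm uses $TK=\widetilde O(\epsilon^{-4})$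 stochastic subgradients and exactly one projection onto $\mathcal C$.
   Context: All norms are Euclidean; $[u]_+=\max\{u,0\}$; $\mathcal P_D(x)=\operatorname{argmin}_{y\in D}\|y-x\|$ is the (possibly set-valued) Euclidean projection. $\partial$ denotes the limiting subdifferential and $N_D$ the limiting normal cone. A function is $\ell$-weakly convex if adding $\frac{\ell}{2}\|\cdot\|^2$ makes it convex. $\widetilde O$ hides polylogarithmic factors in $1/\epsilon$; ''fixed problem parameters'' means all of $\ell,G_f,L_g,G_g,\sigma_{\rm bd},\sigma_{\rm out},\lambda,\beta,\Delta_\lambda$ are held fixed. Algorithm (Penalized Proximal Subgradient Method with One Projection). Inputs: $x_0\in\mathcal B$, integers $T,K\ge2$, penalty $p$, index set $\mathcal I$, and $\beta,m>0$ such that each $H_t$ below is $m$-strongly convex on $\mathcal B$. For $t=0,\dots,T-1$: form $H_t(z)=f(z)+p(g(z))+\frac{\beta}{2}\|z-x_t\|^2$ and set $x_{t+1}=\mathrm{PSM}(H_t,x_t)$. Then sample $J$ uniformly from $\mathcal I$ (independently of everything else) and return an exact nearest point $\hat x\in\mathcal P_{\mathcal C}(x_J)$. Subroutine $\mathrm{PSM}(H_t,x_t)$: set $z_1=x_t$. For $s=1,\dots,K$: set $\eta_s=2/[m(s+1)]$, query $\widetilde v(z_s;\xi_s)$ with fresh $\xi_s$, set $h_s=\widetilde v(z_s;\xi_s)+\beta(z_s-x_t)+w_s$, where $w_s=\lambda\nabla g(z_s)$ if $g(z_s)>0$ and $w_s=0$ if $g(z_s)\le0$, and $z_{s+1}=\mathcal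 P_{\mathcal B}(z_s-\eta_sh_s)$. Return $K^{-1}\sum_{s=1}^Kz_s$. Constants: $G_H=G_f+\lambda G_g+2\beta$, $$U_K(m,G,\delta)=\frac{m+(G^2/m)\{\log(K+1)+2\log(1/\delta)\}}{K},\qquad e_*=\frac{\epsilon^2}{48\beta(1+\beta/m)}.$$ *)

(* Defs.v *)
From HB Require Import structures.
From mathcomp Require Import all_boot all_order all_algebra.
From mathcomp Require Import all_classical all_reals all_analysis.

Set Implicit Arguments.
Unset Strict Implicit.
Unset Printing Implicit Defensive.

Import Order.TTheory GRing.Theory Num.Theory.
Import numFieldNormedType.Exports.

Local Open Scope classical_set_scope.
Local Open Scope ring_scope.

Section euclidean_geometry.
Context {R : realType} {d : nat}.
Local Notation vec := ('rV[R]_d).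

Definition dot (u v : vec) : R := \sum_i u 0 i * v 0 i.

(* The library norm of ['rV[R]_d] is the sup norm. It is used only through the
   topology, which is the Euclidean one; all metric quantities use [enorm]. *)
Definition enorm (u : vec) : R := Num.sqrt (dot u u).

Definition unit_ball : set vec := [set x | enorm x <= 1].

Definition argmin (D : set vec) (h : vec -> R) : set vec :=
  [set y | D y /\ forall z, D z -> h y <= h z].

Definition is_min (D : set vec) (h : vec -> R) (a : R) : Prop :=
  (h @` D) a /\ lbound (h @` D) a.

Definition is_max (D : set vec) (h : vec -> R) (a : R) : Prop :=
  (h @` D) a /\ ubound (h @` D) a.

Definition eproj (D : set vec) (x : vec) : set vec :=
  argmin D (fun y => enorm (y - x)).

Definition edist_set (x : vec) (S : set vec) : R := inf [set enorm (x - y) | y in S].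

Definition lipschitz_fun (U : set vec) (L : R) (h : vec -> R) : Prop :=
  forall x y, U x -> U y -> `|h x - h y| <= L * enorm (x - y).

Definition lipschitz_map (U : set vec) (L : R) (h : vec -> vec) : Prop :=
  forall x y, U x -> U y -> enorm (h x - h y) <= L * enorm (x - y).

Definition weakly_convex (U : set vec) (l : R) (h : vec -> R) : Prop :=
  convex_function U (fun x => h x + l / 2 * enorm x ^+ 2).

Definition strongly_convex (U : set vec) (m : R) (h : vec -> R) : Prop :=
  convex_function U (fun x => h x - m / 2 * enorm x ^+ 2).

Definition grad (h : vec -> R) (x : vec) : vec :=
  \row_i 'D_(delta_mx 0 i) h x.

Definition C1_on (U : set vec) (h : vec -> R) : Prop :=
  forall x, U x -> differentiable h x /\ {for x, continuous (grad h)}.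

Definition regular_subdiff (h : vec -> R) (x : vec) : set vec :=
  [set v | forall e : R, 0 < e ->
     \forall y \near x, h x + dot v (y - x) - e * enorm (y - x) <= h y].

Definition limiting_subdiff (h : vec -> R) (x : vec) : set vec :=
  [set v | exists xs vs : nat -> vec,
     [/\ forall n, regular_subdiff h (xs n) (vs n),
         xs @ \oo --> x, h (xs n) @[n --> \oo] --> h x & vs @ \oo --> v]].

Definition regular_normal (D : set vec) (x : vec) : set vec :=
  [set v | D x /\ forall e : R, 0 < e ->
     \forall y \near x, D y -> dot v (y - x) <= e * enorm (y - x)].

Definition limiting_normal (D : set vec) (x : vec) : set vec :=
  [set v | D x /\ exists xs vs : nat -> vec,
     [/\ forall n, regular_normal D (xs n) (vs n),
         xs @ \oo --> x & vs @ \oo --> v]].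

End euclidean_geometry.

Section penalized_problem.
Context {R : realType} {d : nat}.
Local Notation vec := ('rV[R]_d).
Variables (f g : vec -> R) (lam beta : R).

Definition feasible : set vec := [set x | g x <= 0].

Definition Psi (x : vec) : R := f x + lam * Num.max (g x) 0.

Definition prox_obj (x z : vec) : R := Psi z + beta / 2 * enorm (z - x) ^+ 2.

Definition prox_point (x : vec) : vec := get (argmin unit_ball (prox_obj x)).

Definition prox_residual (x : vec) : R := beta * enorm (x - prox_point x).

End penalized_problem.

(* A program with two external operations: a query of the stochastic subgradient
   oracle and an exact projection onto the feasible set. *)
Inductive prog (V A : Type) : Type :=
| Ret of A
| Query of V & (V -> prog V A)
| Project of V & (V -> prog V A).
Arguments Ret {V A} _.

Fixpoint bind {V A B : Type} (p : prog V A) (k : A -> prog V B) : prog V B :=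
  match p with
  | Ret a => k a
  | Query z c => Query z (fun u => bind (c u) k)
  | Project z c => Project z (fun u => bind (c u) k)
  end.

(* [run answer pC p nq np] executes [p] after [nq] queries and [np] projections,
   and returns the result with the updated counts. The query number [n] (counted
   from 0) at the point [z] is answered by [answer n z]. *)
Fixpoint run {V A : Type} (answer : nat -> V -> V) (pC : V -> V)
    (p : prog V A) (nq np : nat) : A * (nat * nat) :=
  match p with
  | Ret a => (a, (nq, np))
  | Query z c => run answer pC (c (answer nq z)) nq.+1 np
  | Project z c => run answer pC (c (pC z)) nq np.+1
  end.

Section algorithm.
Context {R : realType} {d : nat}.
Local Notation vec := ('rV[R]_d).
Variables (g : vec -> R) (lam beta m : R) (K : nat).

Definition proj_ball (x : vec) : vec := get (eproj unit_ball x).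

Definition penalty_dir (z : vec) : vec :=
  if 0 < g z then lam *: grad g z else 0.

Definition step_size (s : nat) : R := 2 / (m * (s.+1)%:R).

(* [n] steps remain, [s] is the number of the current step, [z] is the current
   point and [acc] is the sum of the previous points. *)
Fixpoint psm_loop (xt : vec) (n s : nat) (z acc : vec) : prog vec vec :=
  if n is n'.+1 then
    Query z (fun a =>
      let h := a + beta *: (z - xt) + penalty_dir z in
      psm_loop xt n' s.+1 (proj_ball (z - step_size s *: h)) (acc + z))
  else Ret (K%:R^-1 *: acc).

Definition psm (xt : vec) : prog vec vec := psm_loop xt K 1 xt 0.

Fixpoint outer_loop (n : nat) (x : vec) (past : seq vec) : prog vec (seq vec) :=
  if n is n'.+1 then
    bind (psm x) (fun x' => outer_loop n' x' (rcons past x'))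
  else Ret past.

(* The result is the pair of the sampled iterate [x_j] and its projection. *)
Definition penalized_psm (T : nat) (x0 : vec) (j : nat) : prog vec (vec * vec) :=
  bind (outer_loop T x0 [:: x0]) (fun xs =>
    Project (nth x0 xs j) (fun xhat => Ret (nth x0 xs j, xhat))).

End algorithm.

Section randomness.
Context {R : realType} {d : nat}.
Local Notation vec := ('rV[R]_d).
Local Notation borel_vec := (g_sigma_algebraType (@open vec)).
Context {dO dX : measure_display} {Omega : measurableType dO}
  {Xi : measurableType dX} (P : probability Omega R).

(* Generators of the sigma-algebra of the random seeds with index in [I]. *)
Definition seed_events (xi : nat -> Omega -> Xi) (I : set nat) : set (set Omega) :=
  \bigcup_(i in I) preimage_set_system setT (xi i) measurable.

(* What is known before query number [n]. *)
Definition history (xi : nat -> Omega -> Xi) (n : nat) : set (set Omega) :=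
  seed_events xi [set i | (i < n)%N].

(* [V] is a version of the conditional expectation of [Y] given the
   sigma-algebra generated by [G]. *)
Definition is_cond_exp (G : set (set Omega)) (Y V : Omega -> R) : Prop :=
  [/\ P.-integrable setT (EFin \o Y),
      P.-integrable setT (EFin \o V),
      measurable_fun [set: g_sigma_algebraType G] V &
      forall A, G.-sigma.-measurable A ->
        (\int[P]_(w in A) (Y w)%:E = \int[P]_(w in A) (V w)%:E)%E].

(* Query number [n] uses the seed [xi n]. A query point may be any random point
   of the ball that is measurable for the past history. *)
Definition stochastic_oracle (f : vec -> R) (Gf : R) (vt : vec -> Xi -> vec)
    (xi : nat -> Omega -> Xi) (v : vec -> vec) : Prop :=
  [/\ forall n, measurable_fun [set: Omega] (xi n),
      measurable_fun [set: borel_vec * Xi]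
        ((fun p => vt p.1 p.2) : borel_vec * Xi -> borel_vec),
      forall x, unit_ball x -> limiting_subdiff f x (v x) &
      forall (n : nat) (X : Omega -> vec),
        measurable_fun [set: g_sigma_algebraType (history xi n)]
          (X : g_sigma_algebraType (history xi n) -> borel_vec) ->
        (forall w, unit_ball (X w)) ->
        (forall i, is_cond_exp (history xi n)
           (fun w => vt (X w) (xi n w) 0 i) (fun w => v (X w) 0 i)) /\
        {ae P, forall w, enorm (vt (X w) (xi n w)) <= Gf}].

Definition uniform_index (T : nat) (J : Omega -> 'I_T) : Prop :=
  forall j, measurable (J @^-1` [set j]) /\
    P (J @^-1` [set j]) = (T%:R^-1)%:E.

Definition index_indep_of_seeds (T : nat) (J : Omega -> 'I_T)
    (xi : nat -> Omega -> Xi) : Prop :=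
  forall j A, (seed_events xi setT).-sigma.-measurable A ->
    P (J @^-1` [set j] `&` A) = (P (J @^-1` [set j]) * P A)%E.

End randomness.

Section constants.
Context {R : realType}.

Definition G_H (Gf Gg lam beta : R) : R := Gf + lam * Gg + 2 * beta.

Definition U_ (K : nat) (m G delta : R) : R :=
  (m + G ^+ 2 / m * (ln (K%:R + 1) + 2 * ln (1 / delta))) / K%:R.

Definition e_star (m beta eps : R) : R := eps ^+ 2 / (48 * beta * (1 + beta / m)).

Definition T_outer (beta Delta eps : R) : nat :=
  maxn 2 `|Num.ceil (48 * beta * Delta / eps ^+ 2)|%N.

(* [1 + log (1/eps)] rather than [log (1/eps)], which vanishes as eps tends to 1. *)
Definition polylog (C : R) (q : nat) (eps : R) : R := C * (1 + ln (1 / eps)) ^+ q.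

End constants.

(* Main.v *)
Require Import Defs.
From mathcomp Require Import all_boot all_order all_algebra.
From mathcomp Require Import all_classical all_reals all_analysis.
From mathcomp Require Import measurable_realfun ring lra.

Set Implicit Arguments.
Unset Strict Implicit.
Unset Printing Implicit Defensive.

Import Order.TTheory GRing.Theory Num.Theory.
Import numFieldNormedType.Exports.
Local Open Scope classical_set_scope.
Local Open Scope ring_scope.

(* Weak convexity of f and the Lipschitz gradient of g make every proximal
   objective m-strongly convex, so each inner loop is a projected stochastic
   subgradient method for a strongly convex function. With steps 2/(m(s+1)) the
   regret inequality keeps a negative term -(m/4) sum |z_s - z*|^2, and this
   absorbs exactly the conditional Hoeffding exponent of the noise
   sum <v_s - v~_s, z_s - z*> at theta = m/(2 G_f^2): the resulting exponential is
   a supermartingale, and Markov's inequality gives the bound U_K(m, G_H, delta).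

   When all T inner solves are e_*-accurate, beta/4 |x_t - Q(x_t)|^2 is at most
   Psi(x_t) - Psi(x_{t+1}) + e_*(1 + beta/m), so the mean squared residual is at
   most eps^2/6 and all but a sixth of the indices have residual at most eps.
   The sampled index is independent of the seeds, hence the probability is at
   least (5/6)^2 >= 2/3.

   If the residual at x is at most eps, then y = Q(x) is feasible (otherwise the
   descent of lambda g beats the Lipschitz constant of f), hence interior to the
   ball, and a one-dimensional exact-penalty duality produces the multiplier mu.
   Since |x - y| < sigma_bd / L_g, the projection of x onto C is unique. *)

(** * Euclidean geometry of row vectors *)

(** Three obstacles shape the argument. The selection [v] carries no measurability of its own, and
    the conditional expectation of the oracle is known only through integrals over events of the
    history. The Hoeffding step therefore uses a bound that is affine in the answer, and asks of
    conditional expectation only that bounded history-measurable factors pass through it. That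
    pull-out property is proved directly, by scaling a crude approximation with error 1.

    The index is independent of the seeds alone, so every event combined with it has to lie in the
    sigma-algebra of the seeds. This is why continuity of the proximal map and of the projection
    onto the ball is established, and why functions that are regular only on [U] need a separate
    composition lemma.

    The probabilistic part ends with an event described by the residual alone. Uniqueness of the
    projection, feasibility of the proximal point and the multiplier are deterministic consequences,
    valid at every outcome of that event. *)

Section euclidean_space.
Context {R : realType} {d : nat}.
Local Notation vec := ('rV[R]_d).
Implicit Types (u v w x y z : vec) (a b c t : R).

Lemma dotC u v : dot u v = dot v u.
Proof. by apply: eq_bigr => i _; rewrite mulrC. Qed.

Lemma dotDl u v w : dot (u + v) w = dot u w + dot v w.
Proof. by rewrite -big_split; apply: eq_bigr => i _; rewrite mxE mulrDl. Qed.

Lemma dotZl a u v : dot (a *: u) v = a * dot u v.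
Proof. by rewrite mulr_sumr; apply: eq_bigr => i _; rewrite mxE mulrA. Qed.

Lemma dotNl u v : dot (- u) v = - dot u v.
Proof. by rewrite -scaleN1r dotZl mulN1r. Qed.

Lemma dotDr u v w : dot w (u + v) = dot w u + dot w v.
Proof. by rewrite dotC dotDl !(dotC _ w). Qed.

Lemma dotZr a u v : dot u (a *: v) = a * dot u v.
Proof. by rewrite dotC dotZl dotC. Qed.

Lemma dotNr u v : dot u (- v) = - dot u v.
Proof. by rewrite dotC dotNl dotC. Qed.

Lemma dot0l u : dot 0 u = 0.
Proof. by rewrite -(scale0r u) dotZl mul0r. Qed.

Lemma dot0r u : dot u 0 = 0.
Proof. by rewrite dotC dot0l. Qed.

Definition dotE := (dotDl, dotDr, dotZl, dotZr, dotNl, dotNr, dot0l, dot0r).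

Lemma dot_ge0 u : 0 <= dot u u.
Proof. by apply: sumr_ge0 => i _; rewrite -expr2 sqr_ge0. Qed.

Lemma dot_eq0 u : dot u u = 0 -> u = 0.
Proof.
move=> /eqP; rewrite psumr_eq0 => [|i _]; last by rewrite -expr2 sqr_ge0.
move=> /allP u0; apply/rowP => i; rewrite mxE; apply/eqP.
by have := u0 i (mem_index_enum _); rewrite -expr2 sqrf_eq0.
Qed.

Lemma enorm_sqr u : enorm u ^+ 2 = dot u u.
Proof. by rewrite sqr_sqrtr // dot_ge0. Qed.

Lemma enorm_ge0 u : 0 <= enorm u.
Proof. exact: sqrtr_ge0. Qed.

Lemma enorm_eq0 u : enorm u = 0 -> u = 0.
Proof. by move=> u0; apply: dot_eq0; rewrite -enorm_sqr u0 expr0n. Qed.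

Lemma enorm0 : enorm (0 : vec) = 0.
Proof. by rewrite /enorm dot0l sqrtr0. Qed.

Lemma enormZ a u : enorm (a *: u) = `|a| * enorm u.
Proof.
by rewrite /enorm dotZl dotZr mulrA -expr2 sqrtrM ?sqr_ge0 // sqrtr_sqr.
Qed.

Lemma enormN u : enorm (- u) = enorm u.
Proof. by rewrite -scaleN1r enormZ normrN1 mul1r. Qed.

Lemma enormB u v : enorm (u - v) = enorm (v - u).
Proof. by rewrite -enormN opprB. Qed.

Lemma enorm_leP u a : 0 <= a -> (enorm u <= a) = (dot u u <= a ^+ 2).
Proof. by move=> a0; rewrite -enorm_sqr ler_pXn2r // ?nnegrE ?enorm_ge0. Qed.

Lemma dot_cauchy_schwarz u v : dot u v <= enorm u * enorm v.
Proof.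
have [u0|u0] := eqVneq (enorm u) 0.
  by rewrite (enorm_eq0 u0) dot0l enorm0 mul0r.
have [v0|v0] := eqVneq (enorm v) 0.
  by rewrite (enorm_eq0 v0) dot0r enorm0 mulr0.
have up : 0 < enorm u by rewrite lt_neqAle eq_sym u0 enorm_ge0.
have vp : 0 < enorm v by rewrite lt_neqAle eq_sym v0 enorm_ge0.
have := dot_ge0 (enorm v *: u - enorm u *: v).
rewrite !dotE -!enorm_sqr (dotC v u).
move: (enorm u) (enorm v) (dot u v) up vp => a b s ap bp H.
have : 0 <= (2 * (a * b)) * (a * b - s) by move: H; nra.
by rewrite pmulr_rge0 ?mulr_gt0 // subr_ge0.
Qed.

Lemma normr_dot_le u v : `|dot u v| <= enorm u * enorm v.
Proof.
rewrite ler_norml dot_cauchy_schwarz andbT.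
by have := dot_cauchy_schwarz (- u) v; rewrite dotNl enormN; lra.
Qed.

Lemma enormD_le u v : enorm (u + v) <= enorm u + enorm v.
Proof.
rewrite enorm_leP ?addr_ge0 ?enorm_ge0 // !dotE -!enorm_sqr (dotC v u).
have := dot_cauchy_schwarz u v; nra.
Qed.

Lemma enormB_le u v w : enorm (u - v) <= enorm (u - w) + enorm (w - v).
Proof. by have := enormD_le (u - w) (w - v); rewrite addrA subrK. Qed.

Lemma normr_coord_le u i : `|u 0 i| <= enorm u.
Proof.
rewrite -[leLHS]sqrtr_sqr /enorm ler_sqrt ?dot_ge0 // /dot (bigD1 i) //= expr2.
by rewrite lerDl; apply: sumr_ge0 => j _; rewrite -expr2 sqr_ge0.
Qed.

(** The squared norm has its convexity defect with equality, so adding a multiple of it shifts a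
    curvature constant exactly; this identifies weak and strong convexity with [semiconvex]. *)
Lemma enorm_conv2 t u v :
  dot (t *: u + (1 - t) *: v) (t *: u + (1 - t) *: v)
  = t * dot u u + (1 - t) * dot v v - t * (1 - t) * dot (u - v) (u - v).
Proof. rewrite !dotE (dotC v u); ring. Qed.

Lemma cvg_coord {T : Type} {F : set_system T} {FF : Filter F} (x : T -> vec) (l : vec) i :
  x @ F --> l -> x t 0 i @[t --> F] --> l 0 i.
Proof.
move=> xl; apply: (cvg_comp x (fun u : vec => u 0 i) xl).
exact: coord_continuous.
Qed.

Lemma cvg_dot {T : Type} {F : set_system T} {FF : Filter F} (x y : T -> vec) (l k : vec) :
  x @ F --> l -> y @ F --> k -> dot (x t) (y t) @[t --> F] --> dot l k.
Proof.
move=> xl yk; apply: cvg_big => [|i _]; first exact: add_continuous.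
by apply: cvgM; apply: cvg_coord.
Qed.

Lemma cvg_enorm {T : Type} {F : set_system T} {FF : Filter F} (x : T -> vec) (l : vec) :
  x @ F --> l -> enorm (x t) @[t --> F] --> enorm l.
Proof.
move=> xl; have H : {for (dot l l), continuous (@Num.sqrt R)}.
  exact: sqrt_continuous.
exact: (continuous_cvg FF H (cvg_dot xl xl)).
Qed.

Lemma mx_norm_le_enorm u : `|u| <= enorm u.
Proof.
rewrite (_ : `|u| = mx_norm u) // mx_normrE; apply/bigmax_leP; split.
  exact: enorm_ge0.
by move=> [i j] _ /=; rewrite (ord1 i) normr_coord_le.
Qed.

(** One direction uses that the sup norm is below the Euclidean one, the other the continuity of
    [enorm], so no norm-equivalence constant depending on [d] appears. *)
Lemma nbhs_enormP x (A : set vec) :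
  nbhs x A <-> exists2 e : R, 0 < e & forall y, enorm (y - x) < e -> A y.
Proof.
split=> [/nbhs_normP [e e0 eA]|[e e0 eA]].
  exists e => // y yx; apply: eA; rewrite /ball_ /= .
  by rewrite (le_lt_trans (mx_norm_le_enorm _)) // enormB.
have : enorm (y - x) @[y --> x] --> enorm (x - x).
  have H : (fun y : vec => y - x) @ x --> x - x.
    by apply: (@cvgB R vec vec (nbhs x)); [exact: cvg_id | exact: cvg_cst].
  exact: (cvg_enorm H).
rewrite subrr enorm0 => /cvgr_lt /(_ _ e0) He.
by apply: filterS He => y; exact: eA.
Qed.

Lemma cvg_enormP {T : Type} {F : set_system T} {FF : Filter F} (x : T -> vec) (l : vec) :
  enorm (x t - l) @[t --> F] --> (0 : R) -> x @ F --> l.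
Proof.
move=> H; apply/cvgrPdist_lt => e e0.
move/cvgr_lt : H => /(_ e e0) H; near=> t.
rewrite distrC (le_lt_trans (mx_norm_le_enorm _)) //; near: t; exact: H.
Unshelve. all: by end_near. Qed.

End euclidean_space.

(** * Semiconvex functions and subgradients *)

(** Stands in for the limit as [t] tends to 0: a variation inequality is divided by [t], and its
    remainder of order [t] is then discarded. *)
Lemma le_of_small_perturbation {R : realFieldType} (a b c t0 : R) : 0 < t0 ->
  (forall t, 0 < t -> t < t0 -> a <= b + t * c) -> a <= b.
Proof.
move=> t00 H; rewrite leNgt; apply/negP => ba.
pose t := Num.min (t0 / 2) ((a - b) / (2 * (`|c| + 1))).
have c1 : 0 < `|c| + 1 by rewrite ltr_wpDl.
have t_gt0 : 0 < t by rewrite lt_min !divr_gt0 ?mulr_gt0 ?subr_gt0.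
have t_lt : t < t0.
  apply: (@le_lt_trans _ _ (t0 / 2)); last by lra.
  by rewrite /t ge_min lexx.
have tc : t * (`|c| + 1) <= (a - b) / 2.
  have -> : (a - b) / 2 = (a - b) / (2 * (`|c| + 1)) * (`|c| + 1).
    by field; rewrite gt_eqF.
  by apply: ler_wpM2r; [exact: ltW | rewrite /t ge_min lexx orbT].
have := H t t_gt0 t_lt; have := ler_norm c; nra.
Qed.

Section semiconvexity.
Context {R : realType} {d : nat}.
Local Notation vec := ('rV[R]_d).
Implicit Types (U : set vec) (h : vec -> R) (x y z v w : vec) (t l : R).

(* For [l < 0] this is strong convexity of modulus [- l]. *)
Definition semiconvex U l h := forall x y t, U x -> U y -> 0 <= t -> t <= 1 ->
  h (t *: x + (1 - t) *: y) <=
    t * h x + (1 - t) * h y + l / 2 * (t * (1 - t)) * dot (x - y) (x - y).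

Lemma convex_setE U x y t : convex_set U -> U x -> U y -> 0 <= t -> t <= 1 ->
  U (t *: x + (1 - t) *: y).
Proof.
move=> cU Ux Uy t0 t1.
by have := cU x y (Itv01 t0 t1); rewrite !inE => /(_ Ux Uy).
Qed.

Lemma convex_segment U x y t : convex_set U -> U x -> U y -> 0 <= t -> t <= 1 ->
  U (x + t *: (y - x)).
Proof.
move=> cU Ux Uy t0 t1; rewrite (_ : _ + _ = t *: y + (1 - t) *: x).
  exact: convex_setE.
by apply/rowP => i; rewrite !mxE; ring.
Qed.

Lemma weakly_convexP U l h : weakly_convex U l h <-> semiconvex U l h.
Proof.
split=> [H x y t Ux Uy t0 t1|H t x y].
  have := H (Itv01 t0 t1) x y; rewrite !inE => /(_ Ux Uy); rewrite convRE.
  rewrite (_ : conv _ _ _ = (t *: x + (1 - t) *: y : convex_lmodType vec)) // !enorm_sqr enorm_conv2.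
  rewrite /unstable.onem /=; lra.
rewrite !inE => Ux Uy; rewrite convRE.
have t0 : 0 <= t%:num by [].
have t1 : t%:num <= 1 by [].
rewrite (_ : conv _ _ _ = (t%:num *: x + (1 - t%:num) *: y : convex_lmodType vec)) // !enorm_sqr.
have := H x y t%:num Ux Uy t0 t1.
rewrite enorm_conv2 /unstable.onem /=; lra.
Qed.

Lemma strongly_convexP U m h : strongly_convex U m h <-> semiconvex U (- m) h.
Proof.
rewrite -weakly_convexP /strongly_convex /weakly_convex.
have -> // : (fun x => h x - m / 2 * enorm x ^+ 2) =
  (fun x => h x + - m / 2 * enorm x ^+ 2).
by apply: funext => x; ring.
Qed.

Lemma unit_ball_convex x y t : unit_ball x -> unit_ball y -> 0 <= t -> t <= 1 ->
  unit_ball (t *: x + (1 - t) *: y).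
Proof.
rewrite /unit_ball /= => Bx By t0 t1; apply: le_trans (enormD_le _ _) _.
rewrite !enormZ !ger0_norm ?subr_ge0 //.
have : t * enorm x <= t * 1 by rewrite ler_wpM2l.
have : (1 - t) * enorm y <= (1 - t) * 1 by rewrite ler_wpM2l // subr_ge0.
lra.
Qed.

Lemma unit_ball_segment x y t : unit_ball x -> unit_ball y -> 0 <= t -> t <= 1 ->
  unit_ball (x + t *: (y - x)).
Proof.
move=> Ux Uy t0 t1; rewrite (_ : _ + _ = t *: y + (1 - t) *: x).
  exact: unit_ball_convex.
by apply/rowP => i; rewrite !mxE; ring.
Qed.

Lemma semiconvex_segment U l h x z t : semiconvex U l h ->
  U x -> U z -> 0 <= t -> t <= 1 ->
  h (x + t *: (z - x)) <=
    h x + t * (h z - h x) + l / 2 * (t * (1 - t)) * dot (z - x) (z - x).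
Proof.
move=> H Ux Uz t0 t1; have := H z x t Uz Ux t0 t1.
rewrite (_ : x + _ = t *: z + (1 - t) *: x); first lra.
by apply/rowP => i; rewrite !mxE; ring.
Qed.

(** Curvature along one segment turns a lower bound valid near [x] into one at [z]. The local bound
    is required on this segment only, so the lemma serves subgradients as well as constrained
    minimizers, the latter with [v = 0]. *)
Lemma semiconvex_local_minorant U l h (x z v : vec) : semiconvex U l h ->
  U x -> U z ->
  (forall e, 0 < e -> exists2 del : R, 0 < del & forall t,
     0 < t -> t < del ->
     h x + t * dot v (z - x) - e * t <= h (x + t *: (z - x))) ->
  h x + dot v (z - x) - l / 2 * dot (z - x) (z - x) <= h z.
Proof.
move=> H Ux Uz loc.
apply: (@le_of_small_perturbation _ _ _ 1 1) => // e e0 _.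
have [del del0 Hd] := loc e e0.
apply: (@le_of_small_perturbation _ _ _
  (- (l / 2 * dot (z - x) (z - x))) (Num.min del 1)) => [|t t0].
  by rewrite lt_min del0 ltr01.
rewrite lt_min => /andP [td t1].
have H1 := Hd t t0 td.
have H2 := semiconvex_segment H Ux Uz (ltW t0) (ltW t1).
have {H1 H2} := le_trans H1 H2.
move: (h x) (h z) (dot v _) (dot (z - x) _) => a b p q.
move=> H1.
have H3 : 0 <= t * (b + e + t * (- (l / 2 * q)) - (a + p - l / 2 * q)) by nra.
by rewrite pmulr_rge0 // subr_ge0 in H3; lra.
Qed.

Lemma regular_subdiff_ineq U l h x z v : semiconvex U l h -> U x -> U z ->
  regular_subdiff h x v ->
  h x + dot v (z - x) - l / 2 * dot (z - x) (z - x) <= h z.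
Proof.
move=> H Ux Uz vx; apply: (semiconvex_local_minorant H Ux Uz) => e e0.
have N0 := enorm_ge0 (z - x); have N1 : 0 < enorm (z - x) + 1 by lra.
(* The error of a regular subgradient is proportional to the displacement [t * enorm (z - x)], hence
   the rescaled tolerance; the added 1 covers [z = x]. *)
have /nbhs_enormP [del del0 Hd] := vx _ (divr_gt0 e0 N1).
exists (del / (enorm (z - x) + 1)); first exact: divr_gt0.
move=> t t0; rewrite ltr_pdivlMr // => td.
have := Hd (x + t *: (z - x)); rewrite addrAC subrr add0r enormZ gtr0_norm //.
rewrite dotZr => Hz.
have et : e / (enorm (z - x) + 1) * (t * enorm (z - x)) <= e * t.
  rewrite mulrAC ler_pdivrMr //.
  move: (enorm _) N0 => a a0; have := mulr_gt0 e0 t0; nra.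
apply: le_trans (Hz _); [lra | nra].
Qed.

(** The global inequality is continuous in the point, the value and the subgradient, so it passes to
    limits of regular subgradients; openness of [U] keeps the approximating points inside. *)
Lemma limiting_subdiff_ineq U l h x z v : open U -> semiconvex U l h ->
  U x -> U z -> limiting_subdiff h x v ->
  h x + dot v (z - x) - l / 2 * dot (z - x) (z - x) <= h z.
Proof.
move=> oU H Ux Uz [xs [vs [reg xsx hx vsv]]].
have zx : (fun n => z - xs n) @ \oo --> z - x.
  exact: (@cvgB R vec nat \oo _ (fun=> z) xs z x (cvg_cst z) xsx).
have lim : h (xs n) + dot (vs n) (z - xs n)
    - l / 2 * dot (z - xs n) (z - xs n) @[n --> \oo] -->
  h x + dot v (z - x) - l / 2 * dot (z - x) (z - x).
  apply: cvgB; first by apply: cvgD => //; exact: (cvg_dot vsv zx).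
  apply: cvgM; first exact: cvg_cst.
  exact: (cvg_dot zx zx).
apply: (cvgr_to_le lim).
have nU : nbhs x U by exact: open_nbhs_nbhs.
have : \forall n \near \oo, U (xs n) by exact: xsx.
apply: filterS => n Un; exact: (regular_subdiff_ineq H Un Uz (reg n)).
Qed.

(** The inequality is tested at [x + t *: v], where curvature costs only order [t ^ 2]. Hoeffding's
    lemma needs this bound for the true subgradients, besides the bound on the oracle answers. *)
Lemma limiting_subdiff_bound U l G h x v : open U -> semiconvex U l h ->
  lipschitz_fun U G h -> 0 <= G -> U x -> limiting_subdiff h x v -> enorm v <= G.
Proof.
move=> oU H lip G0 Ux vx.
have /nbhs_enormP [del del0 Hd] : nbhs x U by exact: open_nbhs_nbhs.
have N0 := enorm_ge0 v; have N1 : 0 < enorm v + 1 by lra.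
apply: (@le_of_small_perturbation _ _ _ (l / 2 * enorm v)
  (del / (enorm v + 1))); first exact: divr_gt0.
move=> t t0; rewrite ltr_pdivlMr // => td.
have [->|v0] := eqVneq v 0; first by rewrite enorm0; nra.
have vp : 0 < enorm v.
  by rewrite lt_neqAle N0 andbT eq_sym; apply: contra v0 => /eqP /enorm_eq0 ->.
have Uz : U (x + t *: v).
  by apply: Hd; rewrite addrAC subrr add0r enormZ gtr0_norm //; nra.
have := limiting_subdiff_ineq oU H Ux Uz vx.
have := le_trans (ler_norm _) (lip _ _ Uz Ux).
rewrite addrAC subrr add0r enormZ gtr0_norm // !dotZr !dotZl -!enorm_sqr => H1 H2.
move: (enorm v) (h (x + _)) (h x) vp H1 H2 => a p q ap H1 H2.
have : 0 <= (t * a) * (G + t * (l / 2 * a) - a) by nra.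
by rewrite pmulr_rge0 ?mulr_gt0 // subr_ge0.
Qed.

Lemma regular_limiting_subdiff h x v :
  regular_subdiff h x v -> limiting_subdiff h x v.
Proof.
move=> vx; exists (fun=> x), (fun=> v); split => //; exact: cvg_cst.
Qed.

Lemma regular_limiting_normal D x v :
  regular_normal D x v -> limiting_normal D x v.
Proof.
move=> vx; split; first by case: vx.
exists (fun=> x), (fun=> v); split => //; exact: cvg_cst.
Qed.

End semiconvexity.

(** * Gradients, and calculus of curvature moduli *)

Section gradient.
Context {R : realType} {d : nat}.
Local Notation vec := ('rV[R]_d).
Implicit Types (U : set vec) (g h : vec -> R) (x y z v w : vec) (t l L : R).

Lemma derive_grad g x w : differentiable g x -> 'D_w g x = dot (grad g x) w.
Proof.
move=> dg; rewrite deriveE // {1}(row_sum_delta w) linear_sum /= /dot.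
apply: eq_bigr => i _; rewrite linearZ /= mxE deriveE // mulrC; congr (_ * _).
Qed.

Lemma is_derive_line g x w t : differentiable g (x + t *: w) ->
  is_derive t 1 (fun s : R => g (x + s *: w)) (dot (grad g (x + t *: w)) w).
Proof.
move=> dg.
have E : (fun h : R => h^-1 *: ((fun s : R => g (x + s *: w)) (h *: 1 + t)
             - g (x + t *: w)))
       = (fun h : R => h^-1 *: (g (h *: w + (x + t *: w)) - g (x + t *: w))).
  apply: funext => h; congr (_ *: (g _ - _)).
  by apply/rowP => i; rewrite !mxE /GRing.scale /=; ring.
have dgw := @diff_derivable _ _ _ g _ w dg.
apply: DeriveDef; first by rewrite /derivable /= E.
by rewrite /derive /= E -derive_grad.
Qed.

(** The mean value theorem applied to [psi], the difference between [phi] and its quadratic model,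
    instead of integrating the derivative. *)
Lemma quadratic_minorant_of_derivative (phi dphi : R -> R) (c : R) :
  (forall t, 0 <= t <= 1 -> is_derive t 1 phi (dphi t)) ->
  (forall t, 0 <= t <= 1 -> dphi 0 - c * t <= dphi t) ->
  phi 0 + dphi 0 - c / 2 <= phi 1.
Proof.
move=> D B.
pose psi s := phi s + (c / 2 * s ^+ 2 - dphi 0 * s).
have Dpsi t : 0 <= t <= 1 -> is_derive t 1 psi (dphi t + (c * t - dphi 0)).
  move=> t01; have Dt := D t t01.
  have -> : dphi t + (c * t - dphi 0) = dphi t +
    (((c / 2) *: ((2%:R * t ^+ 1) *: (1 : R)) : R) - dphi 0 *: (1 : R)).
    rewrite /GRing.scale /=; lra.
  have -> : psi = phi \+ (((c / 2) \*: ((@id R) ^+ 2)) - (dphi 0 \*: (@id R))).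
    by apply: funext => s.
  exact: is_deriveD.
have cpsi : {within `[0, 1], continuous psi}.
  apply: derivable_within_continuous => t; rewrite in_itv /= => t01.
  by have [] := Dpsi t t01.
have [s s01] := @MVT R psi (fun t => dphi t + (c * t - dphi 0)) 0 1 ltr01
  (fun t t01 => Dpsi t (subset_itv_oo_cc t01)) cpsi.
have {}s01 := subset_itv_oo_cc s01; rewrite /= in_itv /= in s01.
have := B s s01; rewrite /psi; lra.
Qed.

Lemma lip_grad_bound U g L x y t : convex_set U -> lipschitz_map U L (grad g) ->
  U x -> U y -> 0 <= t <= 1 ->
  `|dot (grad g (x + t *: (y - x))) (y - x) - dot (grad g x) (y - x)|
    <= L * dot (y - x) (y - x) * t.
Proof.
move=> cU lip Ux Uy /andP [t0 t1].
have := lip _ _ (convex_segment cU Ux Uy t0 t1) Ux.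
rewrite addrAC subrr add0r enormZ ger0_norm // => H.
rewrite -dotNl -dotDl -enorm_sqr; apply: le_trans (normr_dot_le _ _) _.
have := ler_wpM2r (enorm_ge0 (y - x)) H; lra.
Qed.

Lemma gradient_minorant U g L x y : convex_set U -> C1_on U g ->
  lipschitz_map U L (grad g) -> U x -> U y ->
  g x + dot (grad g x) (y - x) - L / 2 * dot (y - x) (y - x) <= g y.
Proof.
move=> cU C1 lip Ux Uy.
have Useg t : 0 <= t <= 1 -> U (x + t *: (y - x)).
  by move=> /andP [t0 t1]; exact: convex_segment.
have := @quadratic_minorant_of_derivative (fun t => g (x + t *: (y - x)))
  (fun t => dot (grad g (x + t *: (y - x))) (y - x))
  (L * dot (y - x) (y - x)).
rewrite scale0r scale1r addr0 (addrC x (y - x)) subrK => H.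
apply: le_trans (H _ _); [lra| |] => t t01.
  by apply: is_derive_line; have [] := C1 _ (Useg t t01).
have := lip_grad_bound cU lip Ux Uy t01; rewrite ler_norml; lra.
Qed.

Lemma gradient_majorant U g L x y : convex_set U -> C1_on U g ->
  lipschitz_map U L (grad g) -> U x -> U y ->
  g y <= g x + dot (grad g x) (y - x) + L / 2 * dot (y - x) (y - x).
Proof.
move=> cU C1 lip Ux Uy.
have Useg t : 0 <= t <= 1 -> U (x + t *: (y - x)).
  by move=> /andP [t0 t1]; exact: convex_segment.
have := @quadratic_minorant_of_derivative (fun t => - g (x + t *: (y - x)))
  (fun t => - dot (grad g (x + t *: (y - x))) (y - x))
  (L * dot (y - x) (y - x)).
rewrite scale0r scale1r addr0 (addrC x (y - x)) subrK => H.
have {}H : - g x - dot (grad g x) (y - x) - L * dot (y - x) (y - x) / 2 <= - g y.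
  apply: H => t t01.
    by apply: is_deriveN; apply: is_derive_line; have [] := C1 _ (Useg t t01).
  have := lip_grad_bound cU lip Ux Uy t01; rewrite ler_norml; lra.
lra.
Qed.

(** The minorants at the intermediate point towards both ends are averaged; their linear terms
    cancel. *)
Lemma gradient_semiconvex U g L : convex_set U -> C1_on U g ->
  lipschitz_map U L (grad g) -> semiconvex U L g.
Proof.
move=> cU C1 lip x y t Ux Uy t0 t1.
have Uz := convex_setE cU Ux Uy t0 t1; set z := _ + _ in Uz *.
have Hx := gradient_minorant cU C1 lip Uz Ux.
have Hy := gradient_minorant cU C1 lip Uz Uy.
have Ex : x - z = (1 - t) *: (x - y) by apply/rowP => i; rewrite !mxE; ring.
have Ey : y - z = (- t) *: (x - y) by apply/rowP => i; rewrite !mxE; ring.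
rewrite Ex !dotZr !dotZl in Hx; rewrite Ey !dotZr !dotZl in Hy.
have t1' : 0 <= 1 - t by rewrite subr_ge0.
have := ler_wpM2l t0 Hx; have := ler_wpM2l t1' Hy.
move: (g z) (g x) (g y) (dot (grad g z) _) (dot (x - y) _) => a b c p q.
lra.
Qed.

Lemma semiconvexD U l1 l2 h1 h2 : semiconvex U l1 h1 -> semiconvex U l2 h2 ->
  semiconvex U (l1 + l2) (fun x => h1 x + h2 x).
Proof.
move=> H1 H2 x y t Ux Uy t0 t1.
have := H1 x y t Ux Uy t0 t1; have := H2 x y t Ux Uy t0 t1; lra.
Qed.

Lemma semiconvexZ U l a h : 0 <= a -> semiconvex U l h ->
  semiconvex U (a * l) (fun x => a * h x).
Proof.
move=> a0 H x y t Ux Uy t0 t1; have := ler_wpM2l a0 (H x y t Ux Uy t0 t1); lra.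
Qed.

Lemma semiconvexS U V l h : V `<=` U -> semiconvex U l h -> semiconvex V l h.
Proof. by move=> VU H x y t Vx Vy; apply: H; exact: VU. Qed.

(** A maximum of two functions of the same modulus: the constant 0 has modulus [l] because
    [0 <= l]. *)
Lemma semiconvex_pos_part U l h : 0 <= l -> semiconvex U l h ->
  semiconvex U l (fun x => Num.max (h x) 0).
Proof.
move=> l0 H x y t Ux Uy t0 t1; rewrite ge_max; apply/andP; split.
  apply: le_trans (H x y t Ux Uy t0 t1) _; rewrite lerD2r lerD //.
    by rewrite ler_wpM2l // le_max lexx.
  by rewrite ler_wpM2l ?subr_ge0 // le_max lexx.
by rewrite !addr_ge0 ?mulr_ge0 ?subr_ge0 ?dot_ge0 ?le_max ?lexx ?orbT ?invr_ge0.
Qed.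

Lemma semiconvex_sqr_dist U x b :
  semiconvex U (- b) (fun z => b / 2 * enorm (z - x) ^+ 2).
Proof.
move=> u v t _ _ t0 t1 /=; rewrite !enorm_sqr.
have -> : t *: u + (1 - t) *: v - x = t *: (u - x) + (1 - t) *: (v - x).
  by apply/rowP => i; rewrite !mxE; ring.
rewrite enorm_conv2 (_ : u - x - (v - x) = u - v); first lra.
by rewrite opprB addrA subrK.
Qed.

(** Minimality makes 0 a subgradient along the segment from [y] to [z], and the modulus yields
    quadratic growth, also when [y] lies on the boundary of [D]. *)
Lemma semiconvex_argmin D m h y z :
  (forall t, 0 <= t -> t <= 1 -> D (y + t *: (z - y))) -> semiconvex D (- m) h ->
  argmin D h y -> D z -> h y + m / 2 * dot (z - y) (z - y) <= h z.
Proof.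
move=> seg H [Dy ymin] Dz.
have := @semiconvex_local_minorant _ _ D (- m) h y z 0 H Dy Dz.
rewrite dot0l => Hz; have : h y + 0 - - m / 2 * dot (z - y) (z - y) <= h z.
  apply: Hz => e e0; exists 1 => // t t0 t1.
  apply: le_trans (ymin _ (seg t (ltW t0) (ltW t1))).
  by have := mulr_gt0 e0 t0; lra.
lra.
Qed.

End gradient.

(** * Projection onto the ball and its normal cone *)

Section ball_projection.
Context {R : realType} {d : nat}.
Local Notation vec := ('rV[R]_d).
Implicit Types (D : set vec) (h : vec -> R) (x y z v w : vec) (t l L : R).

Lemma argmin_set1 D h y : argmin D h y ->
  (forall z, D z -> h z <= h y -> z = y) -> argmin D h = [set y].
Proof.
move=> [Dy ymin] uniq; apply/seteqP; split => z /=.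
  by move=> [Dz zmin]; apply: uniq => //; exact: zmin.
by move=> ->.
Qed.

Lemma get_argmin D h y : argmin D h = [set y] -> get (argmin D h) = y.
Proof. by move=> ->; apply: get_unique. Qed.

(** Closed form of the projection, which [proj_ball] defines only by choice; continuity and then
    measurability are read off from it. *)
Definition ball_retract x : vec := (Num.max 1 (enorm x))^-1 *: x.

Let max1_gt0 x : 0 < Num.max 1 (enorm x).
Proof. by rewrite lt_max ltr01. Qed.

Lemma ball_retract_in x : unit_ball (ball_retract x).
Proof.
have m0 := max1_gt0 x.
rewrite /unit_ball /= enormZ gtr0_norm ?invr_gt0 //.
by rewrite ler_pdivrMl // mulr1 le_max lexx orbT.
Qed.

(** Outside the ball [x - ball_retract x] is a positive multiple of [x], and [dot x z <= enorm x =
    dot x (ball_retract x)]. *)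
Lemma ball_retract_obtuse x z : unit_ball z ->
  dot (x - ball_retract x) (z - ball_retract x) <= 0.
Proof.
rewrite /unit_ball /= => Bz; rewrite /ball_retract.
case: (leP (enorm x) 1) => x1; first by rewrite invr1 scale1r subrr dot0l.
have x0 : 0 < enorm x by lra.
set c := (enorm x)^-1.
have cx : c * enorm x = 1 by rewrite mulVf ?gt_eqF.
have c0 : 0 < c by rewrite invr_gt0.
have c1 : c < 1 by rewrite invf_lt1.
rewrite (_ : x - c *: x = (1 - c) *: x); last by rewrite scalerBl scale1r.
rewrite dotZl dotDr dotNr dotZr -enorm_sqr expr2 mulrA cx mul1r.
have := dot_cauchy_schwarz x z.
have := ler_wpM2l (ltW x0) Bz => H1 H2.
have : 0 <= (1 - c) * (enorm x - dot x z) by apply: mulr_ge0; lra.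
lra.
Qed.

Lemma eproj_ball x : eproj unit_ball x = [set ball_retract x].
Proof.
have key z : unit_ball z -> dot (z - ball_retract x) (z - ball_retract x) +
    dot (ball_retract x - x) (ball_retract x - x) <= dot (z - x) (z - x).
  move=> /(ball_retract_obtuse x); move: (ball_retract x) => p.
  rewrite !dotE (dotC x z) (dotC x p) (dotC p z); lra.
apply: argmin_set1.
  split; first exact: ball_retract_in.
  move=> z /key H; rewrite enorm_leP ?enorm_ge0 // enorm_sqr.
  by have := dot_ge0 (z - ball_retract x); lra.
move=> z /key H; rewrite enorm_leP ?enorm_ge0 // enorm_sqr => H1.
apply/eqP; rewrite -subr_eq0; apply/eqP/dot_eq0/eqP.
by rewrite eq_le dot_ge0 andbT; lra.
Qed.

Lemma proj_ballE x : proj_ball x = ball_retract x.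
Proof. exact: get_argmin (eproj_ball x). Qed.

Lemma proj_ball_in x : unit_ball (proj_ball x).
Proof. by rewrite proj_ballE; exact: ball_retract_in. Qed.

Lemma proj_ball_id x : unit_ball x -> proj_ball x = x.
Proof.
by rewrite proj_ballE /ball_retract => Bx; rewrite max_l // invr1 scale1r.
Qed.

Lemma proj_ball_nearer x z : unit_ball z ->
  dot (proj_ball x - z) (proj_ball x - z) <= dot (x - z) (x - z).
Proof.
rewrite proj_ballE => /(ball_retract_obtuse x); move: (ball_retract x) => p H.
have := dot_ge0 (x - p); move: H.
rewrite !dotE (dotC z x) (dotC p x) (dotC p z); lra.
Qed.

Lemma continuous_enorm : continuous (@enorm R d).
Proof.
move=> x; exact: (@cvg_enorm R d vec (nbhs x) _ id x (@cvg_id _ _)).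
Qed.

Lemma continuous_proj_ball : continuous (@proj_ball R d).
Proof.
rewrite (_ : proj_ball = ball_retract); last by apply: funext => x; exact: proj_ballE.
move=> x; apply: (@cvgZ R vec vec (nbhs x)); last exact: cvg_id.
apply: (@cvgV R vec (nbhs x)); first by rewrite gt_eqF ?max1_gt0.
apply: (@continuous_max R vec (cst 1) (@enorm R d)); first exact: cst_continuous.
exact: continuous_enorm.
Qed.

Lemma unit_ball_compact : compact (@unit_ball R d).
Proof.
apply: bounded_closed_compact.
  exists 1; split; first exact: num_real.
  move=> M M1 x /= Bx; apply: le_trans (mx_norm_le_enorm x) _.
  exact: le_trans Bx (ltW M1).
have := (@preimage_closed _ _ (@enorm R d) [set r | r <= 1]).
apply; last exact: closed_le.
by move=> x _; exact: continuous_enorm.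
Qed.

Lemma lipschitz_continuous U L h x : open U -> lipschitz_fun U L h -> U x ->
  {for x, continuous h}.
Proof.
move=> oU lip Ux; apply/(@cvgrPdist_lt _ R vec (nbhs x)) => e e0.
have /nbhs_enormP [del del0 Hd] : nbhs x U by exact: open_nbhs_nbhs.
have L1 : 0 < `|L| + 1 by rewrite ltr_wpDl.
apply/nbhs_enormP; exists (Num.min del (e / (`|L| + 1))).
  by rewrite lt_min del0 divr_gt0.
move=> y; rewrite lt_min => /andP [yd]; rewrite ltr_pdivlMr // => ye.
apply: le_lt_trans (lip _ _ Ux (Hd _ yd)) _; rewrite enormB.
have := ler_wpM2r (enorm_ge0 (y - x)) (ler_norm L).
have := enorm_ge0 (y - x); lra.
Qed.

End ball_projection.

Section ball_normal_cone.
Context {R : realType} {d : nat}.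
Local Notation vec := ('rV[R]_d).
Implicit Types (a y z w : vec) (t r : R).

(** Complementarity covers both cases at once: either [t = 0], or [y] lies on the sphere and
    [dot y z <= 1 = dot y y]. *)
Lemma regular_normal_sphere y t : unit_ball y -> 0 <= t -> t * (1 - dot y y) = 0 ->
  regular_normal unit_ball y (t *: y).
Proof.
move=> By t0 ty; split => // e e0; apply/nbhs_enormP; exists 1 => // z _ Bz.
apply: (@le_trans _ _ 0); last by rewrite mulr_ge0 ?enorm_ge0 // ltW.
rewrite dotZl dotDr dotNr.
have := dot_cauchy_schwarz y z.
rewrite /unit_ball /= in By Bz.
have := enorm_ge0 y; have := enorm_ge0 z => z0 y0 H.
have : dot y z <= 1 by nra.
have : t * (dot y y) = t by lra.
move=> H1 H2; have := ler_wpM2l t0 H2; lra.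
Qed.

(* The vectors [t *: y] fill the normal cone of the ball at [y]: it is trivial
   inside the ball and the ray spanned by [y] on the sphere. *)
Lemma ball_normal_of_slope a y r : unit_ball y -> 0 <= r ->
  (forall z, unit_ball z -> 0 <= dot a (z - y) + r * enorm (z - y)) ->
  exists2 t, 0 <= t /\ t * (1 - dot y y) = 0 & enorm (a + t *: y) <= r.
Proof.
move=> By r0 slope.
have dir w : (exists2 s : R, 0 < s & unit_ball (y + s *: w)) ->
    - dot a w <= r * enorm w.
  move=> [s s0 /slope]; rewrite addrAC subrr add0r enormZ gtr0_norm // dotZr => H.
  have {H} : 0 <= s * (dot a w + r * enorm w) by lra.
  rewrite pmulr_rge0 //; lra.
have le_r u : dot u u <= r * enorm u -> enorm u <= r.
  rewrite -enorm_sqr => H; have := enorm_ge0 u; rewrite le_eqVlt.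
  by case/orP => [/eqP <- //|u0]; move: H; rewrite expr2 ler_pM2r.
have By' : dot y y <= 1.
  by move: (By); rewrite /unit_ball /= enorm_leP // expr1n.
have inB (s : R) w : dot y y + 2 * s * dot y w + s ^+ 2 * dot w w <= 1 ->
    unit_ball (y + s *: w).
  rewrite /unit_ball /= enorm_leP // expr1n !dotE (dotC w y); lra.
have [yy|yy] := eqVneq (dot y y) 1; last first.
  have {yy}yy : dot y y < 1 by rewrite lt_neqAle yy.
  exists 0; first by rewrite mul0r.
  rewrite scale0r addr0; apply: le_r.
  have := dir (- a); rewrite enormN dotNr opprK; apply.
  have c0 := dot_ge0 a.
  pose s : R := (1 - dot y y) / (2 * `|dot y a| + dot a a + 1 + 1).
  have den : 0 < 2 * `|dot y a| + dot a a + 1 + 1 by have := normr_ge0 (dot y a); lra.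
  have s0 : 0 < s by rewrite divr_gt0 // subr_gt0.
  have sE : s * (2 * `|dot y a| + dot a a + 1 + 1) = 1 - dot y y.
    by rewrite /s divfK // gt_eqF.
  exists s => //; apply: inB; rewrite !dotE.
  have yy0 := dot_ge0 y.
  have n0 := normr_ge0 (dot y a).
  have s1 : s <= 1 by nra.
  have := ler_norm (- dot y a); rewrite normrN => H.
  have : s * - dot y a <= s * `|dot y a| by rewrite ler_wpM2l // ltW.
  have : s ^+ 2 * dot a a <= s * dot a a.
    by rewrite ler_wpM2r // expr2 ler_piMl // ltW.
  nra.
(* [t] is the positive part of [- dot a y]: adding [t *: y] to [a] removes from [- a] the radial
   component that points out of the ball. *)
have [t [t0 ta tor]] : exists t, [/\ 0 <= t, - dot a y <= t & t * (dot a y + t) = 0].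
  have [ay|ay] := leP 0 (dot a y); first by exists 0; rewrite mul0r; split => //; lra.
  by exists (- dot a y); rewrite subrr mulr0; split => //; lra.
exists t; first by rewrite yy subrr mulr0.
have [b bE] : exists b, b = a + t *: y by exists (a + t *: y).
have by0 : 0 <= dot b y by rewrite bE dotDl dotZl yy; lra.
have tby : t * dot b y = 0 by rewrite bE dotDl dotZl yy mulr1.
have aE : a = b - t *: y by rewrite bE addrK.
rewrite -bE.
apply: le_r.
apply: (@le_of_small_perturbation _ _ _ (r - dot a y) 1) => // k k0 _.
(* The direction [- b] may be merely tangent to the sphere. The extra [- k *: y] points strictly
   inward, so a short step along [w] stays in the ball; [k] is then sent to 0. *)
set w := - b - k *: y.
have yw : dot y w <= - k.
  by rewrite /w !dotE yy (dotC y b); lra.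
have : - dot a w <= r * enorm w.
  have w1 : 0 < dot w w + 1 by rewrite ltr_wpDl ?dot_ge0.
  have [s s0 sk] : exists2 s, 0 < s & s * (dot w w + 1) = k.
    by exists (k / (dot w w + 1)); [rewrite divr_gt0 | rewrite divfK ?gt_eqF].
  apply: dir; exists s => //; apply: inB; rewrite yy.
  have := ler_wpM2l (ltW s0) yw.
  have : s * (s * (dot w w)) <= s * k by apply: ler_wpM2l; [exact: ltW | lra].
  have := mulr_gt0 s0 k0; lra.
have -> : - dot a w = dot b b + k * dot a y.
  by rewrite /w !dotE {1}aE !dotE (dotC y b) tby; lra.
have : enorm w <= enorm b + k.
  apply: le_trans (enormD_le _ _) _; rewrite !enormN enormZ gtr0_norm //.
  by rewrite lerD2l /enorm yy sqrtr1 mulr1.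
move=> /(ler_wpM2l r0); lra.
Qed.

End ball_normal_cone.

(** * Proximal points and stationarity *)

Section multiplier.
Context {R : realType} {d : nat}.
Local Notation vec := ('rV[R]_d).

Lemma regular_subdiff_of_quadratic (h : vec -> R) (y v : vec) (c del : R) : 0 < del ->
  (forall z, enorm (z - y) < del ->
     h y + dot v (z - y) - c * enorm (z - y) ^+ 2 <= h z) ->
  regular_subdiff h y v.
Proof.
move=> del0 H e e0; apply/nbhs_enormP.
have c1 : 0 < `|c| + 1 by rewrite ltr_wpDl.
exists (Num.min del (e / (`|c| + 1))); first by rewrite lt_min del0 divr_gt0.
move=> z; rewrite lt_min => /andP [zd]; rewrite ltr_pdivlMr // => ze.
apply: le_trans (H z zd).
have := enorm_ge0 (z - y); move: (enorm (z - y)) ze => N ze N0.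
have := ler_norm c => cc.
have : c * N ^+ 2 <= `|c| * N ^+ 2 by rewrite ler_wpM2r // sqr_ge0.
have : N * (N * (`|c| + 1)) <= N * e by apply: ler_wpM2l => //; exact: ltW.
have := sqr_ge0 N; lra.
Qed.

(* One-dimensional exact-penalty duality: [mu] is the least slope that keeps
   [G + mu s] nonnegative where [s > 0]. *)
Lemma exists_multiplier (D : set vec) (G s : vec -> R) (lam : R) : 0 <= lam ->
  (forall x y t, D x -> D y -> 0 <= t -> t <= 1 -> D (t *: x + (1 - t) *: y)) ->
  semiconvex D 0 G ->
  (forall x y t, s (t *: x + (1 - t) *: y) = t * s x + (1 - t) * s y) ->
  (forall z, D z -> 0 <= G z + lam * Num.max (s z) 0) ->
  exists2 mu, 0 <= mu <= lam & forall z, D z -> 0 <= G z + mu * s z.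
Proof.
move=> lam0 cD cG affs Gs.
(* Each point with positive [s] demands its ratio as a slope; the element 0 makes the set nonempty
   and its supremum nonnegative. *)
pose S := [set r | r = 0 \/ exists z, [/\ D z, 0 < s z & r = - G z / s z]].
have S0 : S 0 by left.
have Slam : ubound S lam.
  move=> _ [->//|[z [Dz sz ->]]]; rewrite ler_pdivrMr //.
  by have := Gs z Dz; rewrite max_l ?(ltW sz) //; lra.
have supS : has_ubound S by exists lam.
exists (sup S); first by rewrite ub_le_sup //= ge_sup //; exists 0.
move=> z Dz; have [sz|sz|sz] := ltgtP (s z) 0.
- suff : sup S <= G z / - s z.
    by rewrite ler_pdivlMr ?oppr_gt0 //; lra.
  apply: ge_sup; first by exists 0.
  move=> _ [->|[w [Dw sw ->]]].
    by have := Gs z Dz; rewrite max_r ?(ltW sz) // => Gz; apply: divr_ge0; lra.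
  rewrite ler_pdivlMr ?oppr_gt0 // mulrAC ler_pdivrMr //.
  have den : 0 < s w - s z by lra.
  (* The weight at which [s] vanishes between [z] and [w]. There the penalty is zero, so [G] is
     nonnegative, and convexity of [G] compares the two ratios. *)
  pose t := s w / (s w - s z).
  have tE : t * (s w - s z) = s w by rewrite /t divfK // gt_eqF.
  have t0 : 0 <= t by apply: divr_ge0; exact: ltW.
  have t1 : t <= 1 by rewrite /t ler_pdivrMr //; lra.
  have := Gs _ (cD z w t Dz Dw t0 t1).
  rewrite affs (_ : t * s z + _ = 0); last lra.
  rewrite maxxx mulr0 addr0 => H.
  have {H} := le_trans H (cG z w t Dz Dw t0 t1); rewrite !mul0r addr0 => H.
  have := mulr_ge0 (ltW den) H.
  have -> : (s w - s z) * (t * G z + (1 - t) * G w)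
    = t * (s w - s z) * G z + ((s w - s z) - t * (s w - s z)) * G w by ring.
  rewrite tE; lra.
- suff : - G z / s z <= sup S by rewrite ler_pdivrMr //; lra.
  by apply: ub_le_sup => //; right; exists z.
- by have := Gs z Dz; rewrite sz maxxx !mulr0.
Qed.

End multiplier.

Record penalized_setting {R : realType} {d : nat} (f g : 'rV[R]_d -> R)
    (U : set 'rV[R]_d) (l Gf Lg lam beta : R) : Prop := PenalizedSetting {
  curvature_f_gt0 : 0 < l;
  lipschitz_f_gt0 : 0 < Gf;
  curvature_g_gt0 : 0 < Lg;
  penalty_gt0 : 0 < lam;
  prox_parameter_gt : l + lam * Lg < beta;
  domain_open : open U;
  domain_convex : convex_set U;
  ball_in_domain : unit_ball `<=` U;
  f_semiconvex : semiconvex U l f;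
  f_lipschitz : lipschitz_fun U Gf f;
  g_C1 : C1_on U g;
  grad_g_lipschitz : lipschitz_map U Lg (grad g)
}.

Section penalized_problem.
Context {R : realType} {d : nat}.
Local Notation vec := ('rV[R]_d).
Variables (f g : vec -> R) (U : set vec) (l Gf Lg lam beta : R).
Hypothesis setting : penalized_setting f g U l Gf Lg lam beta.

Let l_gt0 := curvature_f_gt0 setting.
Let Gf_gt0 := lipschitz_f_gt0 setting.
Let Lg_gt0 := curvature_g_gt0 setting.
Let lam_gt0 := penalty_gt0 setting.
Let beta_gt := prox_parameter_gt setting.
Let oU := domain_open setting.
Let cU := domain_convex setting.
Let BU := ball_in_domain setting.
Let wf := f_semiconvex setting.
Let lipf := f_lipschitz setting.
Let C1g := g_C1 setting.
Let lipg := grad_g_lipschitz setting.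

Local Notation B := (@unit_ball R d).
Local Notation H := (prox_obj f g lam beta).
Local Notation Q := (prox_point f g lam beta).
Local Notation m := (beta - l - lam * Lg).
Implicit Types (x y z w : vec) (t : R).

Lemma beta_gt0 : 0 < beta.
Proof. by have := mulr_gt0 lam_gt0 Lg_gt0; move: beta_gt l_gt0; lra. Qed.

Lemma m_gt0 : 0 < m.
Proof. by move: beta_gt; lra. Qed.

Lemma prox_obj_semiconvex x : semiconvex B (- m) (H x).
Proof.
have -> : - m = l + lam * Lg + (- beta) by ring.
apply: semiconvexD; last exact: semiconvex_sqr_dist.
apply: (semiconvexS BU); apply: semiconvexD => //.
apply: semiconvexZ; first exact: ltW.
apply: semiconvex_pos_part; first exact: ltW.
exact: (gradient_semiconvex cU C1g lipg).
Qed.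

Lemma continuous_f x : B x -> {for x, continuous f}.
Proof. by move=> /BU Ux; exact: (lipschitz_continuous oU lipf Ux). Qed.

Lemma continuous_g x : B x -> {for x, continuous g}.
Proof. by move=> /BU /C1g [dg _]; exact: differentiable_continuous. Qed.

Lemma continuous_Psi x : B x -> {for x, continuous (Psi f g lam)}.
Proof.
move=> Bx; apply: continuousD; first exact: continuous_f.
apply: (@continuousM R vec (cst lam)); first exact: cst_continuous.
apply: (@continuous_max R vec g (cst 0)); [exact: continuous_g | exact: cst_continuous].
Qed.

Lemma continuous_prox_obj x y : B y -> {for y, continuous (H x)}.
Proof.
move=> By; apply: continuousD; first exact: continuous_Psi.
apply: (@continuousM R vec (cst (beta / 2))); first exact: cst_continuous.
have cd : {for y, continuous (fun z => enorm (z - x))}.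
  apply: (@cvg_enorm R d vec (nbhs y)); apply: (@cvgB R vec vec (nbhs y)).
    exact: cvg_id.
  exact: cvg_cst.
exact: (continuousM cd cd).
Qed.

Lemma argmin_prox_obj_nonempty x : exists y, argmin B (H x) y.
Proof.
have B0 : B !=set0 by exists 0; rewrite /unit_ball /= enorm0.
have [|y By ymin] := @EVT_min_rV R d (H x) B B0 unit_ball_compact.
  by apply: continuous_in_subspaceT => y; rewrite inE; exact: continuous_prox_obj.
exists y; split; first by rewrite inE in By.
by move=> z Bz; apply: ymin; rewrite inE.
Qed.

Lemma prox_obj_growth x y z : argmin B (H x) y -> B z ->
  H x y + m / 2 * dot (z - y) (z - y) <= H x z.
Proof.
move=> ymin Bz; apply: (semiconvex_argmin _ (prox_obj_semiconvex x) ymin Bz) => t.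
exact: (unit_ball_segment ymin.1 Bz).
Qed.

Lemma argmin_prox_obj x : argmin B (H x) = [set Q x].
Proof.
have [y ymin] := argmin_prox_obj_nonempty x.
have E : argmin B (H x) = [set y].
  apply: argmin_set1 => // z Bz zy; have := prox_obj_growth ymin Bz => K.
  apply/eqP; rewrite -subr_eq0; apply/eqP/dot_eq0/eqP.
  rewrite eq_le dot_ge0 andbT.
  have : m / 2 * dot (z - y) (z - y) <= 0 by lra.
  by rewrite pmulr_rle0 // divr_gt0 // m_gt0.
by rewrite /prox_point (get_argmin E) E.
Qed.

Lemma prox_point_argmin x : argmin B (H x) (Q x).
Proof. by rewrite argmin_prox_obj. Qed.

Lemma prox_point_in x : B (Q x).
Proof. by case: (prox_point_argmin x). Qed.

(** The growth inequalities of the two problems, each taken at the other's minimizer, are added;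
    only [beta * dot (Q x - Q x') (x - x')] remains on the right. The resulting continuity on the
    whole space makes random proximal points measurable. *)
Lemma prox_point_lipschitz x x' : m * enorm (Q x - Q x') <= beta * enorm (x - x').
Proof.
have H1 := prox_obj_growth (prox_point_argmin x) (prox_point_in x').
have H2 := prox_obj_growth (prox_point_argmin x') (prox_point_in x).
have H3 := dot_cauchy_schwarz (Q x - Q x') (x - x').
have [->|N] := eqVneq (enorm (Q x - Q x')) 0.
  by rewrite mulr0 mulr_ge0 ?enorm_ge0 // ltW // beta_gt0.
have N0 : 0 < enorm (Q x - Q x') by rewrite lt_neqAle eq_sym N enorm_ge0.
rewrite -(ler_pM2r N0) -mulrA -expr2 enorm_sqr.
have := ler_wpM2l (ltW beta_gt0) H3.
move: H1 H2; rewrite /prox_obj !enorm_sqr.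
move: (Q x) (Q x') => q q'.
rewrite !dotE (dotC x q) (dotC x q') (dotC x' q) (dotC x' q') (dotC q' q).
lra.
Qed.

Lemma continuous_prox_point : continuous Q.
Proof.
move=> x; have m0 := m_gt0.
apply: (@cvg_enormP R d vec (nbhs x)).
apply/(@cvgrPdist_lt _ R vec (nbhs x)) => e e0; apply/nbhs_enormP.
exists (m * e / beta) => [|y]; first by rewrite divr_gt0 ?mulr_gt0 // beta_gt0.
rewrite ltr_pdivlMr ?beta_gt0 // => ye.
rewrite sub0r normrN ger0_norm ?enorm_ge0 // -(ltr_pM2l m0).
apply: le_lt_trans (prox_point_lipschitz _ _) _; lra.
Qed.

(** Minimality tested on a segment, with the quadratic part expanded exactly; the infeasible case
    and the active case both start from it. *)
Lemma prox_variation x y z t : argmin B (H x) y -> B z -> 0 <= t -> t <= 1 ->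
  0 <= f (y + t *: (z - y)) - f y
    + lam * (Num.max (g (y + t *: (z - y))) 0 - Num.max (g y) 0)
    + beta * t * dot (y - x) (z - y) + beta / 2 * t ^+ 2 * dot (z - y) (z - y).
Proof.
move=> [By ymin] Bz t0 t1.
have := ymin _ (unit_ball_segment By Bz t0 t1).
rewrite /prox_obj /Psi !enorm_sqr (_ : y + _ - x = (y - x) + t *: (z - y)).
  rewrite (dotDl (y - x)) !(dotDr (y - x)) !dotZl !dotZr (dotC (z - y) (y - x)).
  lra.
by rewrite addrAC.
Qed.

(** For small [t] the constraint stays violated, so the penalty is the smooth function [lam * g]
    there, while [f] changes by at most [Gf] per unit length. *)
Lemma slope_of_infeasible_prox x y : argmin B (H x) y -> 0 < g y ->
  forall z, B z -> 0 <= dot (lam *: grad g y) (z - y)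
    + (Gf + beta * enorm (y - x)) * enorm (z - y).
Proof.
move=> ymin gy z Bz; have By := ymin.1; rewrite dotZl.
set p := dot (grad g y) (z - y); set N := enorm (z - y).
have p1 : 0 < `|p| + Lg / 2 * N ^+ 2 + 1.
  by rewrite ltr_wpDl // addr_ge0 // mulr_ge0 ?sqr_ge0 // divr_ge0 // ltW.
(* The second bound on [t] keeps the linear and quadratic losses of [g] together below [g y]. *)
apply: (@le_of_small_perturbation _ _ _ ((lam * Lg / 2 + beta / 2) * N ^+ 2)
  (Num.min 1 (g y / (`|p| + Lg / 2 * N ^+ 2 + 1)))).
  by rewrite lt_min ltr01 divr_gt0.
move=> t t0; rewrite lt_min ltr_pdivlMr // => /andP [t1 tg].
have Bt := unit_ball_segment By Bz (ltW t0) (ltW t1).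
have V := prox_variation ymin Bz (ltW t0) (ltW t1).
have E : y + t *: (z - y) - y = t *: (z - y) by rewrite addrAC subrr add0r.
have Gmin := gradient_minorant cU C1g lipg (BU By) (BU Bt).
have Gmaj := gradient_majorant cU C1g lipg (BU By) (BU Bt).
have Fl := le_trans (ler_norm _) (lipf (BU Bt) (BU By)).
rewrite E !dotZr !dotZl -enorm_sqr -/p -/N in Gmin Gmaj.
rewrite E enormZ gtr0_norm // -/N in Fl; rewrite -enorm_sqr -/N in V.
have CS := dot_cauchy_schwarz (y - x) (z - y); rewrite -/N in CS.
have N0 : 0 <= N by exact: enorm_ge0.
have tp : - (t * `|p|) <= t * p by have := ler_wpM2l (ltW t0) (ler_norm (- p)); rewrite normrN; lra.
have N2 : 0 <= Lg / 2 * N ^+ 2 by rewrite mulr_ge0 ?sqr_ge0 // divr_ge0 // ltW.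
have tt : t * t * (Lg / 2 * N ^+ 2) <= t * (Lg / 2 * N ^+ 2).
  by rewrite ler_wpM2r // ler_piMl // ltW.
have gt0 : 0 < g (y + t *: (z - y)) by lra.
rewrite max_l ?(ltW gt0) // max_l ?(ltW gy) // in V.
have lamG := ler_wpM2l (ltW lam_gt0) Gmaj.
have bCS := ler_wpM2l (mulr_ge0 (ltW beta_gt0) (ltW t0)) CS.
move: (f _) (f y) (g (y + _)) (g y) (dot (y - x) _) (enorm (y - x)) V Fl lamG bCS
  => a b c e q M V Fl lamG bCS.
have : 0 <= t * (lam * p + (Gf + beta * M) * N
    + t * ((lam * Lg / 2 + beta / 2) * N ^+ 2)) by lra.
by rewrite pmulr_rge0.
Qed.

(** At an infeasible [y] the normal cone of the ball supplies [t *: y] such that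
    [lam *: grad g y + t *: y] has norm at most [Gf + beta * enorm (y - x)]. Divided by [lam], this
    is an element of the gradient plus the normal cone that is shorter than [sout]. *)
Lemma prox_point_feasible sout x y : argmin B (H x) y ->
  (forall x, unit_ball x -> 0 < g x ->
     sout <= edist_set 0 [set grad g x + n | n in limiting_normal unit_ball x]) ->
  beta * enorm (y - x) < lam * sout - Gf -> g y <= 0.
Proof.
move=> ymin Hout small; rewrite leNgt; apply/negP => gy.
have By := ymin.1; set r := Gf + beta * enorm (y - x).
have r0 : 0 <= r by rewrite addr_ge0 ?mulr_ge0 ?enorm_ge0 // ltW // beta_gt0.
have [t [t0 ty] ar] := ball_normal_of_slope By r0 (slope_of_infeasible_prox ymin gy).
have := Hout y By gy; apply/negP; rewrite -ltNge.
apply: (@le_lt_trans _ _ (enorm (0 - (grad g y + (t / lam) *: y)))).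
  apply: ge_inf; first by exists 0 => _ [n _ <-]; exact: enorm_ge0.
  exists (grad g y + (t / lam) *: y) => //; exists ((t / lam) *: y) => //.
  apply: regular_limiting_normal; apply: regular_normal_sphere => //.
    by rewrite divr_ge0 // ltW.
  by rewrite mulrAC ty mul0r.
rewrite sub0r enormN -(ltr_pM2l lam_gt0).
have -> : lam * enorm (grad g y + (t / lam) *: y) = enorm (lam *: grad g y + t *: y).
  rewrite -[X in X * _](gtr0_norm lam_gt0) -enormZ scalerDr scalerA.
  by rewrite mulrCA divff ?mulr1 // gt_eqF.
apply: le_lt_trans ar _; rewrite /r; lra.
Qed.

Lemma inactive_stationary x y del : argmin B (H x) y -> 0 < del ->
  (forall z, enorm (z - y) < del -> B z /\ g z <= 0) ->
  regular_subdiff f y (- (beta *: (y - x))).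
Proof.
move=> [By ymin] del0 near_y.
apply: (@regular_subdiff_of_quadratic _ _ _ _ _ (beta / 2) _ del0) => z zy.
have [Bz gz] := near_y z zy; have := ymin z Bz.
have [_ gy] : B y /\ g y <= 0 by apply: near_y; rewrite subrr enorm0.
rewrite /prox_obj /Psi !max_r // !enorm_sqr (_ : z - x = (y - x) + (z - y)).
  by rewrite dotNl dotZl (dotDl (y - x)) !(dotDr (y - x)) (dotC (z - y) (y - x)); lra.
by apply/rowP => i; rewrite !mxE; ring.
Qed.

Lemma active_stationary x y del : argmin B (H x) y -> g y = 0 -> 0 < del ->
  (forall z, enorm (z - y) < del -> B z) ->
  exists2 mu, 0 <= mu <= lam &
    regular_subdiff f y (- (beta *: (y - x) + mu *: grad g y)).
Proof.
move=> ymin gy del0 near_y; have By := ymin.1.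
(* [G] is [f - f y] convexified by the curvature term, plus the linear part of the proximal
   quadratic; [s] linearizes [g] at the active point. *)
pose G z := f z + l / 2 * enorm (z - y) ^+ 2 + (beta * dot (y - x) (z - y) - f y).
pose s z := dot (grad g y) (z - y).
have cG : semiconvex B 0 G.
  have -> : 0 = l + (- l) + 0 :> R by ring.
  apply: semiconvexD.
    apply: semiconvexD; first exact: (semiconvexS BU).
    exact: semiconvex_sqr_dist.
  by move=> u v t _ _ _ _; rewrite !dotE; lra.
have affs u v t : s (t *: u + (1 - t) *: v) = t * s u + (1 - t) * s v.
  by rewrite /s !dotE; ring.
(* Semiconvexity of [f] and the majorant of [g] bound the variation at [t] by [t] times the value at
   [z], up to order [t ^ 2]; a condition near [y] thus becomes one on the whole ball. *)
have Gs z : B z -> 0 <= G z + lam * Num.max (s z) 0.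
  move=> Bz; set D := dot (z - y) (z - y).
  apply: (@le_of_small_perturbation _ _ _
    (- (l / 2) * D + lam * (Lg / 2 * D) + beta / 2 * D) 1) => // t t0 t1.
  have Bt := unit_ball_segment By Bz (ltW t0) (ltW t1).
  have V := prox_variation ymin Bz (ltW t0) (ltW t1).
  have E : y + t *: (z - y) - y = t *: (z - y) by rewrite addrAC subrr add0r.
  have Gmaj := gradient_majorant cU C1g lipg (BU By) (BU Bt).
  have F := semiconvex_segment wf (BU By) (BU Bz) (ltW t0) (ltW t1).
  rewrite E !dotZr !dotZl gy add0r -/D -/(s z) in Gmaj.
  rewrite gy maxxx -/D in V; rewrite -/D in F.
  rewrite /G enorm_sqr -/D.
  have D0 : 0 <= D by exact: dot_ge0.
  have sp : t * s z <= t * Num.max (s z) 0.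
    by apply: ler_wpM2l; [exact: ltW | rewrite le_max lexx].
  have sp0 : 0 <= t * Num.max (s z) 0.
    by apply: mulr_ge0; [exact: ltW | rewrite le_max lexx orbT].
  have q0 : 0 <= Lg / 2 * (t * (t * D)).
    by rewrite !mulr_ge0 ?invr_ge0 // ltW.
  have : Num.max (g (y + t *: (z - y))) 0
      <= t * Num.max (s z) 0 + Lg / 2 * (t * (t * D)).
    by rewrite ge_max; apply/andP; split; lra.
  move=> /(ler_wpM2l (ltW lam_gt0)).
  move: (Num.max (g _) 0) (Num.max (s z) 0) V F => a b V F P.
  have : 0 <= t * (f z + l / 2 * D + (beta * dot (y - x) (z - y) - f y) + lam * b
    + t * (- (l / 2) * D + lam * (Lg / 2 * D) + beta / 2 * D)) by lra.
  by rewrite pmulr_rge0.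
have [mu mu01 Hmu] := exists_multiplier (ltW lam_gt0) (@unit_ball_convex R d) cG affs Gs.
exists mu => //.
apply: (@regular_subdiff_of_quadratic _ _ _ _ _ (l / 2) _ del0) => z zy.
have := Hmu z (near_y z zy); rewrite /G /s !dotNl (dotDl (beta *: _)) !dotZl; lra.
Qed.

End penalized_problem.

(** * Uniqueness of the projection onto the feasible set *)

Section projection.
Context {R : realType} {d : nat}.
Local Notation vec := ('rV[R]_d).
Variables (g : vec -> R) (U : set vec) (Lg : R).
Hypotheses (Lg_gt0 : 0 < Lg) (cU : convex_set U) (BU : unit_ball `<=` U).
Hypotheses (C1g : C1_on U g) (lipg : lipschitz_map U Lg (grad g)).
Local Notation B := (@unit_ball R d).
Hypothesis feas_int : feasible g `<=` interior B.

Lemma feasible_near y : feasible g y ->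
  exists2 del : R, 0 < del & forall z, enorm (z - y) < del -> B z.
Proof. by move=> /feas_int /nbhs_enormP. Qed.

(** A direction along which the quadratic majorant of [g] stays nonpositive leads to feasible
    points, so it cannot make an acute angle with [x - p]. Since [p] is interior to the ball, short
    steps remain where the majorant is valid. *)
Lemma projection_direction x p w t0 : eproj (feasible g) x p -> 0 < t0 ->
  (forall t, 0 < t -> t < t0 ->
     g p + t * dot (grad g p) w + Lg / 2 * t ^+ 2 * dot w w <= 0) ->
  dot (x - p) w <= 0.
Proof.
move=> [Cp pmin] t00 Hdir; have [del del0 near_p] := feasible_near Cp.
have w1 : 0 < enorm w + 1 by rewrite ltr_wpDl // enorm_ge0.
apply: (@le_of_small_perturbation _ _ _ (dot w w / 2)
  (Num.min t0 (del / (enorm w + 1)))); first by rewrite lt_min t00 divr_gt0.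
move=> t tp; rewrite lt_min => /andP [tt0]; rewrite ltr_pdivlMr // => td.
have E : p + t *: w - p = t *: w by rewrite addrAC subrr add0r.
have Bp : B p by apply: near_p; rewrite subrr enorm0.
have Bt : B (p + t *: w).
  by apply: near_p; rewrite E enormZ gtr0_norm //; lra.
have Ct : feasible g (p + t *: w).
  have := gradient_majorant cU C1g lipg (BU Bp) (BU Bt).
  rewrite E !dotZr !dotZl => Gmaj; apply: le_trans Gmaj _.
  by have := Hdir t tp tt0; lra.
have := pmin _ Ct; rewrite enorm_leP ?enorm_ge0 // enorm_sqr.
rewrite (_ : p + t *: w - x = t *: w - (x - p)); last first.
  by apply/rowP => i; rewrite !mxE; ring.
rewrite (_ : p - x = - (x - p)); last by rewrite opprB.
move: (x - p) => b; rewrite !dotE (dotC w b) => K.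
have : 0 <= t * (0 + t * (dot w w / 2) - dot b w) by lra.
by rewrite pmulr_rge0 // subr_ge0.
Qed.

(* The multiplier of a nearest point [p] is at most [|x - p| / sbd], below the
   inverse curvature [1 / Lg] of the constraint: no other point is as near. *)
Lemma projection_unique sbd x p : 0 < sbd ->
  (forall z, B z -> g z = 0 -> sbd <= enorm (grad g z)) ->
  eproj (feasible g) x p -> enorm (p - x) * Lg < sbd ->
  eproj (feasible g) x = [set p].
Proof.
move=> sbd0 Hbd pproj close; have [Cp pmin] := pproj.
have [del del0 near_p] := feasible_near Cp.
have Bp : B p by apply: near_p; rewrite subrr enorm0.
apply: argmin_set1 => // q Cq qp.
have [del' del'0 near_q] := feasible_near Cq.
have Bq : B q by apply: near_q; rewrite subrr enorm0.
rewrite enorm_leP ?enorm_ge0 // enorm_sqr in qp.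
apply/eqP; rewrite -subr_eq0; apply/eqP/dot_eq0/eqP; rewrite eq_le dot_ge0 andbT.
have qE : q - x = (q - p) - (x - p) by rewrite opprB addrA subrK.
have pE : p - x = - (x - p) by rewrite opprB.
rewrite pE enormN in close; rewrite pE qE in qp.
have Gmin := gradient_minorant cU C1g lipg (BU Bp) (BU Bq).
have dir := projection_direction (w := _) pproj.
move: (x - p) (q - p) close dir qp Gmin => b e close dir.
rewrite !dotE (dotC e b) => qp Gmin.
have {qp}qp : dot e e <= 2 * dot b e by lra.
(* At an inactive [p] every direction is feasible, in particular [x - p], which therefore
   vanishes. *)
have [gp|gp] := ltP (g p) 0.
  suff b0 : dot b b <= 0.
    have b0E : b = 0 by apply: dot_eq0; apply/eqP; rewrite eq_le b0 dot_ge0.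
    by move: qp; rewrite b0E dot0l mulr0.
  set r := dot (grad g p) b; set D := dot b b.
  have D0 : 0 <= Lg / 2 * D by rewrite mulr_ge0 ?dot_ge0 // divr_ge0 // ltW.
  have den : 0 < `|r| + Lg / 2 * D + 1 by rewrite ltr_wpDl // addr_ge0.
  apply: (dir b (Num.min 1 (- g p / (`|r| + Lg / 2 * D + 1)))).
    by rewrite lt_min ltr01 divr_gt0 // oppr_gt0.
  move=> t t0; rewrite lt_min ltr_pdivlMr // => /andP [t1 tg].
  have : t * r <= t * `|r| by apply: ler_wpM2l; [exact: ltW | exact: ler_norm].
  have : t * t * (Lg / 2 * D) <= t * (Lg / 2 * D).
    by apply: ler_wpM2r => //; rewrite ler_piMl // ltW.
  rewrite -/D -/r; lra.
have {}gp : g p = 0 by apply/eqP; rewrite eq_le Cp.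
have a_ge := Hbd p Bp gp.
rewrite gp in dir Gmin; move: (grad g p) a_ge dir Gmin => a a_ge dir Gmin.
have {}dir w : dot a w < 0 -> dot b w <= 0.
  move=> aw; have w1 : 0 < dot w w + 1 by rewrite ltr_wpDl ?dot_ge0.
  apply: (dir w (- dot a w / (Lg / 2 * (dot w w + 1)))).
    by rewrite !divr_gt0 ?oppr_gt0 // mulr_gt0 // divr_gt0.
  move=> t t0; rewrite ltr_pdivlMr ?mulr_gt0 ?divr_gt0 // => tw.
  have tw2 := ler_wpM2l (ltW t0) (ltW tw).
  have : 0 <= Lg / 2 * t ^+ 2 by rewrite mulr_ge0 ?sqr_ge0 // divr_ge0 // ltW.
  lra.
have aa : 0 < dot a a by rewrite -enorm_sqr exprn_gt0 //; lra.
(* [b] makes no acute angle with any descent direction of [g], hence is a multiple of the gradient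
   [a]: the residual orthogonal to [a], tilted by [- t *: a], is such a direction. *)
have [c bE] : exists c, b = c *: a.
  pose c := dot a b / dot a a.
  have cE : c * dot a a = dot a b by rewrite /c divfK // gt_eqF.
  exists c; apply/eqP; rewrite -subr_eq0; apply/eqP/dot_eq0/eqP.
  rewrite eq_le dot_ge0 andbT.
  have -> : dot (b - c *: a) (b - c *: a) = dot b (b - c *: a).
    by rewrite !dotE (dotC b a) -cE; ring.
  apply: (@le_of_small_perturbation _ _ _ (dot b a) 1) => // t t0 _.
  have := dir (b - c *: a - t *: a).
  rewrite !dotE -cE => /(_ _); have ta := mulr_gt0 t0 aa.
  by move=> K; have := K ltac:(lra); lra.
have c0 : 0 <= c.
  have := dir (- a); rewrite bE !dotNr dotZl => /(_ _) K.
  have {}K : - (c * dot a a) <= 0 by apply: K; rewrite oppr_lt0.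
  by rewrite oppr_le0 pmulr_lge0 in K.
(* Since [enorm a] is at least [sbd], the closeness [enorm b * Lg < sbd] bounds the multiplier
   [c]. *)
have cL : c * Lg < 1.
  rewrite bE enormZ ger0_norm // in close.
  rewrite -(ltr_pM2r sbd0) mul1r; apply: le_lt_trans close.
  by rewrite mulrAC ler_wpM2r ?(ltW Lg_gt0) // ler_wpM2l.
rewrite bE dotZl in qp.
(* Feasibility of [q] bounds [dot a e] by the curvature of [g]; with [dot e e <= 2 * c * dot a e]
   and [c * Lg < 1] only [e = 0] remains. *)
have ae : dot a e <= Lg / 2 * dot e e by rewrite /feasible /= in Cq; lra.
have := ler_wpM2l c0 ae => K.
have {K qp}: (1 - c * Lg) * dot e e <= 0 by lra.
by rewrite pmulr_rle0 // subr_gt0.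
Qed.

End projection.

(** * From a small residual to approximate stationarity *)

Section stationarity.
Context {R : realType} {d : nat}.
Local Notation vec := ('rV[R]_d).

Lemma stationary_of_small_residual (f g : vec -> R) (U : set vec)
    (l Gf Lg lam beta sbd sout eps : R) (x p : vec) :
  penalized_setting f g U l Gf Lg lam beta ->
  feasible g `<=` interior (@unit_ball R d) -> 0 < sbd ->
  (forall z, unit_ball z -> g z = 0 -> sbd <= enorm (grad g z)) ->
  (forall x, unit_ball x -> 0 < g x ->
     sout <= edist_set 0 [set grad g x + n | n in limiting_normal unit_ball x]) ->
  prox_residual f g lam beta x <= eps ->
  eps < lam * sout - Gf -> eps < beta * (sbd / Lg) -> eproj (feasible g) x p ->
  eproj (feasible g) x = [set p] /\
  exists (y u : vec) (mu : R),
    [/\ feasible g y, limiting_subdiff f y u, 0 <= mu <= lam,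
        enorm (p - y) <= 2 * eps / beta &
        enorm (u + mu *: grad g y) <= eps /\ mu * g y = 0].
Proof.
move=> S fint sbd0 Hbd Hout.
have [l0 Gf0 Lg0 lam0 bgt oU cU BU wf lipf C1g lipg] := S.
rewrite /prox_residual; set y := prox_point _ _ _ _ x => res e1 e2 pproj.
have b0 : 0 < beta := beta_gt0 S.
have ymin : argmin unit_ball (prox_obj f g lam beta x) y.
  exact: (prox_point_argmin S).
rewrite enormB in res.
have Cy : feasible g y.
  by apply: (prox_point_feasible S ymin Hout); lra.
have res' : enorm (y - x) <= eps / beta by rewrite ler_pdivlMr // mulrC.
(* [y] is itself feasible, so the nearest point [p] is no farther from [x] than [y]; this is the
   source of the factor 2 in the distance bound. *)
have pd : enorm (p - x) <= eps / beta by apply: le_trans res'; exact: pproj.2.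
split.
  apply: (projection_unique Lg0 cU BU C1g lipg fint sbd0 Hbd pproj).
  rewrite -ltr_pdivlMr //; apply: le_lt_trans pd _.
  by rewrite ltr_pdivrMr // mulrC.
have py : enorm (p - y) <= 2 * eps / beta.
  by apply: le_trans (enormB_le _ _ x) _; rewrite (enormB x y); lra.
have [del del0 near_y] := feasible_near fint Cy.
have By : unit_ball y := ymin.1.
have resE : enorm (- (beta *: (y - x))) <= eps.
  by rewrite enormN enormZ gtr0_norm.
have [gy|gy] := ltP (g y) 0; last first.
  have {}gy : g y = 0 by apply/eqP; rewrite eq_le gy andbT.
  have [mu mu01 sub] := active_stationary S ymin gy del0 near_y.
  exists y, (- (beta *: (y - x) + mu *: grad g y)), mu; split => //.
    exact: regular_limiting_subdiff.
  by rewrite gy mulr0 opprD subrK.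
have /nbhs_enormP [del' del'0 gneg] : nbhs y (fun z => g z < 0).
  exact: (@cvgr_lt R vec (nbhs y) _ g (g y) (continuous_g S By) 0 gy).
exists y, (- (beta *: (y - x))), 0; split => //.
- apply: regular_limiting_subdiff.
  apply: (inactive_stationary ymin (del := Num.min del del')).
    by rewrite lt_min del0.
  move=> z; rewrite lt_min => /andP [zd zd']; split; first exact: near_y.
  exact/ltW/gneg.
- by rewrite lexx ltW.
- by rewrite scale0r addr0 mul0r.
Qed.

End stationarity.

(** * Execution and regret of the inner loop *)

Section execution.
Context {R : realType} {d : nat}.
Local Notation vec := ('rV[R]_d).

Lemma run_bind (V A C : Type) (ans : nat -> V -> V) (pC : V -> V) (p : prog V A)
    (k : A -> prog V C) nq np :
  run ans pC (bind p k) nq np =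
    run ans pC (k (run ans pC p nq np).1) (run ans pC p nq np).2.1
      (run ans pC p nq np).2.2.
Proof. by elim: p nq np => //= z c IH nq np; rewrite IH. Qed.

Variables (g : vec -> R) (lam beta m : R) (K : nat).
Variable ans : nat -> vec -> vec.

(** The inner points as a function of a fixed answering rule. Counting starts at 0: index [i] is the
    point queried in step [i.+1], with query number [n0 + i]. *)
Fixpoint psm_point (xt : vec) (n0 i : nat) : vec :=
  if i is i'.+1 then
    let z := psm_point xt n0 i' in
    proj_ball (z - step_size m i'.+1 *:
      (ans (n0 + i') z + beta *: (z - xt) + penalty_dir g lam z))
  else xt.

Definition psm_value (xt : vec) (n0 : nat) : vec :=
  K%:R^-1 *: \sum_(0 <= i < K) psm_point xt n0 i.

Fixpoint psm_iterate (x0 : vec) (t : nat) : vec :=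
  if t is t'.+1 then psm_value (psm_iterate x0 t') (t' * K) else x0.

Lemma run_psm_loop pC xt n0 np n s :
  run ans pC (psm_loop g lam beta m K xt n s.+1 (psm_point xt n0 s)
      (\sum_(0 <= i < s) psm_point xt n0 i)) (n0 + s) np
  = (K%:R^-1 *: \sum_(0 <= i < s + n) psm_point xt n0 i, ((n0 + s + n)%N, np)).
Proof.
elim: n s => [|n IH] s /=; first by rewrite !addn0.
by have := IH s.+1; rewrite big_nat_recr //= !addnS !addSn => <-.
Qed.

Lemma run_psm pC xt n0 np :
  run ans pC (psm g lam beta m K xt) n0 np = (psm_value xt n0, ((n0 + K)%N, np)).
Proof.
by have := run_psm_loop pC xt n0 np K 0; rewrite /psm /= addn0 add0n big_nil.
Qed.

Lemma run_outer_loop pC x0 np n t :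
  run ans pC (outer_loop g lam beta m K n (psm_iterate x0 t)
      (mkseq (psm_iterate x0) t.+1)) (t * K) np
  = (mkseq (psm_iterate x0) (t + n).+1, (((t + n) * K)%N, np)).
Proof.
elim: n t => [|n IH] t; first by rewrite /= addn0.
rewrite /outer_loop -/(outer_loop _ _ _ _ _) run_bind run_psm.
have := IH t.+1; rewrite addSnnS mulSnr => <-.
congr (run _ _ (outer_loop _ _ _ _ _ _ _ _) _ _).
by rewrite [in RHS]mkseqS.
Qed.

Lemma run_penalized_psm pC x0 T j : (j < T)%N ->
  run ans pC (penalized_psm g lam beta m K T x0 j) 0 0
  = ((psm_iterate x0 j, pC (psm_iterate x0 j)), ((T * K)%N, 1%N)).
Proof.
move=> jT; rewrite /penalized_psm run_bind.
have := run_outer_loop pC x0 0 T 0; rewrite mul0n add0n => -> /=.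
(* The list of iterates also contains the one of index [T], which the sampled index never
   reaches. *)
by rewrite -/(mkseq (psm_iterate x0) T.+1) nth_mkseq // ltnS ltnW.
Qed.

End execution.

(** * Averages, Jensen's inequality and the harmonic sum *)

Section averages.
Context {R : realType} {d : nat}.
Local Notation vec := ('rV[R]_d).

Lemma average_recr (z : nat -> vec) n : (0 < n)%N ->
  n.+1%:R^-1 *: \sum_(0 <= i < n.+1) z i =
  (n%:R / n.+1%:R) *: (n%:R^-1 *: \sum_(0 <= i < n) z i) + (1 - n%:R / n.+1%:R) *: z n
  :> vec.
Proof.
move=> n0; have n0' : (n%:R : R) != 0 by rewrite pnatr_eq0 -lt0n.
have n1' : (n.+1%:R : R) != 0 by rewrite pnatr_eq0.
rewrite big_nat_recr //= scalerDr scalerA; congr (_ *: _ + _ *: _).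
  by rewrite mulrAC divff // mul1r.
rewrite -[X in _ = X - _](divff n1') -mulrBl -[X in X - _]natr1.
by rewrite addrAC subrr add0r mul1r.
Qed.

Lemma average_in_ball (z : nat -> vec) n : (0 < n)%N ->
  (forall i, unit_ball (z i)) -> unit_ball (n%:R^-1 *: \sum_(0 <= i < n) z i).
Proof.
move=> + Bz; elim: n => // -[|n] IH _.
  by rewrite big_nat1 invr1 scale1r.
rewrite average_recr //; apply: unit_ball_convex; [exact: IH | exact: Bz | |].
  exact: divr_ge0.
by rewrite ler_pdivrMr ?ltr0n // mul1r ler_nat.
Qed.

Lemma jensen_average (h : vec -> R) (z : nat -> vec) n : (0 < n)%N ->
  semiconvex unit_ball 0 h -> (forall i, unit_ball (z i)) ->
  n%:R * h (n%:R^-1 *: \sum_(0 <= i < n) z i) <= \sum_(0 <= i < n) h (z i).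
Proof.
move=> + ch Bz; elim: n => // -[|n] IH _.
  by rewrite !big_nat1 invr1 scale1r mul1r.
rewrite average_recr // [X in _ <= X]big_nat_recr //=.
have n2 : 0 < n.+2%:R :> R by rewrite ltr0n.
have t0 : 0 <= n.+1%:R / n.+2%:R :> R by exact: divr_ge0.
have t1 : n.+1%:R / n.+2%:R <= 1 :> R by rewrite ler_pdivrMr // mul1r ler_nat.
have := ch _ _ _ (average_in_ball (ltn0Sn n) Bz) (Bz n.+1) t0 t1.
rewrite !mul0r addr0 => /(ler_wpM2l (ltW n2)) H; apply: le_trans H _.
have e : n.+2%:R * (n.+1%:R / n.+2%:R) = n.+1%:R :> R.
  by rewrite mulrCA divff ?mulr1 // gt_eqF.
rewrite mulrDr [_ * (_ / _ * _)]mulrA [_ * ((1 - _) * _)]mulrA mulrBr mulr1 e (_ : n.+2%:R - n.+1%:R = 1 :> R).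
  by rewrite mul1r lerD2r; exact: IH.
by rewrite -(natr1 n.+1); ring.
Qed.

(** The induction step is [ln x <= x - 1] at [x = (n + 1) / (n + 2)]. The reciprocals come from the
    step sizes. *)
Lemma sum_inv_le_ln n : \sum_(0 <= i < n) (i.+2%:R)^-1 <= ln (n%:R + 1) :> R.
Proof.
elim: n => [|n IH]; first by rewrite big_nil add0r ln1.
rewrite big_nat_recr //= .
have n1 : 0 < n%:R + 1 :> R by rewrite ltr_wpDl.
have n2 : 0 < n.+2%:R :> R by rewrite ltr0n.
have nE : n.+1%:R + 1 = n.+2%:R :> R by rewrite natr1.
have nE' : n%:R + 1 = n.+2%:R - 1 :> R by rewrite -(natr1 n.+1) -(natr1 n); ring.
have : ln ((n%:R + 1) / n.+2%:R) <= - (n.+2%:R)^-1 :> R.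
  rewrite (_ : (n%:R + 1) / n.+2%:R = 1 + - (n.+2%:R)^-1).
    by apply: le_ln1Dx; rewrite ltrN2 invf_lt1 // ltr1n.
  by rewrite nE' mulrBl divff ?gt_eqF // mul1r.
rewrite ln_div ?posrE // nE; move: IH.
move: (\sum_(0 <= i < n) _) (ln (n%:R + 1 : R)) (ln _) (_^-1) => s a b c; lra.
Qed.

End averages.

(** * Deterministic regret of one inner loop *)

Section inner_regret.
Context {R : realType} {d : nat}.
Local Notation vec := ('rV[R]_d).
Variables (f g : vec -> R) (U : set vec) (l Gf Lg lam beta Gg : R).
Hypothesis setting : penalized_setting f g U l Gf Lg lam beta.
Hypothesis Gg_max : forall x, unit_ball x -> enorm (grad g x) <= Gg.
Local Notation B := (@unit_ball R d).
Local Notation H := (prox_obj f g lam beta).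
Local Notation m := (beta - l - lam * Lg).
Local Notation G := (G_H Gf Gg lam beta).
Implicit Types (x y z w : vec) (t : R).

(** The quadratic part is expanded exactly and contributes modulus [beta]. The penalty direction is
    an admissible selection also where [g z <= 0]: the positive part is minimal there, so 0 may be
    taken. *)
Lemma prox_obj_subgradient x z y v : B z -> B y -> limiting_subdiff f z v ->
  H x z + dot (v + beta *: (z - x) + penalty_dir g lam z) (y - z)
    + m / 2 * dot (y - z) (y - z) <= H x y.
Proof.
move=> Bz By vz; have [_ _ Lg0 lam0 _ oU cU BU wf lipf C1g lipg] := setting.
have Hf := limiting_subdiff_ineq oU wf (BU _ Bz) (BU _ By) vz.
have Hg : lam * Num.max (g z) 0 + dot (penalty_dir g lam z) (y - z)
    - lam * (Lg / 2 * dot (y - z) (y - z)) <= lam * Num.max (g y) 0.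
  rewrite /penalty_dir; case: ifPn => gz.
    rewrite (max_l (ltW gz)) dotZl -mulrDr -mulrBr ler_wpM2l ?(ltW lam0) //.
    apply: le_trans (gradient_minorant cU C1g lipg (BU _ Bz) (BU _ By)) _.
    by rewrite le_max lexx.
  rewrite -leNgt in gz; rewrite (max_r gz) mulr0 dot0l add0r add0r.
  apply: (@le_trans _ _ 0).
    by rewrite oppr_le0 !mulr_ge0 ?invr_ge0 ?dot_ge0 // ltW.
  by rewrite mulr_ge0 ?(ltW lam0) // le_max lexx orbT.
move: Hf Hg; rewrite /prox_obj /Psi !enorm_sqr.
have -> : y - x = (z - x) + (y - z) by apply/rowP => i; rewrite !mxE; ring.
by move: (y - z) (z - x) => e w Hf Hg; rewrite !dotE (dotC e w); lra.
Qed.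

(** Origin of [G_H]: its term [2 * beta] is [beta] times the diameter of the ball. *)
Lemma psm_direction_bound x z a : B x -> B z -> enorm a <= Gf ->
  enorm (a + beta *: (z - x) + penalty_dir g lam z) <= G.
Proof.
move=> Bx Bz aG; have [_ _ Lg0 lam0 _ oU cU BU wf lipf C1g lipg] := setting.
apply: le_trans (enormD_le _ _) _.
have b0 := ltW (beta_gt0 setting).
have H1 : enorm (a + beta *: (z - x)) <= Gf + 2 * beta.
  apply: le_trans (enormD_le _ _) _; apply: lerD => //.
  rewrite enormZ ger0_norm // mulrC ler_wpM2r //.
  apply: le_trans (enormD_le _ _) _; rewrite enormN.
  by move: Bx Bz; rewrite /unit_ball /=; lra.
have H2 : enorm (penalty_dir g lam z) <= lam * Gg.
  have Gz := Gg_max Bz.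
  rewrite /penalty_dir; case: ifP => _; last first.
    by rewrite enorm0 mulr_ge0 ?(ltW lam0) // (le_trans (enorm_ge0 _) Gz).
  by rewrite enormZ ger0_norm ?(ltW lam0) // ler_wpM2l // ltW.
rewrite /G_H; lra.
Qed.

(** With [eta = 2 / (m (i + 2))] the expansion of the projected step is divided by [2 eta], so
    squared distances carry the weight [m (i + 2) / 4]; strong convexity lowers the weight of the
    old one to [m i / 4]. The new distance enters the next step with weight only [m (i + 1) / 4],
    and this mismatch is the negative term left over for the noise. *)
Lemma psm_step x z zs a v z' i : B x -> B z -> B zs -> enorm a <= Gf ->
  limiting_subdiff f z v ->
  z' = proj_ball (z - step_size m i.+1 *:
      (a + beta *: (z - x) + penalty_dir g lam z)) ->
  H x z - H x zs <= dot (v - a) (z - zs) + m * i%:R / 4 * dot (z - zs) (z - zs)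
    - m * i.+2%:R / 4 * dot (z' - zs) (z' - zs) + G ^+ 2 / m * (i.+2%:R)^-1.
Proof.
move=> Bx Bz Bzs aG vz z'E; have m0 := m_gt0 setting.
have sub := prox_obj_subgradient x Bz Bzs vz.
have dirb := psm_direction_bound Bx Bz aG.
pose h := a + beta *: (z - x) + penalty_dir g lam z.
have hE : v + beta *: (z - x) + penalty_dir g lam z = h + (v - a).
  by rewrite /h; apply/rowP => j; rewrite !mxE; ring.
rewrite {}hE in sub; rewrite -/h in dirb z'E.
have near := proj_ball_nearer (z - step_size m i.+1 *: h) Bzs.
rewrite -{}z'E in near; move: (dot (z' - zs) _) near => D'.
move: h dirb sub => h dirb sub.
have hh : dot h h <= G ^+ 2.
  by rewrite -enorm_sqr lerXn2r // nnegrE ?enorm_ge0 // (le_trans (enorm_ge0 h)).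
rewrite (_ : zs - z = - (z - zs)) in sub; last by rewrite opprB.
rewrite (_ : z - _ - zs = (z - zs) - step_size m i.+1 *: h); last first.
  by rewrite addrAC.
move: (z - zs) (v - a) sub => e n; rewrite !dotE (dotC e h) => sub near.
have etaE : step_size m i.+1 = 2 / (m * i.+2%:R) by [].
have i2 : 0 < i.+2%:R :> R by rewrite ltr0n.
have mi : 0 < m * i.+2%:R by rewrite mulr_gt0.
have iE : i%:R = i.+2%:R - 2 :> R by rewrite -(natr1 i.+1) -(natr1 i); ring.
set eta := step_size m i.+1 in etaE near *.
have e0 : 0 < eta by rewrite etaE divr_gt0.
have nearh : D' <= dot e e - 2 * eta * dot h e + eta ^+ 2 * G ^+ 2.
  have := ler_wpM2l (sqr_ge0 eta) hh; lra.
have eta1 : m * i.+2%:R / 4 * (2 * eta) = 1 by rewrite etaE; field; rewrite !gt_eqF.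
have eta2 : m * i.+2%:R / 4 * eta ^+ 2 = m^-1 * (i.+2%:R)^-1.
  by rewrite etaE; field; rewrite !gt_eqF.
have := ler_wpM2l (ltW (divr_gt0 mi (ltr0n _ 4))) nearh.
have -> : m * i.+2%:R / 4 * (dot e e - 2 * eta * dot h e + eta ^+ 2 * G ^+ 2) =
  m * i.+2%:R / 4 * dot e e - (m * i.+2%:R / 4 * (2 * eta)) * dot h e
  + (m * i.+2%:R / 4 * eta ^+ 2) * G ^+ 2 by ring.
rewrite eta1 eta2 iE mul1r; move: sub.
move: (i.+2%:R^-1 : R) (i.+2%:R : R) => r s.
move: (m^-1 : R) (m : R) => mi' m'; lra.
Qed.

Variables (x zs : vec) (z a v : nat -> vec).
Hypotheses (Bx : B x) (Bzs : B zs) (z0 : z 0%N = x).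
Hypothesis zS : forall i, z i.+1 = proj_ball (z i - step_size m i.+1 *:
  (a i + beta *: (z i - x) + penalty_dir g lam (z i))).
Hypothesis v_sub : forall i, limiting_subdiff f (z i) (v i).

Lemma psm_sequence_in i : B (z i).
Proof. by case: i => [|i]; rewrite ?z0 // zS; exact: proj_ball_in. Qed.

(** Telescoping leaves [- m / 4] times every squared distance except the initial one. That one is
    added on both sides, so that the noise sum on the right has a compensator in each summand. *)
Lemma psm_regret n : (forall i, (i < n)%N -> enorm (a i) <= Gf) ->
  \sum_(0 <= i < n) (H x (z i) - H x zs)
    + m * n.+1%:R / 4 * dot (z n - zs) (z n - zs) <=
  \sum_(0 <= i < n) (dot (v i - a i) (z i - zs) - m / 4 * dot (z i - zs) (z i - zs))
    + m / 4 * dot (x - zs) (x - zs) + G ^+ 2 / m * \sum_(0 <= i < n) (i.+2%:R)^-1.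
Proof.
elim: n => [|n IH] aG; first by rewrite !big_nil z0 mulr0 addr0 !add0r mulr1n mulr1.
have {}IH := IH (fun i ni => aG i (ltnW ni)).
rewrite !big_nat_recr //=.
have := psm_step (i := n) Bx (psm_sequence_in n) Bzs (aG n (ltnSn n)) (v_sub n) (zS n).
have n1 : n.+1%:R = n%:R + 1 :> R by rewrite -natr1.
rewrite !mulrDr n1 in IH *; move: IH.
move: (\sum_(0 <= i < n) _) (\sum_(0 <= i < n) _) (\sum_(0 <= i < n) _) => S1 S2 S3.
move: (n.+2%:R^-1 : R) (n.+2%:R : R) (m^-1 : R) (m : R) => r s mi m'; lra.
Qed.

Lemma psm_average_gap n : (0 < n)%N -> (forall i, (i < n)%N -> enorm (a i) <= Gf) ->
  n%:R * (H x (n%:R^-1 *: \sum_(0 <= i < n) z i) - H x zs) <=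
  m + G ^+ 2 / m * ln (n%:R + 1) +
  \sum_(0 <= i < n) (dot (v i - a i) (z i - zs) - m / 4 * dot (z i - zs) (z i - zs)).
Proof.
move=> n0 aG; have reg := psm_regret aG; have m0 := m_gt0 setting.
have cvx : semiconvex B 0 (H x).
  move=> u w t Bu Bw t0 t1; apply: le_trans (prox_obj_semiconvex setting x Bu Bw t0 t1) _.
  rewrite lerD2l mul0r mul0r.
  have q0 : 0 <= m * (t * (1 - t) * dot (u - w) (u - w)).
    by apply: mulr_ge0; [exact: ltW | rewrite !mulr_ge0 ?dot_ge0 ?subr_ge0].
  lra.
have := jensen_average n0 cvx psm_sequence_in.
(* The diameter 2 of the ball turns the initial term [m / 4 * dot (x - zs) (x - zs)] into the
   summand [m] of [U_]. *)
have D0 : dot (x - zs) (x - zs) <= 4.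
  have : enorm (x - zs) <= 2.
    apply: le_trans (enormD_le _ _) _; rewrite enormN.
    by move: Bx Bzs; rewrite /unit_ball /=; lra.
  by rewrite enorm_leP //; lra.
have : G ^+ 2 / m * \sum_(0 <= i < n) (i.+2%:R)^-1 <= G ^+ 2 / m * ln (n%:R + 1).
  by rewrite ler_wpM2l ?sum_inv_le_ln // divr_ge0 ?sqr_ge0 // ltW.
have : 0 <= m * n.+1%:R / 4 * dot (z n - zs) (z n - zs).
  by rewrite !mulr_ge0 ?dot_ge0 ?invr_ge0 // ltW.
have := ler_wpM2l (ltW m0) D0.
move: reg; rewrite sumrB big_const_nat subn0 iter_addr_0 -[_ *+ n]mulr_natl.
move: (m * n.+1%:R / 4 * _) (G ^+ 2 / m * ln _) => A1 A2.
move: (G ^+ 2 / m * _) (H x (_ *: _)) => A3 A4.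
move: (\sum_(0 <= i < n) _) (\sum_(0 <= i < n) _) => S1 S2.
by move: (m : R) (n%:R : R) => m' n'; lra.
Qed.

End inner_regret.

(** * Hoeffding's inequality and the choice of parameters *)

Section hoeffding.
Context {R : realType}.
Implicit Types (a b u r x y p q : R).

Lemma ge_init_of_derive_ge0 (h dh : R -> R) u :
  (forall x : R, 0 <= x -> is_derive x (1 : R) h (dh x)) -> (forall x, 0 <= x -> 0 <= dh x) ->
  0 <= u -> h 0 <= h u.
Proof.
move=> D dh0 u0.
have c : {within `[0, u], continuous h}.
  apply: derivable_within_continuous => t; rewrite in_itv /= => /andP [t0 _].
  by have [] := D t t0.
have [|t] := MVT_segment u0 _ c (df := dh).
  by move=> t; rewrite in_itv /= => /andP [/ltW t0 _]; exact: D.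
rewrite in_itv /= subr0 => /andP [t0 _] hE.
by rewrite -subr_ge0 hE mulr_ge0 // dh0.
Qed.

Lemma expR_chord u y : -1 <= y -> y <= 1 ->
  expR (- (u * y)) <= (1 - y) / 2 * expR u + (1 + y) / 2 * expR (- u).
Proof.
move=> y1 y2; have t0 : 0 <= (1 - y) / 2 by lra.
have t1 : (1 - y) / 2 <= 1 by lra.
have := convex_expR (Itv01 t0 t1) u (- u); rewrite !convRE /= /unstable.onem.
have -> : (1 - y) / 2 * u + (1 - (1 - y) / 2) * - u = - (u * y) by field.
by have -> : 1 - (1 - y) / 2 = (1 + y) / 2 by field.
Qed.

Lemma is_derive_expR_affine a b x :
  is_derive x (1 : R) (fun u => expR (a * u + b)) (a * expR (a * x + b)).
Proof.
have D : is_derive x (1 : R) (fun u => a * u + b) a.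
  have -> : (fun u => a * u + b) = (a \*: (@id R)) \+ cst b by [].
  apply: is_derive_eq; rewrite /GRing.scale /=; ring.
by rewrite mulrC; apply: (@is_derive1_comp R expR (fun u => a * u + b)).
Qed.

(* Two-point case of Hoeffding's lemma, with masses [q] at [1] and [p] at [-1]:
   [S / C] is the tilted mean and [S^2 / C^2] is what its derivative lacks to 1. *)
Lemma hoeffding_two_point p q u : 0 <= p -> 0 <= q -> p + q = 1 -> 0 <= u ->
  (q * expR u + p * expR (- u)) * expR (u * (p - q)) <= expR (u ^+ 2 / 2).
Proof.
move=> p0 q0 pq u0.
pose C x := q * expR (1 * x + 0) + p * expR (-1 * x + 0).
pose S x := q * expR (1 * x + 0) - p * expR (-1 * x + 0).
have C0 x : 0 < C x.
  rewrite /C; have := expR_gt0 (1 * x + 0); have := expR_gt0 (-1 * x + 0).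
  move: (expR _) (expR _) => a b a0 b0.
  have [pE|p1] := eqVneq p 0.
    by rewrite (_ : q = 1) ?pE ?mul0r ?addr0 ?mul1r //; lra.
  by rewrite ltr_wpDl ?mulr_ge0 ?(ltW b0) // mulr_gt0 // lt_neqAle eq_sym p1.
have C_0 : C 0 = 1 by rewrite /C !mulr0 !addr0 expR0 !mulr1 addrC.
have S_0 : S 0 = q - p by rewrite /S !mulr0 !addr0 expR0 !mulr1.
have dC x : is_derive x (1 : R) C (S x).
  have -> : C = (q \*: (fun u => expR (1 * u + 0)))
    \+ (p \*: (fun u => expR (-1 * u + 0))) by [].
  have D1 := is_derive_expR_affine 1 0 x.
  have D2 := is_derive_expR_affine (-1) 0 x.
  apply: is_derive_eq; rewrite /S /GRing.scale /=; ring.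
have dS x : is_derive x (1 : R) S (C x).
  have -> : S = (q \*: (fun u => expR (1 * u + 0)))
    \- (p \*: (fun u => expR (-1 * u + 0))) by [].
  have D1 := is_derive_expR_affine 1 0 x.
  have D2 := is_derive_expR_affine (-1) 0 x.
  apply: is_derive_eq; rewrite /C /GRing.scale /=; ring.
have mean x : 0 <= x -> S x <= (x + (q - p)) * C x.
  move=> x0; have Cx := C0 x.
  pose h y := y - S y / C y.
  have h0 : h 0 = - (q - p) by rewrite /h C_0 S_0 divr1 sub0r.
  have : h 0 <= h x.
    apply: (@ge_init_of_derive_ge0 h (fun y => (S y / C y) ^+ 2)) x0 => y y0;
      last exact: sqr_ge0.
    have dCV : is_derive y (1 : R) (fun z => (C z)^-1) (- (C y) ^- 2 *: S y).
      by apply: is_deriveV; rewrite ?gt_eqF.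
    have -> : h = (@id R) \- (S \* (fun z => (C z)^-1)) by [].
    apply: is_derive_eq; rewrite /GRing.scale /=.
    by field; rewrite gt_eqF.
  rewrite h0 /h -ler_pdivrMr //; lra.
(* The centred exponential moment divided by the claimed bound; [mean] says that it is
   nonincreasing. *)
pose psi x := C x * expR (x * (p - q) - x ^+ 2 / 2).
have dE x : is_derive x (1 : R) (fun x => expR (x * (p - q) - x ^+ 2 / 2))
    ((p - q - x) * expR (x * (p - q) - x ^+ 2 / 2)).
  have D : is_derive x (1 : R) (fun x => x * (p - q) - x ^+ 2 / 2) (p - q - x).
    have -> : (fun x => x * (p - q) - x ^+ 2 / 2)
      = ((p - q) \*: (@id R)) \- ((1 / 2) \*: ((@id R) ^+ 2)).
      apply: funext => z; transitivity ((p - q) * z - 1 / 2 * z ^+ 2); first by field.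
      by [].
    by apply: is_derive_eq; rewrite /GRing.scale /= expr1; field.
  rewrite mulrC; exact: (@is_derive1_comp R expR (fun x => x * (p - q) - x ^+ 2 / 2)
    x _ _ (is_derive_expR _) D).
have psi_le : - psi 0 <= - psi u.
  apply: (@ge_init_of_derive_ge0 (fun x => - psi x)
    (fun x => ((x + (q - p)) * C x - S x) * expR (x * (p - q) - x ^+ 2 / 2))) u0 => x x0;
    last by rewrite mulr_ge0 ?expR_ge0 // subr_ge0 mean.
  have -> : (fun x => - psi x)
    = \- (C \* (fun x => expR (x * (p - q) - x ^+ 2 / 2))) by [].
  have dCx := dC x; have dEx := dE x.
  apply: is_derive_eq; rewrite /GRing.scale /=; ring.
move: psi_le; rewrite lerN2 /psi C_0 mul0r expr0n mul0r subr0 expR0 mul1r expRB.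
by rewrite mulrA ler_pdivrMr ?expR_gt0 // mul1r /C !addr0 mul1r mulN1r.
Qed.

(** Here [r] is minus the mean of the two-point law, which matches the chord of
    [expR (- (u * y))]. *)
Lemma hoeffding_two_point_mean u r : -1 <= r -> r <= 1 -> 0 <= u ->
  expR (u * r) * ((1 - r) / 2 * expR u + (1 + r) / 2 * expR (- u))
    <= expR (u ^+ 2 / 2).
Proof.
move=> r1 r2 u0.
have := @hoeffding_two_point ((1 + r) / 2) ((1 - r) / 2) u.
have -> : (1 + r) / 2 - (1 - r) / 2 = r by field.
by move=> H; rewrite mulrC; apply: H => //; lra.
Qed.

End hoeffding.

(** * Outer and inner iteration counts *)

Section parameters.
Context {R : realType}.
Implicit Types (beta Delta eps m G : R).

Lemma abs_ceil_itv (x : R) : 0 <= x ->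
  x <= (`|Num.ceil x|%N)%:R /\ (`|Num.ceil x|%N)%:R <= x + 1.
Proof.
move=> x0; have c0 : 0 <= Num.ceil x by rewrite ceil_ge0; lra.
have -> : (`|Num.ceil x|%N)%:R = (Num.ceil x)%:~R :> R.
  by rewrite -[in RHS](gez0_abs c0) -pmulrn.
by split; [exact: ceil_ge | have := ceilB1_lt x; rewrite rmorphB /=; lra].
Qed.

Lemma T_outer_le beta Delta eps : 0 < beta -> 0 <= Delta -> 0 < eps ->
  (T_outer beta Delta eps)%:R <= 48 * (1 + beta * Delta / eps ^+ 2).
Proof.
move=> b0 D0 e0; set s := beta * Delta / eps ^+ 2.
have s0 : 0 <= s by rewrite divr_ge0 ?sqr_ge0 // mulr_ge0 // ltW.
rewrite /T_outer (_ : 48 * beta * Delta / eps ^+ 2 = 48 * s); last by rewrite /s !mulrA.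
have [_ H] := abs_ceil_itv (mulr_ge0 (ler0n R 48) s0).
by rewrite natr_max ge_max; apply/andP; split; lra.
Qed.

Lemma T_outer_ge2 beta Delta eps : (2 <= T_outer beta Delta eps)%N.
Proof. exact: leq_maxl. Qed.

Lemma T_outer_ge beta Delta eps : 0 < beta -> 0 <= Delta -> 0 < eps ->
  48 * beta * Delta <= (T_outer beta Delta eps)%:R * eps ^+ 2.
Proof.
move=> b0 D0 e0; rewrite -ler_pdivrMr ?exprn_gt0 //.
have x0 : 0 <= 48 * beta * Delta / eps ^+ 2.
  by rewrite divr_ge0 ?sqr_ge0 // !mulr_ge0 // ltW.
apply: le_trans (abs_ceil_itv x0).1 _; by rewrite ler_nat leq_maxr.
Qed.

End parameters.

Section inner_budget.
Context {R : realType}.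
Implicit Types (x beta Delta eps m G : R).

Lemma nat_above x : 0 <= x -> exists n : nat, x <= n%:R /\ n%:R <= x + 1.
Proof.
by move=> x0; exists `|Num.ceil x|%N; exact: abs_ceil_itv.
Qed.

(** The tangent bound of [ln] at [1 / t], with its constant -1 dropped. For [t] of order [eps ^ 2]
    it absorbs the logarithm of [K] into a small multiple of [K * eps ^ 2], so that [K] can be
    chosen explicitly. *)
Lemma ln_le_linear x t : 0 < x -> 0 < t -> ln x <= t * x - ln t :> R.
Proof.
move=> x0 t0; have tx := mulr_gt0 t0 x0.
have : ln (1 + (t * x - 1)) <= t * x - 1 by apply: le_ln1Dx; lra.
by rewrite addrC subrK lnM ?posrE //; lra.
Qed.

(** [C] is fixed before the functions are, when the sign of [Delta] is still unknown; hence the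
    absolute value. *)
Lemma inner_budget m G beta Delta : 0 < m -> 0 < beta ->
  exists2 C : R, 0 < C & forall eps (T : nat),
    0 < eps -> eps < 1 -> (2 <= T)%N ->
    T%:R <= 48 * (1 + beta * `|Delta| / eps ^+ 2) ->
  exists K : nat,
    [/\ (2 <= K)%N /\ U_ K m G (1 / (6 * T%:R)) <= e_star m beta eps,
        K%:R <= polylog C 1 eps * eps ^- 2 &
        (T * K)%:R <= polylog C 1 eps * eps ^- 4].
Proof.
move=> m0 b0.
pose g2 := G ^+ 2 / m.
have g20 : 0 <= g2 by rewrite divr_ge0 ?sqr_ge0 // ltW.
(* [kap * eps ^+ 2] is [e_star]. *)
pose kap := (48 * beta * (1 + beta / m))^-1.
have kap0 : 0 < kap by rewrite invr_gt0 !mulr_gt0 // addr_gt0 // divr_gt0.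
pose A := 48 * (1 + beta * `|Delta|).
have A0 : 48 <= A by rewrite /A; have := mulr_ge0 (ltW b0) (normr_ge0 Delta); lra.
(* Gives [g2 * t <= kap / 2]: the term with the logarithm of [K] uses about half of the budget
   [kap * eps ^+ 2 * K]. *)
pose t := kap / (2 * (g2 + 1)).
have t0 : 0 < t by rewrite divr_gt0 //; lra.
pose c1 := `|ln t| + 2; pose c2 := `|ln (6 * A)| + 2.
have c10 : 0 <= c1 by rewrite /c1; have := normr_ge0 (ln t); lra.
have c20 : 0 <= c2 by rewrite /c2; have := normr_ge0 (ln (6 * A)); lra.
(* Collects the remaining terms, each a multiple of [L], which have to fit into the other half of
   the budget. *)
pose c3 := m + g2 * c1 + 2 * g2 * c2 + kap / 2.
have c30 : 0 < c3.
  by rewrite /c3; have := mulr_ge0 g20 c10; have := mulr_ge0 g20 c20; lra.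
pose c4 := 2 * c3 / kap + 3.
have c40 : 3 <= c4.
  have : 0 <= 2 * c3 / kap by apply: divr_ge0; [lra | exact: ltW].
  by rewrite /c4; lra.
exists (A * c4) => [|eps T e0 e1 T2 TA]; first by apply: mulr_gt0; lra.
pose L := 1 + ln (1 / eps).
have L1 : 1 <= L by rewrite /L lerDl ln_ge0 // div1r invf_ge1 // ltW.
have e2 : 0 < eps ^+ 2 by rewrite exprn_gt0.
have e21 : eps ^+ 2 < 1 by rewrite exprn_ilt1 // ltW.
have lneps : ln (eps ^+ 2) = - 2 * (L - 1).
  by rewrite lnXn // /L div1r lnV ?posrE // -mulr_natl; lra.
have TA' : T%:R <= A / eps ^+ 2.
  apply: le_trans TA _; rewrite /A -[X in _ <= X]mulrA ler_wpM2l // mulrDl lerD2r.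
  by rewrite div1r invf_ge1 // ltW.
have [n [nl nu]] : exists n : nat, 2 * c3 * L / (kap * eps ^+ 2) <= n%:R /\
    n%:R <= 2 * c3 * L / (kap * eps ^+ 2) + 1.
  by apply: nat_above; rewrite divr_ge0 // mulr_ge0 //; lra.
have TK : (n.+2)%:R <= c4 * L / eps ^+ 2.
  have -> : n.+2%:R = n%:R + 2 :> R by rewrite -addn2 natrD.
  have : 3 <= 3 * L / eps ^+ 2 by rewrite ler_pdivlMr //; nra.
  have -> : c4 * L / eps ^+ 2 = 2 * c3 * L / (kap * eps ^+ 2) + 3 * L / eps ^+ 2.
    by rewrite /c4; field; rewrite !gt_eqF.
  lra.
exists n.+2; split.
- split => //; have K0 : 0 < n.+2%:R :> R by rewrite ltr0n.
  have T0 : 0 < T%:R :> R by rewrite ltr0n (leq_trans _ T2).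
  rewrite /U_ ler_pdivrMr // -/g2.
  have -> : e_star m beta eps = kap * eps ^+ 2 by rewrite /e_star /kap mulrC.
  have H1 : ln (n.+2%:R + 1) <= t * eps ^+ 2 * (n.+2%:R + 1) + c1 * L :> R.
    apply: le_trans (ln_le_linear (t := t * eps ^+ 2) _ _) _.
    - by rewrite addr_gt0.
    - by rewrite mulr_gt0.
    rewrite lnM ?posrE // lneps.
    have := ler_norm (- ln t); rewrite normrN => lt.
    have : `|ln t| * 1 <= `|ln t| * L by rewrite ler_wpM2l.
    by rewrite /c1; lra.
  have H2 : ln (1 / (1 / (6 * T%:R))) <= c2 * L :> R.
    have -> : 1 / (1 / (6 * T%:R)) = 6 * T%:R :> R by field; rewrite gt_eqF.
    apply: (@le_trans _ _ (ln (6 * A / eps ^+ 2))).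
      rewrite ler_ln ?posrE //; first by rewrite -mulrA ler_wpM2l.
        by rewrite mulr_gt0.
      by apply: divr_gt0 => //; lra.
    have A6 : 0 < 6 * A by lra.
    rewrite ln_div ?posrE //.
    rewrite lneps; have := ler_norm (ln (6 * A)) => lt.
    have : `|ln (6 * A)| * 1 <= `|ln (6 * A)| * L by rewrite ler_wpM2l.
    by rewrite /c2; lra.
  have H3 : g2 * t <= kap / 2.
    by rewrite /t mulrA ler_pdivrMr; [nra | lra].
  have {}nl : c3 * L <= kap * eps ^+ 2 / 2 * n%:R.
    by move: nl; rewrite ler_pdivrMr ?mulr_gt0 //; lra.
  have nE : n.+2%:R = n%:R + 2 :> R by rewrite -addn2 natrD.
  have G1 := ler_wpM2l g20 H1; have G2 := ler_wpM2l g20 H2.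
  have G3 : g2 * t * (eps ^+ 2 * (n%:R + 3)) <= kap / 2 * (eps ^+ 2 * (n%:R + 3)).
    by rewrite ler_wpM2r // mulr_ge0 ?(ltW e2) // addr_ge0.
  have G6 : 0 <= kap * eps ^+ 2 by apply: mulr_ge0; exact: ltW.
  have G4 : m * 1 <= m * L by rewrite ler_wpM2l // ltW.
  have G5 : kap * eps ^+ 2 <= kap * L.
    by rewrite ler_wpM2l ?(ltW kap0) //; lra.
  move: nl; rewrite /c3 => nl.
  move: G1 G2; rewrite nE mulrDr => G1 G2.
  move: (ln _) (ln _) G1 G2 => a b G1 G2.
  lra.
- apply: le_trans TK _; rewrite /polylog expr1 -/L ler_wpM2r ?invr_ge0 ?(ltW e2) //.
  rewrite ler_wpM2r //; first lra.
  by rewrite ler_peMl //; lra.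
- rewrite natrM /polylog expr1 -/L.
  have -> : A * c4 * L * eps ^- 4 = (A / eps ^+ 2) * (c4 * L / eps ^+ 2).
    by field; rewrite gt_eqF.
  by rewrite ler_pM.
Qed.

End inner_budget.

(** * Measurability and conditional expectation *)

Section vector_measurability.
Context {R : realType} {d : nat}.
Local Notation vec := ('rV[R]_d).
Local Notation borel_vec := (g_sigma_algebraType (@open vec)).
Context {dT : measure_display} {T : measurableType dT}.
Implicit Types (X Y : T -> vec).

Lemma open_measurable_preimage X (O : set vec) : open O ->
  measurable_fun [set: T] (X : T -> borel_vec) -> measurable (X @^-1` O).
Proof.
move=> oO mX; rewrite -[X in measurable X]setTI; apply: mX => //.
exact: sub_sigma_algebra.
Qed.

(** The part of [U] where [h] exceeds [r] is open, however [h] behaves outside [U], and [X] never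
    leaves [U]. *)
Lemma measurable_comp_continuous_on (U : set vec) (h : vec -> R) X : open U ->
  (forall x, U x -> {for x, continuous h}) -> (forall w, U (X w)) ->
  measurable_fun [set: T] (X : T -> borel_vec) ->
  measurable_fun [set: T] (fun w => h (X w)).
Proof.
move=> oU ch UX mX; apply: (measurability _ (RGenOInfty.measurableE R)).
move=> _ [_ [r ->] <-]; rewrite setTI.
have -> : (fun w => h (X w)) @^-1` `]r, +oo[%classic
    = X @^-1` [set x | U x /\ r < h x].
  apply/seteqP; split => w /=; rewrite in_itv /= andbT; first by split.
  by case.
apply: open_measurable_preimage mX.
rewrite openE => x [Ux hx] /=.
apply/nbhs_enormP.
have /nbhs_enormP [e1 e10 He1] : nbhs x U by exact: open_nbhs_nbhs.
have /nbhs_enormP [e2 e20 He2] : nbhs x (fun z => r < h z).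
  exact: (@cvgr_gt R vec (nbhs x) _ h (h x) (ch x Ux) r hx).
exists (Num.min e1 e2); first by rewrite lt_min e10.
by move=> y; rewrite lt_min => /andP [y1 y2]; split; [exact: He1 | exact: He2].
Qed.

Lemma measurable_comp_continuous (h : vec -> R) X : continuous h ->
  measurable_fun [set: T] (X : T -> borel_vec) ->
  measurable_fun [set: T] (fun w => h (X w)).
Proof.
by move=> ch; apply: (measurable_comp_continuous_on openT) => // x _; exact: ch.
Qed.

Lemma measurable_vec_coord X i :
  measurable_fun [set: T] (X : T -> borel_vec) ->
  measurable_fun [set: T] (fun w => X w 0 i).
Proof.
apply: (measurable_comp_continuous (h := fun x : vec => x 0 i)).
exact: coord_continuous.
Qed.

Definition rational_box (c : {ffun 'I_d -> rat}) (n : nat) : set vec :=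
  [set x | forall i, `|x 0 i - ratr (c i)| < (n.+1%:R)^-1].

(** A countable base of boxes: it reduces Borel measurability of a random vector to that of its
    coordinates. *)
Lemma open_rational_boxes (O : set vec) : open O ->
  O = \bigcup_(b : {ffun 'I_d -> rat} * nat)
        (if pselect (rational_box b.1 b.2 `<=` O) then rational_box b.1 b.2 else set0).
Proof.
move=> oO; apply/seteqP; split => [x Ox|x [[c n] _]]; last first.
  by case: pselect => //= sub /sub.
have /nbhs_normP [e e0 He] : nbhs x O by exact: open_nbhs_nbhs.
(* Two points of a box of radius below [e / 2] differ by less than [e] in every coordinate. *)
have [n ne] : exists n : nat, (n.+1%:R)^-1 < e / 2.
  have [nl _] := abs_ceil_itv (ltW (divr_gt0 (ltr0n R 2) e0)).
  exists `|Num.ceil (2 / e)|%N.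
  rewrite invf_plt ?posrE ?divr_gt0 ?ltr0n // invf_div.
  by rewrite (le_lt_trans nl) // ltr_nat.
have n0 : 0 < (n.+1%:R)^-1 :> R by rewrite invr_gt0 ltr0n.
have [r rE] : exists r, r = (n.+1%:R)^-1 :> R by exists (n.+1%:R)^-1.
rewrite -rE in ne n0.
have /choice [c Hc] : forall i, exists q : rat,
    `|x 0 i - ratr q| < r.
  move=> i; have [|q] := @rat_in_itvoo R (x 0 i - r) (x 0 i + r).
    lra.
  by rewrite in_itv /= => /andP [q1 q2]; exists q; rewrite ltr_norml; lra.
exists ([ffun i => c i], n) => //; case: pselect => [_ i|]; first by rewrite -rE ffunE.
case=> y Hy; apply: He; rewrite /ball_ /=.
have en : mx_norm (x - y) <= 2 * r.
  rewrite mx_normrE; apply/bigmax_leP; split; first by lra.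
  move=> [i j] _ /=; rewrite (ord1 i) !mxE.
  have := Hy j; rewrite -rE; have := Hc j; rewrite /= ffunE !ltr_norml ler_norml.
  by move=> /andP [a1 a2] /andP [b1 b2]; apply/andP; split; lra.
apply: le_lt_trans en _; lra.
Qed.

Lemma measurable_vecP X : (forall i, measurable_fun [set: T] (fun w => X w 0 i)) ->
  measurable_fun [set: T] (X : T -> borel_vec).
Proof.
move=> mX; apply: (@measurability _ _ T borel_vec setT X (@open vec) erefl).
move=> _ [V oV <-]; rewrite setTI (open_rational_boxes oV) preimage_bigcup.
apply: countable_bigcupT_measurable => [|[c n]]; first exact: countableP.
case: (pselect _) => [sub|nsub] /=; last by rewrite preimage_set0.
have -> : X @^-1` rational_box c n
    = \bigcap_(i in [set: 'I_d]) [set w | `|X w 0 i - ratr (c i)| < (n.+1%:R)^-1].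
  by apply/seteqP; split => w /= H i; [move=> _|]; exact: H.
apply: fin_bigcap_measurable => // i _.
have m1 : measurable_fun [set: T] (fun w => `|X w 0 i - ratr (c i)|).
  apply: (@measurableT_comp _ _ _ _ _ _ (@Num.norm R R)); first exact: normr_measurable.
  by apply: measurable_funB => //; exact: mX.
rewrite -[X in measurable X]setTI.
have := m1 measurableT `]-oo, (n.+1%:R)^-1[%classic (measurable_itv _).
congr (measurable _); apply/seteqP; split => w /=; by rewrite in_itv.
Qed.

End vector_measurability.

Section conditional_expectation.
Context {R : realType} {dO : measure_display} {Omega : measurableType dO}.
Variable P : probability Omega R.
Implicit Types (G : set (set Omega)) (Y V Z f : Omega -> R) (M : R).

Lemma sigma_measurable_sub G : G `<=` measurable ->
  forall A : set Omega, G.-sigma.-measurable A -> measurable A.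
Proof.
move=> Gm A mA; exact: (smallest_sub (sigma_algebra_measurable Omega) Gm mA).
Qed.

Lemma measurable_fun_coarser G dT (T : measurableType dT) (X : Omega -> T) :
  G `<=` measurable ->
  measurable_fun [set: g_sigma_algebraType G] (X : g_sigma_algebraType G -> T) ->
  measurable_fun [set: Omega] X.
Proof.
move=> Gm mX _ B mB; apply: (sigma_measurable_sub Gm).
exact: (mX measurableT B mB).
Qed.

Lemma measurable_fun_sub_sigma G1 G2 dT (T : measurableType dT) (X : Omega -> T) :
  G1 `<=` G2 ->
  measurable_fun [set: g_sigma_algebraType G1] (X : g_sigma_algebraType G1 -> T) ->
  measurable_fun [set: g_sigma_algebraType G2] (X : g_sigma_algebraType G2 -> T).
Proof.
move=> G12 mX _ B mB; have := mX measurableT B mB.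
exact: (@sub_smallest2r _ (sigma_algebra setT) _ _ (smallest_sigma_algebra _ _) G12).
Qed.

Lemma bounded_integrable f M : measurable_fun [set: Omega] f ->
  (forall w, `|f w| <= M) -> P.-integrable setT (EFin \o f).
Proof.
move=> mf fM; apply: measurable_bounded_integrable => //.
  by rewrite (le_lt_trans (probability_le1 P measurableT)) // ltry.
exists M; split; first exact: num_real.
by move=> x Mx w _; exact: le_trans (fM w) (ltW Mx).
Qed.

Lemma integrable_bounded_mul f Z M : measurable_fun [set: Omega] Z ->
  (forall w, `|Z w| <= M) -> P.-integrable setT (EFin \o f) ->
  P.-integrable setT (EFin \o (fun w => Z w * f w)).
Proof.
move=> mZ ZM intf; have -> : EFin \o (fun w => Z w * f w)
    = ((EFin \o Z) \* (EFin \o f))%E by apply: funext => w /=; rewrite EFinM.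
apply: integrableMr => //; exists M; split; first exact: num_real.
by move=> x Mx w _; exact: le_trans (ZM w) (ltW Mx).
Qed.

Lemma integrable_addr f h : P.-integrable setT (EFin \o f) ->
  P.-integrable setT (EFin \o h) ->
  P.-integrable setT (EFin \o (fun w => f w + h w)).
Proof. by move=> i1 i2; exact: (integrableD measurableT i1 i2). Qed.

Lemma integrable_subr f h : P.-integrable setT (EFin \o f) ->
  P.-integrable setT (EFin \o h) ->
  P.-integrable setT (EFin \o (fun w => f w - h w)).
Proof. by move=> i1 i2; exact: (integrableB measurableT i1 i2). Qed.

Lemma integrable_scaler f a : P.-integrable setT (EFin \o f) ->
  P.-integrable setT (EFin \o (fun w => a * f w)).
Proof. by move=> i1; exact: (integrableZl measurableT a i1). Qed.

Lemma integrable_normr f : P.-integrable setT (EFin \o f) ->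
  P.-integrable setT (EFin \o (fun w => `|f w|)).
Proof. by move=> i1; exact: (integrable_abse i1). Qed.

Lemma integrable_sum n (h : 'I_n -> Omega -> R) :
  (forall i, P.-integrable setT (EFin \o h i)) ->
  P.-integrable setT (EFin \o (fun w => \sum_i h i w)) /\
  \int[P]_w (\sum_i h i w) = \sum_i \int[P]_w h i w.
Proof.
elim: n h => [|n IH] h ih.
  have -> : (fun w => \sum_(i < 0) h i w) = cst 0 by apply: funext => w; rewrite big_ord0.
  by split; [exact: integrable0 | rewrite big_ord0 Rintegral_cst // mul0r].
have [i1 e1] := IH (fun i => h (lift ord0 i)) (fun i => ih _).
have -> : (fun w => \sum_i h i w) = (fun w => h ord0 w + \sum_i h (lift ord0 i) w).
  by apply: funext => w; rewrite big_ord_recl.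
split; first by apply: integrable_addr => //; exact: ih.
by rewrite RintegralD ?big_ord_recl ?e1.
Qed.

(** The sum counts the integer levels below [x]. Applied pointwise, it replaces a bounded
    nonnegative function by a sum of indicators of superlevel sets with uniform error 1. *)
Lemma count_lt_close (x : R) (J : nat) : 0 <= x -> x <= J%:R ->
  `|x - \sum_(j < J) (j%:R < x)%R%:R| <= 1.
Proof.
move=> x0; elim: J => [|J IH] xJ; first by
  rewrite big_ord0 subr0 ger0_norm // (le_trans xJ).
rewrite big_ord_recr /=; have [Jx|Jx] := ltP J%:R x; last by rewrite addr0 IH.
rewrite (eq_bigr (fun=> 1)) => [|j _]; last first.
  have jJ : (j%:R : R) < J%:R by rewrite ltr_nat.
  by rewrite (lt_trans jJ Jx).
rewrite sumr_const card_ord /= mulr1n.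
by move: xJ; rewrite -natr1 ler_norml => xJ; apply/andP; split; lra.
Qed.

Lemma Rintegral_indicM (A : set Omega) (f : Omega -> R) :
  \int[P]_w ((w \in A)%:R * f w) = \int[P]_(w in A) f w.
Proof.
rewrite [in RHS]Rintegral_mkcond; apply: eq_Rintegral => w _.
by rewrite patchE; case: (w \in A); rewrite ?mul1r ?mul0r.
Qed.

(** The definition gives the claim for indicators. Approximating [Z] by integer levels costs at most
    the mean of [|Y - V|], whatever the size of [Z]; multiplying [Z] by an arbitrarily large [N]
    then forces equality. *)
Lemma cond_exp_mul G Y V Z M : G `<=` measurable -> is_cond_exp P G Y V ->
  measurable_fun [set: g_sigma_algebraType G] (Z : g_sigma_algebraType G -> R) ->
  (forall w, `|Z w| <= M) ->
  \int[P]_w (Z w * Y w) = \int[P]_w (Z w * V w).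
Proof.
move=> Gm [iY iV mV eYV] mZ ZM.
pose D w := Y w - V w.
have iD : P.-integrable setT (EFin \o D).
  exact: integrable_subr.
have D0 (A : set Omega) : G.-sigma.-measurable A -> \int[P]_w ((w \in A)%:R * D w) = 0.
  move=> mA; have mA' := sigma_measurable_sub Gm mA.
  rewrite Rintegral_indicM RintegralB //; last 2 first.
  - exact: integrableS iY.
  - exact: integrableS iV.
  by rewrite /Rintegral eYV // subrr.
pose I := \int[P]_w `|D w|.
(* The bound does not depend on [J], which is what makes the later scaling effective. *)
have bound Z' (J : nat) :
    measurable_fun [set: g_sigma_algebraType G] (Z' : g_sigma_algebraType G -> R) ->
    (forall w, 0 <= Z' w <= J%:R) -> `|\int[P]_w (Z' w * D w)| <= I.
  move=> mZ' Z'J.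
  pose A (j : 'I_J) : set Omega := [set w | j%:R < Z' w].
  have mA j : G.-sigma.-measurable (A j).
    have := mZ' measurableT `]j%:R, +oo[%classic (measurable_itv _).
    rewrite setTI; congr (_.-sigma.-measurable _); apply/seteqP.
    by split => w /=; rewrite in_itv /= andbT.
  have mA' j := sigma_measurable_sub Gm (mA j).
  have iA j : P.-integrable setT (EFin \o (fun w => (w \in A j)%:R * D w)).
    apply: (@integrable_bounded_mul D (fun w => (w \in A j)%:R) 1) => //.
      exact: (measurable_indic (mA' j)).
    by move=> w; case: (_ \in _); rewrite ?normr1 ?normr0.
  have [iS eS] := integrable_sum iA.
  have iZ' : P.-integrable setT (EFin \o (fun w => Z' w * D w)).
    apply: (@integrable_bounded_mul _ _ J%:R) => //.
      exact: (measurable_fun_coarser Gm).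
    by move=> w; have /andP [z0 zJ] := Z'J w; rewrite ger0_norm.
  have -> : \int[P]_w (Z' w * D w)
      = \int[P]_w (Z' w * D w - \sum_j (w \in A j)%:R * D w).
    by rewrite RintegralB // eS big1 ?subr0 // => j _; exact: D0.
  apply: le_trans (le_normr_Rintegral _ _) _ => //.
    exact: integrable_subr.
  apply: le_Rintegral => //.
  - by apply: integrable_normr; exact: integrable_subr.
  - exact: integrable_normr.
  move=> w _; rewrite -mulr_suml -mulrBl normrM ler_piMl //.
  have /andP [z0 zJ] := Z'J w.
  apply: le_trans (count_lt_close z0 zJ); rewrite le_eqVlt; apply/orP; left.
  apply/eqP; congr (`|_ - _|); apply: eq_bigr => j _; congr (nat_of_bool _)%:R.
  by apply/idP/idP; rewrite /A inE.
have M0 : 0 <= M.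
  by have := ZM point; apply: le_trans; exact: normr_ge0.
have mZO := measurable_fun_coarser Gm mZ.
have iZY := integrable_bounded_mul mZO ZM iY.
have iZV := integrable_bounded_mul mZO ZM iV.
have iZD : P.-integrable setT (EFin \o (fun w => Z w * D w)).
  exact: (integrable_bounded_mul mZO ZM iD).
suff : \int[P]_w (Z w * D w) = 0.
  have -> : \int[P]_w (Z w * D w) = \int[P]_w (Z w * Y w - Z w * V w).
    by apply: eq_Rintegral => w _; rewrite mulrBr.
  by rewrite RintegralB // => /eqP; rewrite subr_eq0 => /eqP.
have DT : \int[P]_w D w = 0.
  have := D0 setT measurableT; rewrite Rintegral_indicM.
  by [].
have ZE (N : R) : \int[P]_w (N * (Z w + M) * D w) = N * \int[P]_w (Z w * D w).
  have -> : \int[P]_w (N * (Z w + M) * D w)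
      = \int[P]_w (N * (Z w * D w) + N * M * D w).
    by apply: eq_Rintegral => w _; ring.
  have i1 : P.-integrable setT (EFin \o (fun w => N * (Z w * D w))).
    exact: integrable_scaler.
  have i2 : P.-integrable setT (EFin \o (fun w => N * M * D w)).
    exact: integrable_scaler.
  by rewrite RintegralD // !RintegralZl // DT mulr0 addr0.
(* [Z] is shifted by [M] to become nonnegative; the shift is invisible because [D] has mean 0. *)
have key (N : nat) : N%:R * `|\int[P]_w (Z w * D w)| <= I.
  rewrite -[N%:R]ger0_norm // -normrM -ZE.
  have [J [JM _]] := nat_above (mulr_ge0 (ler0n R N) (addr_ge0 M0 M0)).
  apply: (bound _ J).
    apply: measurable_funM => //; exact: measurable_funD.
  move=> w; have := ZM w; rewrite ler_norml => /andP [z1 z2].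
  rewrite mulr_ge0 //=; last lra.
  by apply: le_trans JM; rewrite ler_wpM2l //; lra.
apply/eqP; rewrite -normr_le0 leNgt; apply/negP => d0.
have [N [NI _]] := nat_above (divr_ge0 (le_trans (mulr_ge0 (ler0n R 0) (normr_ge0 _)) (key 0%N)) (ltW d0)).
have := key N.+1; rewrite -natr1 mulrDl mul1r.
by rewrite ler_pdivrMr // in NI; lra.
Qed.

End conditional_expectation.

(** * Conditional Hoeffding lemma *)

Section subgaussian_step.
Context {R : realType} {d : nat} {dO : measure_display} {Omega : measurableType dO}.
Variable P : probability Omega R.
Local Notation vec := ('rV[R]_d).
Local Notation borel_vec := (g_sigma_algebraType (@open vec)).

(** The measurable space is a parameter: the same closure rules are used on the whole space and on
    each history. *)
Definition bounded_measurable dT (T : measurableType dT) (f : T -> R) : Prop :=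
  measurable_fun [set: T] f /\ exists M, forall w, `|f w| <= M.

Section closure.
Context {dT : measure_display} {T : measurableType dT}.
Implicit Types f h : T -> R.

Lemma bounded_measurable_cst (c : R) : bounded_measurable (fun _ : T => c).
Proof. by split => //; exists `|c|. Qed.

Lemma bounded_measurableD f h : bounded_measurable f -> bounded_measurable h ->
  bounded_measurable (fun w => f w + h w).
Proof.
move=> [mf [M fM]] [mh [N hN]]; split; first exact: measurable_funD.
by exists (M + N) => w; rewrite (le_trans (ler_normD _ _)) // lerD.
Qed.

Lemma bounded_measurableM f h : bounded_measurable f -> bounded_measurable h ->
  bounded_measurable (fun w => f w * h w).
Proof.
move=> [mf [M fM]] [mh [N hN]]; split; first exact: measurable_funM.
by exists (M * N) => w; rewrite normrM ler_pM.
Qed.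

Lemma bounded_measurableZ c f : bounded_measurable f ->
  bounded_measurable (fun w => c * f w).
Proof. by move=> bf; apply: bounded_measurableM => //; exact: bounded_measurable_cst. Qed.

Lemma bounded_measurableB f h : bounded_measurable f -> bounded_measurable h ->
  bounded_measurable (fun w => f w - h w).
Proof.
move=> bf bh; have := bounded_measurableD bf (bounded_measurableZ (-1) bh).
by congr bounded_measurable; apply: funext => w; rewrite mulN1r.
Qed.

Lemma bounded_measurable_expR f : bounded_measurable f ->
  bounded_measurable (fun w => expR (f w)).
Proof.
move=> [mf [M fM]]; split.
  by apply: measurableT_comp => //; exact: measurable_expR.
exists (expR M) => w; rewrite ger0_norm ?expR_ge0 // ler_expR.
exact: le_trans (ler_norm _) (fM w).
Qed.

Lemma bounded_measurable_sum n (h : 'I_n -> T -> R) :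
  (forall i, bounded_measurable (h i)) ->
  bounded_measurable (fun w => \sum_i h i w).
Proof.
elim: n h => [|n IH] h bh.
  have -> : (fun w => \sum_(i < 0) h i w) = cst 0 by apply: funext => w; rewrite big_ord0.
  exact: bounded_measurable_cst.
have -> : (fun w => \sum_i h i w) = (fun w => h ord0 w + \sum_i h (lift ord0 i) w).
  by apply: funext => w; rewrite big_ord_recl.
by apply: bounded_measurableD => //; exact: IH.
Qed.

Lemma bounded_measurable_dot (X Y : T -> vec) :
  (forall i, bounded_measurable (fun w => X w 0 i)) ->
  (forall i, bounded_measurable (fun w => Y w 0 i)) ->
  bounded_measurable (fun w => dot (X w) (Y w)).
Proof.
move=> bX bY; rewrite /dot.
by apply: bounded_measurable_sum => i; exact: bounded_measurableM.
Qed.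

Lemma bounded_measurable_coord (X : T -> vec) M :
  measurable_fun [set: T] (X : T -> borel_vec) -> (forall w, enorm (X w) <= M) ->
  forall i, bounded_measurable (fun w => X w 0 i).
Proof.
move=> mX XM i; split; first exact: measurable_vec_coord.
by exists M => w; exact: le_trans (normr_coord_le _ _) (XM w).
Qed.

Lemma bounded_measurable_enorm (X : T -> vec) M :
  measurable_fun [set: T] (X : T -> borel_vec) -> (forall w, enorm (X w) <= M) ->
  bounded_measurable (fun w => enorm (X w)).
Proof.
move=> mX XM; split.
  by apply: measurable_comp_continuous mX; exact: continuous_enorm.
by exists M => w; rewrite ger0_norm ?enorm_ge0.
Qed.

Lemma bounded_measurable_direction (X : T -> vec) M :
  measurable_fun [set: T] (X : T -> borel_vec) -> (forall w, enorm (X w) <= M) ->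
  forall i, bounded_measurable (fun w => (enorm (X w))^-1 * X w 0 i).
Proof.
move=> mX XM i; split.
  apply: measurable_funM; last exact: measurable_vec_coord.
  (* The inverse is a real power, a measurable function; the two agree also at 0, where both
     vanish. *)
  have -> : (fun w => (enorm (X w))^-1) = (fun w => enorm (X w) `^ (-1)).
    by apply: funext => w; rewrite powR_inv1 ?enorm_ge0.
  apply: (@measurableT_comp _ _ _ _ _ _ (@powR R ^~ (-1))).
    exact: measurable_powR.
  exact: (bounded_measurable_enorm mX XM).1.
exists 1 => w; rewrite normrM normfV (ger0_norm (enorm_ge0 _)).
have [->|N0] := eqVneq (enorm (X w)) 0; first by rewrite invr0 mul0r.
by rewrite ler_pdivrMl ?mulr1 ?normr_coord_le // lt_neqAle eq_sym N0 enorm_ge0.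
Qed.

End closure.

Lemma bounded_measurable_integrable (f : Omega -> R) : bounded_measurable f ->
  P.-integrable setT (EFin \o f).
Proof. by move=> [mf [M fM]]; exact: bounded_integrable mf fM. Qed.

Lemma bounded_measurable_coarser (G : set (set Omega)) (f : Omega -> R) :
  G `<=` measurable ->
  bounded_measurable (f : g_sigma_algebraType G -> R) -> bounded_measurable f.
Proof. by move=> Gm [mf bf]; split => //; exact: (measurable_fun_coarser Gm). Qed.

(** As the inverse of 0 is 0, the normalized direction of a null vector is null and the bound holds
    there too. *)
Lemma unit_slope (a e : vec) c : 0 < c -> enorm a <= c ->
  -1 <= dot a ((enorm e)^-1 *: e) / c <= 1.
Proof.
move=> c0 ac; rewrite -ler_norml normrM normfV (gtr0_norm c0) ler_pdivrMr // mul1r.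
apply: le_trans (normr_dot_le _ _) _.
have e1 : enorm ((enorm e)^-1 *: e) <= 1.
  rewrite enormZ normfV (ger0_norm (enorm_ge0 _)).
  have [->|N0] := eqVneq (enorm e) 0; first by rewrite mulr0.
  by rewrite mulVf.
by apply: le_trans ac; rewrite ler_piMr ?enorm_ge0.
Qed.

Lemma dot_direction (a e : vec) : enorm e * dot a ((enorm e)^-1 *: e) = dot a e.
Proof.
rewrite dotZr; have [E|N0] := eqVneq (enorm e) 0.
  by rewrite E mul0r (enorm_eq0 E) dot0r.
by rewrite mulrA divff // mul1r.
Qed.

(* Conditional Hoeffding lemma, weighted by [W]: the chord of the exponential is
   affine in [a], so [a] may be replaced by its conditional expectation [V]. *)
Lemma subgaussian_step (G : set (set Omega)) (W : Omega -> R) (e a V : Omega -> vec)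
    (c theta M : R) :
  G `<=` measurable -> 0 < c -> 0 <= theta ->
  bounded_measurable (W : g_sigma_algebraType G -> R) -> (forall w, 0 <= W w) ->
  measurable_fun [set: g_sigma_algebraType G]
    (e : g_sigma_algebraType G -> borel_vec) ->
  (forall w, enorm (e w) <= M) ->
  measurable_fun [set: Omega] (a : Omega -> borel_vec) ->
  (forall w, enorm (a w) <= c) -> (forall w, enorm (V w) <= c) ->
  (forall i, is_cond_exp P G (fun w => a w 0 i) (fun w => V w 0 i)) ->
  \int[P]_w (W w * expR (theta * dot (V w - a w) (e w)))
    <= \int[P]_w (W w * expR (theta ^+ 2 * c ^+ 2 / 2 * dot (e w) (e w))).
Proof.
move=> Gm c0 th0 bW W0 me eM ma ac Vc ce.
pose n w := (enorm (e w))^-1 *: e w.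
pose u w := theta * c * enorm (e w).
pose r w := dot (V w) (n w) / c.
pose y w := dot (a w) (n w) / c.
(* [al w - ga w * y] is the chord of the exponential at [y], multiplied by the factor that comes
   from [V]. *)
pose al w := expR (u w * r w) * (expR (u w) + expR (- u w)) / 2.
pose ga w := expR (u w * r w) * (expR (u w) - expR (- u w)) / 2.
have bV i : bounded_measurable ((fun w => V w 0 i) : g_sigma_algebraType G -> R).
  split; first by have [_ _ mV _] := ce i.
  by exists c => w; exact: le_trans (normr_coord_le _ _) (Vc w).
have ba i : bounded_measurable (fun w => a w 0 i) := bounded_measurable_coord ma ac i.
have bn i : bounded_measurable ((fun w => n w 0 i) : g_sigma_algebraType G -> R).
  have := bounded_measurable_direction me eM i.
  by congr bounded_measurable; apply: funext => w; rewrite /n mxE.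
have bu : bounded_measurable (u : g_sigma_algebraType G -> R).
  by apply: bounded_measurableZ; exact: (bounded_measurable_enorm me eM).
have br : bounded_measurable (r : g_sigma_algebraType G -> R).
  apply: bounded_measurableM; last exact: bounded_measurable_cst.
  exact: (@bounded_measurable_dot _ (g_sigma_algebraType G)).
have bur : bounded_measurable ((fun w => expR (u w * r w)) : g_sigma_algebraType G -> R).
  by apply: bounded_measurable_expR; exact: (@bounded_measurableM _ (g_sigma_algebraType G)).
have beu : bounded_measurable ((fun w => expR (u w)) : g_sigma_algebraType G -> R).
  exact: bounded_measurable_expR.
have bNu : bounded_measurable ((fun w => expR (- u w)) : g_sigma_algebraType G -> R).
  apply: bounded_measurable_expR; have := bounded_measurableZ (-1) bu.
  by congr bounded_measurable; apply: funext => w; rewrite mulN1r.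
have bal : bounded_measurable (al : g_sigma_algebraType G -> R).
  apply: bounded_measurableM; last exact: bounded_measurable_cst.
  apply: bounded_measurableM => //; exact: bounded_measurableD.
have bga : bounded_measurable (ga : g_sigma_algebraType G -> R).
  apply: bounded_measurableM; last exact: bounded_measurable_cst.
  apply: bounded_measurableM => //; exact: bounded_measurableB.
(* Coefficients of the coordinates of [a] in the weighted chord; they are bounded and
   [G]-measurable, so each product can be conditioned separately. *)
pose ci i w := W w * ga w * n w 0 i / c.
have bci i : bounded_measurable (ci i : g_sigma_algebraType G -> R).
  apply: bounded_measurableM; last exact: bounded_measurable_cst.
  apply: bounded_measurableM => //; exact: bounded_measurableM.
have swap i : \int[P]_w (ci i w * a w 0 i) = \int[P]_w (ci i w * V w 0 i).
  have [mc [N cN]] := bci i; exact: (cond_exp_mul Gm (ce i) mc cN).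
have bWO := bounded_measurable_coarser Gm bW.
have balO := bounded_measurable_coarser Gm bal.
have bciO i := bounded_measurable_coarser Gm (bci i).
have bVO i := bounded_measurable_coarser Gm (bV i).
have iWal := bounded_measurable_integrable (bounded_measurableM bWO balO).
have ica i := bounded_measurable_integrable (bounded_measurableM (bciO i) (ba i)).
have icV i := bounded_measurable_integrable (bounded_measurableM (bciO i) (bVO i)).
have [iSa eSa] := integrable_sum ica; have [iSV eSV] := integrable_sum icV.
have sumE (b : Omega -> vec) w :
    \sum_i ci i w * b w 0 i = W w * ga w * (dot (b w) (n w) / c).
  rewrite /dot mulr_suml mulr_sumr; apply: eq_bigr => i _; rewrite /ci; ring.
have urE w : u w * r w = theta * dot (V w) (e w).
  rewrite -(dot_direction (V w) (e w)) /u /r; field; rewrite gt_eqF //.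
have uyE w : u w * y w = theta * dot (a w) (e w).
  rewrite -(dot_direction (a w) (e w)) /u /y; field; rewrite gt_eqF //.
have bdot : bounded_measurable (fun w => dot (e w) (e w)).
  apply: (bounded_measurable_coarser Gm).
  apply: (@bounded_measurable_dot _ (g_sigma_algebraType G)) => i;
    exact: (bounded_measurable_coord me eM).
apply: (@le_trans _ _ (\int[P]_w (W w * al w - \sum_i ci i w * a w 0 i))).
  apply: le_Rintegral => //.
  - apply: bounded_measurable_integrable; apply: bounded_measurableM => //.
    apply: bounded_measurable_expR; apply: bounded_measurableZ.
    have beO i := bounded_measurable_coarser Gm (bounded_measurable_coord me eM i).
    apply: bounded_measurable_dot => // i.
    have := bounded_measurableB (bVO i) (ba i).
    by congr bounded_measurable; apply: funext => w; rewrite !mxE.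
  - exact: integrable_subr.
  move=> w _; rewrite sumE -mulrA -mulrBr ler_wpM2l // -/(y w).
  have /andP [y1 y2] := unit_slope (e w) c0 (ac w).
  have := expR_chord (u w) y1 y2; rewrite -/(y w) uyE => H.
  rewrite dotDl dotNl mulrDr mulrN expRD -urE.
  apply: le_trans (ler_wpM2l (expR_ge0 _) H) _.
  by rewrite /al /ga; lra.
(* Here [a] is exchanged for its conditional expectation; the chord at [r] is a two-point
   exponential moment. *)
rewrite RintegralB // eSa (eq_bigr _ (fun i _ => swap i)) -eSV -RintegralB //.
apply: le_Rintegral => //.
- exact: integrable_subr.
- apply: bounded_measurable_integrable; apply: bounded_measurableM => //.
  by apply: bounded_measurable_expR; exact: bounded_measurableZ.
move=> w _; rewrite sumE -mulrA -mulrBr ler_wpM2l // -/(r w).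
have /andP [r1 r2] := unit_slope (e w) c0 (Vc w).
have u0 : 0 <= u w by rewrite !mulr_ge0 ?enorm_ge0 // ltW.
have := hoeffding_two_point_mean r1 r2 u0; rewrite -/(r w) => H.
have -> : theta ^+ 2 * c ^+ 2 / 2 * dot (e w) (e w) = u w ^+ 2 / 2.
  by rewrite -enorm_sqr /u; field.
by apply: le_trans H; rewrite /al /ga; lra.
Qed.

End subgaussian_step.

(** * Measurability of the elementary operations *)

Section step_measurability.
Context {R : realType} {d : nat}.
Local Notation vec := ('rV[R]_d).
Local Notation borel_vec := (g_sigma_algebraType (@open vec)).
Variables (f g : vec -> R) (U : set vec) (l Gf Lg lam beta : R).
Hypothesis setting : penalized_setting f g U l Gf Lg lam beta.
Context {dT : measure_display} {T : measurableType dT}.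
Implicit Types (x z a : T -> vec).

Lemma measurable_proj_ball z : measurable_fun [set: T] (z : T -> borel_vec) ->
  measurable_fun [set: T] ((fun w => proj_ball (z w)) : T -> borel_vec).
Proof.
move=> mz; apply: measurable_vecP => i.
apply: (measurable_comp_continuous (h := fun u : vec => proj_ball u 0 i)) mz.
move=> u; apply: (@cvg_coord R d vec (nbhs u) _ (@proj_ball R d)).
exact: continuous_proj_ball.
Qed.

Lemma measurable_prox_point x : measurable_fun [set: T] (x : T -> borel_vec) ->
  measurable_fun [set: T] ((fun w => prox_point f g lam beta (x w)) : T -> borel_vec).
Proof.
move=> mx; apply: measurable_vecP => i.
apply: (measurable_comp_continuous (h := fun u : vec => prox_point f g lam beta u 0 i)) mx.
move=> u; apply: (@cvg_coord R d vec (nbhs u) _ (prox_point f g lam beta)).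
exact: (continuous_prox_point setting).
Qed.

Lemma measurable_fun_f z : (forall w, unit_ball (z w)) ->
  measurable_fun [set: T] (z : T -> borel_vec) ->
  measurable_fun [set: T] (fun w => f (z w)).
Proof.
move=> Bz; have [_ _ _ _ _ oU _ BU _ lipf _ _] := setting.
apply: (measurable_comp_continuous_on oU) => [u Uu|w]; last exact: BU.
exact: (lipschitz_continuous oU lipf Uu).
Qed.

Lemma measurable_fun_g z : (forall w, unit_ball (z w)) ->
  measurable_fun [set: T] (z : T -> borel_vec) ->
  measurable_fun [set: T] (fun w => g (z w)).
Proof.
move=> Bz; have [_ _ _ _ _ oU _ BU _ _ C1g _] := setting.
apply: (measurable_comp_continuous_on oU) => [u Uu|w]; last exact: BU.
by have [dg _] := C1g u Uu; exact: differentiable_continuous.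
Qed.

Lemma measurable_grad_g z i : (forall w, unit_ball (z w)) ->
  measurable_fun [set: T] (z : T -> borel_vec) ->
  measurable_fun [set: T] (fun w => grad g (z w) 0 i).
Proof.
move=> Bz; have [_ _ _ _ _ oU _ BU _ _ C1g _] := setting.
apply: (measurable_comp_continuous_on (h := fun u => grad g u 0 i) oU) => [u Uu|w];
  last exact: BU.
have [_ cg] := C1g u Uu.
exact: (@cvg_coord R d vec (nbhs u) _ (grad g) (grad g u) i cg).
Qed.

Lemma measurable_psm_update eta x z a : (forall w, unit_ball (z w)) ->
  measurable_fun [set: T] (x : T -> borel_vec) ->
  measurable_fun [set: T] (z : T -> borel_vec) ->
  measurable_fun [set: T] (a : T -> borel_vec) ->
  measurable_fun [set: T] ((fun w => proj_ball (z w - eta *: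
    (a w + beta *: (z w - x w) + penalty_dir g lam (z w)))) : T -> borel_vec).
Proof.
move=> Bz mx mz ma; apply: measurable_proj_ball; apply: measurable_vecP => i.
have mp : measurable_fun [set: T] (fun w => penalty_dir g lam (z w) 0 i).
  have -> : (fun w => penalty_dir g lam (z w) 0 i)
      = (fun w => if 0 < g (z w) then lam * grad g (z w) 0 i else 0).
    by apply: funext => w; rewrite /penalty_dir; case: ifP; rewrite !mxE.
  apply: measurable_fun_ifT => //.
    by apply: measurable_fun_ltr => //; exact: measurable_fun_g.
  by apply: measurable_funM => //; exact: measurable_grad_g.
have -> : (fun w => (z w - eta *: (a w + beta *: (z w - x w)
      + penalty_dir g lam (z w))) 0 i)
    = (fun w => z w 0 i - eta * (a w 0 i + beta * (z w 0 i - x w 0 i)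
      + penalty_dir g lam (z w) 0 i)) by apply: funext => w; rewrite !mxE.
have mc (X : T -> vec) : measurable_fun [set: T] (X : T -> borel_vec) ->
    measurable_fun [set: T] (fun w => X w 0 i) by exact: measurable_vec_coord.
apply: measurable_funB; first exact: mc.
apply: measurable_funM => //; apply: measurable_funD => //.
apply: measurable_funD; first exact: mc.
by apply: measurable_funM => //; apply: measurable_funB; exact: mc.
Qed.

Lemma measurable_vec_sub x z :
  measurable_fun [set: T] (x : T -> borel_vec) ->
  measurable_fun [set: T] (z : T -> borel_vec) ->
  measurable_fun [set: T] ((fun w => x w - z w) : T -> borel_vec).
Proof.
move=> mx mz; apply: measurable_vecP => i.
have -> : (fun w => (x w - z w) 0 i) = (fun w => x w 0 i - z w 0 i).
  by apply: funext => w; rewrite !mxE.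
by apply: measurable_funB; exact: measurable_vec_coord.
Qed.

Lemma measurable_vec_average K (z : nat -> T -> vec) :
  (forall i, (i < K)%N -> measurable_fun [set: T] (z i : T -> borel_vec)) ->
  measurable_fun [set: T]
    ((fun w => K%:R^-1 *: \sum_(0 <= i < K) z i w) : T -> borel_vec).
Proof.
move=> mz; apply: measurable_vecP => j.
have -> : (fun w => (K%:R^-1 *: \sum_(0 <= i < K) z i w) 0 j)
    = (fun w => K%:R^-1 * \sum_(i < K) z i w 0 j).
  by apply: funext => w; rewrite mxE summxE big_mkord.
apply: measurable_funM => //; apply: measurable_sum => i.
by apply: measurable_vec_coord; exact: mz.
Qed.

Lemma measurable_enorm_sub x z :
  measurable_fun [set: T] (x : T -> borel_vec) ->
  measurable_fun [set: T] (z : T -> borel_vec) ->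
  measurable_fun [set: T] (fun w => enorm (x w - z w)).
Proof.
move=> mx mz; apply: (measurable_comp_continuous (@continuous_enorm R d)).
exact: measurable_vec_sub.
Qed.

Lemma measurable_prox_obj x z : (forall w, unit_ball (z w)) ->
  measurable_fun [set: T] (x : T -> borel_vec) ->
  measurable_fun [set: T] (z : T -> borel_vec) ->
  measurable_fun [set: T] (fun w => prox_obj f g lam beta (x w) (z w)).
Proof.
move=> Bz mx mz; apply: measurable_funD.
  apply: measurable_funD; first exact: measurable_fun_f.
  apply: measurable_funM => //; apply: measurable_maxr => //.
  exact: measurable_fun_g.
apply: measurable_funM => //; apply: measurable_funX.
exact: measurable_enorm_sub.
Qed.

End step_measurability.

(** * Measurability of the iterates with respect to the past *)

Section oracle_history.
Context {R : realType} {d : nat}.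
Local Notation vec := ('rV[R]_d).
Local Notation borel_vec := (g_sigma_algebraType (@open vec)).
Context {dO dX : measure_display} {Omega : measurableType dO}
  {Xi : measurableType dX} (P : probability Omega R).
Variables (f g : vec -> R) (U : set vec) (l Gf Lg lam beta : R).
Hypothesis setting : penalized_setting f g U l Gf Lg lam beta.
Variables (vt : vec -> Xi -> vec) (v : vec -> vec) (xi : nat -> Omega -> Xi).
Hypothesis oracle : stochastic_oracle P f Gf vt xi v.
Local Notation m := (beta - l - lam * Lg).

Definition oracle_answer (w : Omega) (n : nat) (z : vec) : vec := vt z (xi n w).

Definition history_measurable (n : nat) (X : Omega -> vec) : Prop :=
  measurable_fun [set: g_sigma_algebraType (history xi n)]
    (X : g_sigma_algebraType (history xi n) -> borel_vec).

Lemma seed_events_measurable I : seed_events xi I `<=` measurable.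
Proof.
have [mxi _ _ _] := oracle; move=> _ [i _ [V mV <-]].
exact: (mxi i measurableT V mV).
Qed.

Lemma seed_events_mono I I' : I `<=` I' -> seed_events xi I `<=` seed_events xi I'.
Proof. by move=> II' A [i Ii iA]; exists i => //; exact: II'. Qed.

Lemma history_mono n n' : (n <= n')%N -> history xi n `<=` history xi n'.
Proof. by move=> nn'; apply: seed_events_mono => i /= /leq_trans; apply. Qed.

Lemma history_measurable_mono n n' X : (n <= n')%N ->
  history_measurable n X -> history_measurable n' X.
Proof. by move=> nn'; apply: measurable_fun_sub_sigma; exact: history_mono. Qed.

Lemma history_measurable_cst n x : history_measurable n (fun=> x).
Proof. exact: measurable_cst. Qed.

Lemma seed_measurable n : measurable_fun
  [set: g_sigma_algebraType (history xi n.+1)]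
  (xi n : g_sigma_algebraType (history xi n.+1) -> Xi).
Proof.
by move=> _ V mV; apply: sub_sigma_algebra; exists n; [exact: ltnSn | exists V].
Qed.

(** The answer to query [n] uses seed [n], which belongs to the history only from [n.+1] on. *)
Lemma answer_measurable n X : history_measurable n X ->
  history_measurable n.+1 (fun w => oracle_answer w n (X w)).
Proof.
move=> mX; have [_ mvt _ _] := oracle.
have mp : measurable_fun [set: g_sigma_algebraType (history xi n.+1)]
    ((fun w => (X w, xi n w)) : g_sigma_algebraType (history xi n.+1) -> borel_vec * Xi).
  apply: measurable_fun_pair; last exact: seed_measurable.
  exact: (history_measurable_mono (leqnSn n) mX).
exact: (measurableT_comp mvt mp).
Qed.

Lemma psm_point_in (ans : nat -> vec -> vec) xt n0 i : unit_ball xt ->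
  unit_ball (psm_point g lam beta m ans xt n0 i).
Proof. by case: i => [//|i] _; exact: proj_ball_in. Qed.

Lemma psm_point_measurable X n0 i : (forall w, unit_ball (X w)) ->
  history_measurable n0 X ->
  history_measurable (n0 + i)
    (fun w => psm_point g lam beta m (oracle_answer w) (X w) n0 i).
Proof.
move=> BX mX; elim: i => [|i IH]; first by rewrite addn0.
rewrite addnS.
have mz := history_measurable_mono (leqnSn (n0 + i)) IH.
have mx := history_measurable_mono (leq_trans (leq_addr i n0) (leqnSn _)) mX.
apply: (measurable_psm_update setting (step_size m i.+1) _ mx mz (answer_measurable IH)).
by move=> w; exact: psm_point_in.
Qed.

Lemma psm_value_measurable K X n0 : (forall w, unit_ball (X w)) ->
  history_measurable n0 X ->
  history_measurable (n0 + K)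
    (fun w => psm_value g lam beta m K (oracle_answer w) (X w) n0).
Proof.
move=> BX mX; apply: measurable_vec_average => i iK.
have := psm_point_measurable (i := i) BX mX.
by apply: history_measurable_mono; rewrite leq_add2l ltnW.
Qed.

Lemma psm_value_in K (ans : nat -> vec -> vec) xt n0 : (0 < K)%N -> unit_ball xt ->
  unit_ball (psm_value g lam beta m K ans xt n0).
Proof. by move=> K0 Bx; apply: average_in_ball => // i; exact: psm_point_in. Qed.

Lemma psm_iterate_in K (ans : nat -> vec -> vec) x0 t : (0 < K)%N -> unit_ball x0 ->
  unit_ball (psm_iterate g lam beta m K ans x0 t).
Proof. by move=> K0 Bx; elim: t => //= t IH; exact: psm_value_in. Qed.

Lemma psm_iterate_measurable K x0 t : (0 < K)%N -> unit_ball x0 ->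
  history_measurable (t * K)
    (fun w => psm_iterate g lam beta m K (oracle_answer w) x0 t).
Proof.
move=> K0 Bx; elim: t => [|t IH]; first exact: history_measurable_cst.
rewrite mulSnr; apply: psm_value_measurable => // w.
exact: psm_iterate_in.
Qed.

End oracle_history.

(** * Tail bound for one inner loop *)

Section truncation.
Context {R : realType} {d : nat}.
Local Notation vec := ('rV[R]_d).
Local Notation borel_vec := (g_sigma_algebraType (@open vec)).

(* The oracle is bounded only almost surely; truncating its answers makes the
   exponential supermartingale bounded everywhere. *)
Definition truncate (c : R) (u : vec) : vec := c *: proj_ball (c^-1 *: u).

Lemma truncate_le c u : 0 < c -> enorm (truncate c u) <= c.
Proof.
move=> c0; rewrite enormZ gtr0_norm // ler_piMr ?(ltW c0) //.
exact: proj_ball_in.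
Qed.

Lemma truncate_id c u : 0 < c -> enorm u <= c -> truncate c u = u.
Proof.
move=> c0 uc; rewrite /truncate proj_ball_id.
  by rewrite scalerA divff ?scale1r // gt_eqF.
by rewrite /unit_ball /= enormZ normfV gtr0_norm // ler_pdivrMl // mulr1.
Qed.

Lemma measurable_truncate dT (T : measurableType dT) c (u : T -> vec) :
  measurable_fun [set: T] (u : T -> borel_vec) ->
  measurable_fun [set: T] ((fun w => truncate c (u w)) : T -> borel_vec).
Proof.
have mZ b (x : T -> vec) : measurable_fun [set: T] (x : T -> borel_vec) ->
    measurable_fun [set: T] ((fun w => b *: x w) : T -> borel_vec).
  move=> mx; apply: measurable_vecP => i.
  have -> : (fun w => (b *: x w) 0 i) = (fun w => b * x w 0 i).
    by apply: funext => w; rewrite mxE.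
  by apply: measurable_funM => //; exact: measurable_vec_coord.
by move=> mu; apply: (mZ); apply: measurable_proj_ball; exact: mZ.
Qed.

End truncation.

Section cond_exp_ae.
Context {R : realType} {dO : measure_display} {Omega : measurableType dO}.
Variable P : probability Omega R.

(** Carries the conditional expectation from the oracle answers over to the truncated ones. *)
Lemma is_cond_exp_ae (G : set (set Omega)) (Y Y' V : Omega -> R) :
  G `<=` measurable -> P.-integrable setT (EFin \o Y') ->
  {ae P, forall w, Y w = Y' w} -> is_cond_exp P G Y V -> is_cond_exp P G Y' V.
Proof.
move=> Gm iY' ae [iY iV mV eYV]; split => // A mA; rewrite -eYV //.
have mA' := sigma_measurable_sub Gm mA.
apply: ae_eq_integral => //.
- by apply: measurable_funTS; exact: (measurable_int P iY').
- by apply: measurable_funTS; exact: (measurable_int P iY).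
- by apply: filterS ae => w /= -> _.
Qed.

End cond_exp_ae.

Section tail_bound.
Context {R : realType} {d : nat}.
Local Notation vec := ('rV[R]_d).
Local Notation borel_vec := (g_sigma_algebraType (@open vec)).
Context {dO dX : measure_display} {Omega : measurableType dO}
  {Xi : measurableType dX} (P : probability Omega R).
Variables (f g : vec -> R) (U : set vec) (l Gf Lg lam beta Gg : R).
Hypothesis setting : penalized_setting f g U l Gf Lg lam beta.
Hypothesis Gg_max : forall x, unit_ball x -> enorm (grad g x) <= Gg.
Variables (vt : vec -> Xi -> vec) (v : vec -> vec) (xi : nat -> Omega -> Xi).
Hypothesis oracle : stochastic_oracle P f Gf vt xi v.
Variables (X : Omega -> vec) (n0 : nat).
Hypothesis BX : forall w, unit_ball (X w).
Hypothesis mX : history_measurable xi n0 X.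
Local Notation m := (beta - l - lam * Lg).
Local Notation G := (G_H Gf Gg lam beta).
Local Notation hist n := (g_sigma_algebraType (history xi n)).

Let Gf_gt0 : 0 < Gf := lipschitz_f_gt0 setting.

Let z i w := psm_point g lam beta m (oracle_answer vt xi w) (X w) n0 i.
Let zs w := prox_point f g lam beta (X w).
Let a i w := oracle_answer vt xi w (n0 + i)%N (z i w).
Let b i w := truncate Gf (a i w).
Let e i w := z i w - zs w.
Let theta := m / (2 * Gf ^+ 2).
Let incr i w := dot (v (z i w) - b i w) (e i w) - m / 4 * dot (e i w) (e i w).
Let Mg n w := expR (theta * \sum_(0 <= i < n) incr i w).

Let Bz i w : unit_ball (z i w). Proof. exact: psm_point_in. Qed.

Let Bzs w : unit_ball (zs w). Proof. exact: (prox_point_in setting). Qed.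

Let theta_gt0 : 0 < theta.
Proof. by rewrite divr_gt0 ?(m_gt0 setting) // mulr_gt0 // exprn_gt0. Qed.

Let mz i : history_measurable xi (n0 + i) (z i).
Proof. exact: (psm_point_measurable setting oracle). Qed.

Let mb i : history_measurable xi (n0 + i.+1) (b i).
Proof.
by rewrite addnS; apply: measurable_truncate; exact: (answer_measurable oracle).
Qed.

Let me i : history_measurable xi (n0 + i) (e i).
Proof.
apply: (@measurable_vec_sub _ _ _ (hist (n0 + i))); first exact: mz.
apply: (measurable_prox_point setting).
exact: (history_measurable_mono (leq_addr i n0) mX).
Qed.

Let e_le i w : enorm (e i w) <= 2.
Proof.
apply: le_trans (enormD_le _ _) _; rewrite enormN.
by have := Bz i w; have := Bzs w; rewrite /unit_ball /=; lra.
Qed.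

Let v_le i w : enorm (v (z i w)) <= Gf.
Proof.
have [_ _ vsub _] := oracle; have [_ _ _ _ _ oU _ BU wf lipf _ _] := setting.
apply: (limiting_subdiff_bound oU wf lipf (ltW Gf_gt0) (BU _ (Bz i w))).
exact: vsub.
Qed.

Let b_le i w : enorm (b i w) <= Gf.
Proof. exact: truncate_le. Qed.

Let cond_exp_a i j : is_cond_exp P (history xi (n0 + i))
  (fun w => a i w 0 j) (fun w => v (z i w) 0 j).
Proof. by have [_ _ _ orc] := oracle; have [ce _] := orc _ _ (@mz i) (Bz i). Qed.

Lemma psm_answer_bounded : {ae P, forall w, forall i, enorm (a i w) <= Gf}.
Proof.
apply: ae_foralln => i.
by have [_ _ _ orc] := oracle; have [_] := orc _ _ (@mz i) (Bz i).
Qed.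

Let hist_sub n : history xi n `<=` measurable.
Proof. exact: (seed_events_measurable oracle). Qed.

Let bounded_b i j : bounded_measurable (fun w => b i w 0 j).
Proof.
apply: (bounded_measurable_coarser (@hist_sub _)).
exact: (bounded_measurable_coord (@mb i) (b_le i) j).
Qed.

Let cond_exp_b i j : is_cond_exp P (history xi (n0 + i))
  (fun w => b i w 0 j) (fun w => v (z i w) 0 j).
Proof.
apply: is_cond_exp_ae (cond_exp_a i j); first exact: (@hist_sub _).
  exact: bounded_measurable_integrable.
apply: filterS psm_answer_bounded => w /(_ i) ai.
by rewrite /b truncate_id.
Qed.

Let bounded_incr i n : (i < n)%N ->
  bounded_measurable (incr i : hist (n0 + n) -> R).
Proof.
move=> i_n.
have be j : bounded_measurable ((fun w => e i w 0 j) : hist (n0 + n) -> R).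
  apply: (@bounded_measurable_coord _ _ _ (hist (n0 + n)) (e i) 2); last exact: e_le.
  apply: (history_measurable_mono _ (@me i)).
  by rewrite leq_add2l ltnW.
apply: bounded_measurableB.
  apply: (@bounded_measurable_dot _ _ _ (hist (n0 + n))) => // j.
  (* [v] is an arbitrary selection; its measurability along the iterates comes from its being a
     conditional expectation. *)
  have bv : bounded_measurable ((fun w => v (z i w) 0 j) : hist (n0 + n) -> R).
    split; last first.
      by exists Gf => w; exact: le_trans (normr_coord_le _ _) (v_le i w).
    have [_ _ mv _] := cond_exp_a i j.
    apply: (measurable_fun_sub_sigma _ mv).
    by apply: history_mono; rewrite leq_add2l ltnW.
  have bb : bounded_measurable ((fun w => b i w 0 j) : hist (n0 + n) -> R).
    apply: (@bounded_measurable_coord _ _ _ (hist (n0 + n)) (b i) Gf); last exact: b_le.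
    apply: (history_measurable_mono _ (@mb i)).
    by rewrite leq_add2l.
  have := bounded_measurableB bv bb.
  by congr bounded_measurable; apply: funext => w; rewrite !mxE.
apply: bounded_measurableZ.
exact: (@bounded_measurable_dot _ _ _ (hist (n0 + n))).
Qed.

Let bounded_Mg n : bounded_measurable (Mg n : hist (n0 + n) -> R).
Proof.
apply: bounded_measurable_expR; apply: bounded_measurableZ.
have -> : (fun w => \sum_(0 <= i < n) incr i w) = (fun w => \sum_(i < n) incr i w).
  by apply: funext => w; rewrite big_mkord.
by apply: (@bounded_measurable_sum _ _ (hist (n0 + n))) => i; exact: bounded_incr.
Qed.

Let bounded_MgO n : bounded_measurable (Mg n).
Proof. exact: (bounded_measurable_coarser (@hist_sub _) (bounded_Mg n)). Qed.

Lemma psm_exponential_supermartingale n : \int[P]_w Mg n w <= 1.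
Proof.
elim: n => [|n IH].
  have -> : Mg 0 = cst 1.
    by apply: funext => w; rewrite /Mg big_nil mulr0 expR0.
  by rewrite Rintegral_cst // mul1r -[leRHS]/(fine 1%E) -(probability_setT P).
apply: le_trans IH.
pose D w := dot (e n w) (e n w).
(* The compensator of step [n] is known before the query, so it can be put into the weight; the
   Hoeffding bound then cancels it and leaves [Mg n]. *)
pose W w := Mg n w * expR (- (theta * (m / 4) * D w)).
have bD : bounded_measurable (D : hist (n0 + n) -> R).
  by apply: (@bounded_measurable_dot _ _ _ (hist (n0 + n))) => j;
    exact: (@bounded_measurable_coord _ _ _ (hist (n0 + n)) (e n) 2 (@me n) (e_le n)).
have bW : bounded_measurable (W : hist (n0 + n) -> R).
  apply: bounded_measurableM; first exact: bounded_Mg.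
  apply: bounded_measurable_expR.
  have := bounded_measurableZ (- (theta * (m / 4))) bD.
  by congr bounded_measurable; apply: funext => w; rewrite mulNr.
have W0 w : 0 <= W w by rewrite mulr_ge0 ?expR_ge0.
have mbO : measurable_fun [set: Omega] (b n : Omega -> borel_vec).
  exact: (measurable_fun_coarser (@hist_sub _) (@mb n)).
have := subgaussian_step (@hist_sub _) Gf_gt0 (ltW theta_gt0) bW W0 (@me n) (e_le n)
  mbO (b_le n) (v_le n) (cond_exp_b n).
have thE : theta ^+ 2 * Gf ^+ 2 / 2 = theta * (m / 4).
  by rewrite /theta; field; rewrite gt_eqF.
have -> : \int[P]_w (W w * expR (theta * dot (v (z n w) - b n w) (e n w)))
    = \int[P]_w Mg n.+1 w.
  apply: eq_Rintegral => w _; rewrite /W /Mg -!expRD big_nat_recr //=.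
  congr expR; rewrite /incr -/(D w); ring.
have -> // : \int[P]_w (W w * expR (theta ^+ 2 * Gf ^+ 2 / 2 * dot (e n w) (e n w)))
    = \int[P]_w Mg n w.
apply: eq_Rintegral => w _; rewrite thE /W -/(D w) -mulrA -expRD.
by rewrite addNr expR0 mulr1.
Qed.

Let gap K w := prox_obj f g lam beta (X w)
    (psm_value g lam beta m K (oracle_answer vt xi w) (X w) n0)
  - prox_obj f g lam beta (X w) (zs w).

Lemma psm_gap_measurable K : (0 < K)%N ->
  measurable_fun [set: hist (n0 + K)] (gap K : hist (n0 + K) -> R).
Proof.
move=> K0.
have mXK := history_measurable_mono (leq_addr K n0) mX.
apply: measurable_funB; apply: (measurable_prox_obj setting) => //.
- by move=> w; exact: psm_value_in.
- exact: (psm_value_measurable setting oracle).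
- exact: (measurable_prox_point setting).
Qed.

Lemma psm_tail K del : (0 < K)%N -> 0 < del -> del <= 1 ->
  (P [set w | (U_ K m G del < gap K w)%R] <= del%:E)%E.
Proof.
move=> K0 del0 del1; set E0 := [set w | _].
pose A := [set w | 1 / del <= Mg K w].
have mgap : measurable_fun [set: Omega] (gap K).
  exact: (measurable_fun_coarser (@hist_sub _) (psm_gap_measurable K0)).
have mE0 : measurable E0.
  have := mgap measurableT `]U_ K m G del, +oo[%classic (measurable_itv _).
  by rewrite setTI; congr measurable; apply/seteqP;
    split => w; rewrite /E0 /= in_itv /= andbT.
have mA : measurable A.
  have := (bounded_MgO K).1 measurableT `[1 / del, +oo[%classic (measurable_itv _).
  by rewrite setTI; congr measurable; apply/seteqP;
    split => w; rewrite /A /= in_itv /= andbT.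
have PA : (P A <= del%:E)%E.
  (* Markov's inequality for [Mg K], through comparison with a multiple of the indicator of [A]. *)
  have : \int[P]_w ((w \in A)%:R * (1 / del)) <= \int[P]_w Mg K w.
    apply: le_Rintegral => //.
    - apply: bounded_measurable_integrable; split.
        by apply: measurable_funM => //; exact: (measurable_indic mA).
      exists `|1 / del| => w; rewrite normrM.
      by case: (_ \in _); rewrite ?normr1 ?normr0 ?mul1r ?mul0r.
    - exact: bounded_measurable_integrable.
    move=> w _; case: (boolP (w \in A)) => [|_]; last by rewrite mul0r expR_ge0.
    by rewrite inE mul1r.
  rewrite (@Rintegral_indicM _ _ _ _ _ (fun=> 1 / del)) Rintegral_cst //.
  move=> /le_trans /(_ (psm_exponential_supermartingale K)).
  rewrite mulrAC mul1r ler_pdivrMr // mul1r -lee_fin fineK //.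
  exact: fin_num_measure.
(* Outside the null set [N] truncation changes nothing, and the deterministic regret bound applies
   to the run. *)
have [N [mN PN subN]] := psm_answer_bounded.
have E0A : E0 `<=` A `|` N.
  move=> w E0w; have [Nw|Nw] := pselect (N w); first by right.
  have aw : forall i, enorm (a i w) <= Gf.
    by apply: contrapT => H; apply: Nw; exact: subN.
  left; rewrite /A /= /Mg.
  have [_ _ vsub _] := oracle.
  have m0 := m_gt0 setting.
  have avg := @psm_average_gap _ _ f g U l Gf Lg lam beta Gg setting Gg_max (X w) (zs w)
    (z ^~ w) (a ^~ w) (fun i => v (z i w)) (BX w) (Bzs w) erefl (fun i => erefl)
    (fun i => vsub _ (Bz i w)) K K0 (fun i _ => aw i).
  have K0' : 0 < K%:R :> R by rewrite ltr0n.
  have incrE : \sum_(0 <= i < K) (dot (v (z i w) - a i w) (z i w - zs w)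
      - m / 4 * dot (z i w - zs w) (z i w - zs w)) = \sum_(0 <= i < K) incr i w.
    by apply: eq_bigr => i _; rewrite /incr /b truncate_id.
  rewrite incrE in avg.
  have gapw : U_ K m G del * K%:R < K%:R * gap K w.
    by rewrite mulrC ltr_pM2l.
  have {gapw} := lt_le_trans gapw avg.
  rewrite /U_ divfK ?gt_eqF //.
  have ln0 : 0 <= ln (1 / del) by rewrite ln_ge0 // div1r invf_ge1.
  move: (\sum_(0 <= i < K) _) => S.
  rewrite mulrDr addrA ltrD2l => HS.
  rewrite -[leLHS]lnK ?posrE ?divr_gt0 // ler_expR.
  (* The deviation term of [U_] carries [G], the noise only [Gf]: [theta] times that term is
     [G ^+ 2 / Gf ^+ 2 * ln (1 / del)], at least the level needed for [A]. *)
  have GG : Gf ^+ 2 <= G ^+ 2.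
    have b0 := beta_gt0 setting; have lam0 := penalty_gt0 setting.
    have Gg0 : 0 <= Gg := le_trans (enorm_ge0 _) (Gg_max (BX w)).
    rewrite lerXn2r ?nnegrE ?(ltW Gf_gt0) //.
      by rewrite /G_H !addr_ge0 ?mulr_ge0 // ltW.
    by rewrite /G_H; have := mulr_ge0 (ltW lam0) Gg0; lra.
  apply: le_trans (ler_wpM2l (ltW theta_gt0) (ltW HS)).
  have Gf2 : 0 < Gf ^+ 2 by rewrite exprn_gt0.
  have -> : theta * (G ^+ 2 / m * (2 * ln (1 / del))) = G ^+ 2 / Gf ^+ 2 * ln (1 / del).
    by rewrite /theta; field; rewrite !gt_eqF.
  by rewrite ler_peMl // ler_pdivlMr // mul1r.
apply: le_trans (le_measure _ _ _ E0A) _; rewrite ?inE //; first exact: measurableU.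
have le1 : (P (A `|` N) <= P A + P N)%E by exact: measureU2.
by apply: le_trans le1 _; rewrite PN adde0.
Qed.

End tail_bound.

(** * Outer descent and the sampled index *)

Section outer_descent.
Context {R : realType} {d : nat}.
Local Notation vec := ('rV[R]_d).
Variables (f g : vec -> R) (U : set vec) (l Gf Lg lam beta : R).
Hypothesis setting : penalized_setting f g U l Gf Lg lam beta.
Local Notation m := (beta - l - lam * Lg).
Local Notation H := (prox_obj f g lam beta).
Local Notation Q := (prox_point f g lam beta).
Local Notation F := (Psi f g lam).

(** [x'] is compared with both ends: growth at [Q x] bounds its squared distance to [Q x] by
    [2 * e / m], and the gap bounds its squared distance to [x] by the decrease of the penalty
    function plus [e]. The parallelogram inequality combines the two. *)
Lemma residual_descent (x x' : vec) (e : R) : unit_ball x -> unit_ball x' ->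
  H x x' - H x (Q x) <= e ->
  prox_residual f g lam beta x ^+ 2 <=
    4 * beta * (F x - F x' + e * (1 + beta / m)).
Proof.
move=> Bx Bx' gap; have m0 := m_gt0 setting; have b0 := beta_gt0 setting.
have H1 := prox_obj_growth setting (prox_point_argmin setting x) Bx.
have H2 := prox_obj_growth setting (prox_point_argmin setting x) Bx'.
rewrite /prox_residual exprMn enorm_sqr.
have near : dot (x' - Q x) (x' - Q x) <= 2 * e / m.
  by rewrite ler_pdivlMr //; lra.
have par : dot (x - Q x) (x - Q x) <=
    2 * dot (x' - x) (x' - x) + 2 * dot (x' - Q x) (x' - Q x).
  have := dot_ge0 ((x' - x) + (x' - Q x)).
  have -> : x - Q x = (x' - Q x) - (x' - x).
    by apply/rowP => i; rewrite !mxE; ring.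
  by move: (x' - x) (x' - Q x) => p q; rewrite !dotE (dotC q p); lra.
have Hx : H x x = F x by rewrite /prox_obj subrr enorm0 expr0n mulr0 addr0.
have Hx' : H x x' = F x' + beta / 2 * dot (x' - x) (x' - x).
  by rewrite /prox_obj enorm_sqr.
rewrite Hx in H1; rewrite Hx' in gap H2.
have mq : 0 <= m / 2 * dot (x - Q x) (x - Q x).
  by rewrite mulr_ge0 ?dot_ge0 // divr_ge0 // ltW.
move: (dot (x - Q x) _) (dot (x' - x) _) (dot (x' - Q x) _) (H x (Q x)) near par gap H1 H2 mq
  => p q r h near par gap H1 H2 mq.
have e1 := ler_wpM2l (ltW b0) near; have e2 := ler_wpM2l (ltW b0) par.
have K : beta * p <= 4 * (F x - F x' + e * (1 + beta / m)).
  have -> : e * (1 + beta / m) = e + beta * (2 * e / m) / 2 by field; rewrite gt_eqF.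
  lra.
have := ler_wpM2l (ltW b0) K; rewrite expr2; lra.
Qed.

Lemma sum_residual_le (x : nat -> vec) (e Psi_min : R) (T : nat) :
  (forall t, unit_ball (x t)) -> (forall y, unit_ball y -> Psi_min <= F y) ->
  (forall t, (t < T)%N -> H (x t) (x t.+1) - H (x t) (Q (x t)) <= e) ->
  \sum_(j < T) prox_residual f g lam beta (x j) ^+ 2 <=
    4 * beta * (F (x 0%N) - Psi_min + T%:R * (e * (1 + beta / m))).
Proof.
move=> Bx Fmin gap; have b0 := beta_gt0 setting.
suff : \sum_(j < T) prox_residual f g lam beta (x j) ^+ 2 <=
    4 * beta * (F (x 0%N) - F (x T) + T%:R * (e * (1 + beta / m))).
  move=> /le_trans; apply; rewrite ler_wpM2l ?mulr_ge0 ?(ltW b0) //.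
  by have := Fmin _ (Bx T); lra.
elim: T gap => [|T IH] gap.
  by rewrite big_ord0 subrr add0r mul0r mulr0.
rewrite big_ord_recr /=.
have := IH (fun t tT => gap t (ltnW tT)).
have := residual_descent (Bx T) (Bx T.+1) (gap T (ltnSn T)).
rewrite -[T.+1%:R]natr1; move: (e * _) (\sum_(j < T) _) => c s; lra.
Qed.

Lemma count_large_residuals (r : nat -> R) (eps q : R) (T : nat) : 0 < eps ->
  (forall j, 0 <= r j) -> \sum_(j < T) r j ^+ 2 <= q * eps ^+ 2 ->
  \sum_(j < T) (eps < r j)%R%:R <= q.
Proof.
move=> e0 r0 H1; have e2 : 0 < eps ^+ 2 by rewrite exprn_gt0.
rewrite -(ler_pM2r e2) mulr_suml; apply: le_trans H1; apply: ler_sum => j _.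
case: ltP => rj; last by rewrite mul0r sqr_ge0.
by rewrite mul1r lerXn2r ?nnegrE ?(ltW e0) // ltW.
Qed.

End outer_descent.

(** * Sampling an index independent of the seeds *)

Section sampled_index.
Context {R : realType} {dO dX : measure_display} {Omega : measurableType dO}
  {Xi : measurableType dX} (P : probability Omega R).

Lemma Rintegral_indicator (A : set Omega) : measurable A ->
  \int[P]_w (w \in A)%:R = fine (P A).
Proof.
move=> mA; rewrite (_ : (fun w => (w \in A)%:R) = (fun w => (w \in A)%:R * 1)).
  by rewrite Rintegral_indicM Rintegral_cst // mul1r.
by apply: funext => w; rewrite mulr1.
Qed.

Lemma integrable_indicator (A : set Omega) : measurable A ->
  P.-integrable setT (EFin \o (fun w => (w \in A)%:R : R)).
Proof.
move=> mA; apply: (@bounded_integrable _ _ _ _ _ 1).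
  exact: (measurable_indic mA).
by move=> w; case: (_ \in _); rewrite ?normr1 ?normr0.
Qed.

(** [Good] and the [S j] depend on the seeds only, so conditioning on the index amounts to averaging
    [P (Good & S j)] over [j]; the counting hypothesis bounds this average from below. *)
Lemma sampled_event (xi : nat -> Omega -> Xi) (T : nat) (J : Omega -> 'I_T)
    (Good : set Omega) (S : 'I_T -> set Omega) (q : R) :
  (0 < T)%N -> (forall n, measurable_fun [set: Omega] (xi n)) ->
  uniform_index P J -> index_indep_of_seeds P J xi ->
  (seed_events xi setT).-sigma.-measurable Good ->
  (forall j, (seed_events xi setT).-sigma.-measurable (S j)) ->
  (forall w, Good w -> \sum_j (w \in ~` S j)%:R <= q * T%:R) ->
  measurable [set w | Good w /\ S (J w) w] /\
  (1 - q) * fine (P Good) <= fine (P [set w | Good w /\ S (J w) w]).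
Proof.
move=> T0 mxi unif indep mG mS cnt; set E := [set w | _].
have seeds : seed_events xi setT `<=` measurable.
  by move=> _ [i _ [V mV <-]]; exact: (mxi i measurableT V mV).
have mA j : (seed_events xi setT).-sigma.-measurable (Good `&` S j).
  exact: measurableI.
have mAO j : measurable (Good `&` S j : set Omega) := sigma_measurable_sub seeds (mA j).
have mGO : measurable (Good : set Omega) := sigma_measurable_sub seeds mG.
have mB j : measurable (J @^-1` [set j] `&` (Good `&` S j)).
  by apply: measurableI => //; have [] := unif j.
have EE : E = \bigcup_(j in [set: 'I_T]) (J @^-1` [set j] `&` (Good `&` S j)).
  apply/seteqP; split => w; first by move=> [Gw Sw]; exists (J w).
  by move=> [j _ [<- [Gw Sw]]].
have mE : measurable E by rewrite EE; apply: fin_bigcup_measurable.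
split=> //; have T0' : 0 < T%:R :> R by rewrite ltr0n.
have PE : fine (P E) = \sum_j T%:R^-1 * fine (P (Good `&` S j)).
  rewrite -Rintegral_indicator //.
  have -> : (fun w => (w \in E)%:R)
      = (fun w => \sum_j (w \in J @^-1` [set j] `&` (Good `&` S j))%:R : R).
    apply: funext => w; rewrite (bigD1 (J w)) //= big1 ?addr0 => [|j jJ].
      by congr (nat_of_bool _)%:R; apply/idP/idP; rewrite !inE => -[].
    rewrite (_ : (_ \in _) = false) //; apply/negbTE; apply: contra jJ.
    by rewrite inE => -[/= -> _].
  have [_ ->] := integrable_sum (fun j => integrable_indicator (mB j)).
  apply: eq_bigr => j _; rewrite Rintegral_indicator // indep //.
  have [_ ->] := unif j; rewrite fineM //; exact: fin_num_measure.
(* Sum and integral are exchanged: at each outcome of [Good] at least [(1 - q) * T] of the events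
   [S j] occur. *)
have sumA : (1 - q) * T%:R * fine (P Good) <= \sum_j fine (P (Good `&` S j)).
  rewrite (eq_bigr (fun j => \int[P]_w (w \in Good `&` S j)%:R)); last first.
    by move=> j _; rewrite Rintegral_indicator.
  have [iS <-] := integrable_sum (fun j => integrable_indicator (mAO j)).
  rewrite -Rintegral_indicator // -RintegralZl //; last exact: integrable_indicator.
  apply: le_Rintegral => //.
    by apply: integrable_scaler; exact: integrable_indicator.
  move=> w _; case: (boolP (w \in Good)) => [|_]; last first.
    by rewrite mulr0; apply: sumr_ge0.
  rewrite inE => Gw; have := cnt w Gw.
  have -> : \sum_j (w \in Good `&` S j)%:R = \sum_(j < T) (1 - (w \in ~` S j)%:R) :> R.
    apply: eq_bigr => j _; rewrite in_setC in_setI mem_set //=.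
    by case: (w \in S j); rewrite /= ?subr0 ?subrr.
  rewrite sumrB sumr_const card_ord mulr1; lra.
rewrite PE -mulr_sumr (_ : (1 - q) * _ = T%:R^-1 * ((1 - q) * T%:R * fine (P Good))).
  by rewrite ler_wpM2l ?invr_ge0.
by rewrite -mulrA (mulrCA (1 - q)) mulKf ?gt_eqF.
Qed.

End sampled_index.

Section good_event.
Context {R : realType} {dO : measure_display} {Omega : measurableType dO}
  (P : probability Omega R).

(** Union bound in integrated form: the indicator of no bad event is at least 1 minus the sum of the
    bad indicators. *)
Lemma probability_no_bad_event (T : nat) (Bad : 'I_T -> set Omega) (del : R) :
  (forall t, measurable (Bad t)) -> (forall t, (P (Bad t) <= del%:E)%E) ->
  1 - T%:R * del <= fine (P [set w | forall t, ~ Bad t w]).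
Proof.
move=> mB PB; set Good := [set w | _].
have GE : Good = \bigcap_(t in [set: 'I_T]) ~` Bad t.
  by apply/seteqP; split => w /= H t; [move=> _|]; exact: H.
have mG : measurable Good.
  by rewrite GE; apply: fin_bigcap_measurable => // t _; exact: measurableC.
rewrite -Rintegral_indicator //.
have iB t := integrable_indicator P (mB t).
have [iS eS] := integrable_sum iB.
have i1 : P.-integrable setT (EFin \o (fun _ : Omega => 1 : R)).
  by apply: (@bounded_integrable _ _ _ _ _ 1) => // w; rewrite normr1.
have I1 : \int[P]_(_ in [set: Omega]) (1 : R) = 1.
  by rewrite Rintegral_cst // mul1r -[RHS]/(fine 1%E) -(probability_setT P).
apply: (@le_trans _ _ (\int[P]_w (1 - \sum_t (w \in Bad t)%:R))).
  rewrite RintegralB // I1 eS lerD2l lerN2.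
  have -> : T%:R * del = \sum_(t < T) del by rewrite sumr_const card_ord mulr_natl.
  apply: ler_sum => t _; rewrite Rintegral_indicator // -lee_fin fineK //.
  exact: fin_num_measure.
apply: le_Rintegral => //; [exact: integrable_subr | exact: integrable_indicator |].
move=> w _; case: (boolP (w \in Good)) => [_|].
  by rewrite gerBl; apply: sumr_ge0.
rewrite notin_setE /Good /= => /existsNP [t /contrapT Bt].
rewrite (bigD1 t) //= mem_set // opprD addrA subrr add0r oppr_le0.
by apply: sumr_ge0.
Qed.

End good_event.

(** * Probability that the sampled residual is small *)

Section guarantee.
Context {R : realType} {d : nat}.
Local Notation vec := ('rV[R]_d).
Context {dO dX : measure_display} {Omega : measurableType dO}
  {Xi : measurableType dX} (P : probability Omega R).
Variables (f g : vec -> R) (U : set vec) (l Gf Lg lam beta Gg : R).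
Hypothesis setting : penalized_setting f g U l Gf Lg lam beta.
Hypothesis Gg_max : forall x, unit_ball x -> enorm (grad g x) <= Gg.
Variables (vt : vec -> Xi -> vec) (v : vec -> vec) (xi : nat -> Omega -> Xi).
Hypothesis oracle : stochastic_oracle P f Gf vt xi v.
Local Notation m := (beta - l - lam * Lg).

Lemma small_residual_probability (x0 : vec) (Psi_min Delta eps : R) (K : nat)
    (J : Omega -> 'I_(T_outer beta Delta eps)) :
  let T := T_outer beta Delta eps in
  unit_ball x0 -> (forall y, unit_ball y -> Psi_min <= Psi f g lam y) ->
  Delta = Psi f g lam x0 - Psi_min -> 0 < eps -> (0 < K)%N ->
  U_ K m (G_H Gf Gg lam beta) (1 / (6 * T%:R)) <= e_star m beta eps ->
  uniform_index P J -> index_indep_of_seeds P J xi ->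
  exists E : set Omega, [/\ measurable E, ((2 / 3)%:E <= P E)%E &
    forall w, E w -> prox_residual f g lam beta
      (psm_iterate g lam beta m K (oracle_answer vt xi w) x0 (J w)) <= eps].
Proof.
move=> T Bx0 Fmin DeltaE e0 K0 UK unif indep.
have m0 := m_gt0 setting; have b0 := beta_gt0 setting.
have D0 : 0 <= Delta by rewrite DeltaE subr_ge0 Fmin.
have T0 : (0 < T)%N by exact: leq_trans (T_outer_ge2 _ _ _).
have T0' : 0 < T%:R :> R by rewrite ltr0n.
pose x t w := psm_iterate g lam beta m K (oracle_answer vt xi w) x0 t.
have Bx t w : unit_ball (x t w) by exact: psm_iterate_in.
have mx t : history_measurable xi (t * K) (x t).
  exact: (psm_iterate_measurable setting oracle).
pose gap t w := prox_obj f g lam beta (x t w) (x t.+1 w)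
  - prox_obj f g lam beta (x t w) (prox_point f g lam beta (x t w)).
pose eS := e_star m beta eps; pose del : R := 1 / (6 * T%:R).
have del0 : 0 < del by rewrite divr_gt0 // mulr_gt0.
have del1 : del <= 1.
  rewrite ler_pdivrMr ?mulr_gt0 // mul1r.
  have : 1 <= T%:R :> R by rewrite ler1n.
  lra.
pose seeds := g_sigma_algebraType (seed_events xi setT).
have hist_seeds n : history xi n `<=` seed_events xi setT.
  exact: seed_events_mono.
have mxi := let: And4 mxi _ _ _ := oracle in mxi.
have seedsm : seed_events xi setT `<=` measurable.
  exact: (seed_events_measurable oracle).
(* Measurability is proved relative to the seeds, since independence of the index is stated for that
   sigma-algebra. *)
have mgap t : measurable_fun [set: seeds] (gap t : seeds -> R).
  apply: (measurable_fun_sub_sigma (@hist_seeds (t * K + K)%N)).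
  exact: (psm_gap_measurable setting oracle (Bx t) (@mx t) K0).
pose Bad (t : 'I_T) : set Omega := [set w | eS < gap t w].
have mBad t : (seed_events xi setT).-sigma.-measurable (Bad t).
  have := mgap t measurableT `]eS, +oo[%classic (measurable_itv _).
  rewrite setTI; congr (_.-sigma.-measurable _); apply/seteqP.
  by split => w; rewrite /Bad /= in_itv /= andbT.
(* By the choice of [K], a gap above [e_star] lies above [U_], so the tail bound covers it. *)
have PBad t : (P (Bad t) <= del%:E)%E.
  have mB' := sigma_measurable_sub seedsm (mBad t).
  have mgapO : measurable_fun [set: Omega] (gap t).
    exact: (measurable_fun_coarser seedsm (mgap t)).
  have := psm_tail setting Gg_max oracle (Bx t) (@mx t) K0 del0 del1.
  apply: le_trans; apply: le_measure; rewrite ?inE //.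
    have := mgapO measurableT `]U_ K m (G_H Gf Gg lam beta) del, +oo[%classic
      (measurable_itv _).
    rewrite setTI; congr measurable; apply/seteqP.
    by split => w; rewrite /= in_itv /= andbT.
  by move=> w; rewrite /Bad /=; apply: le_lt_trans.
pose Good : set Omega := [set w | forall t, ~ Bad t w].
have PGood : 5 / 6 <= fine (P Good).
  have := probability_no_bad_event (fun t => sigma_measurable_sub seedsm (mBad t)) PBad.
  apply: le_trans; rewrite (_ : T%:R * del = 1 / 6); first by lra.
  by rewrite /del; field; rewrite gt_eqF.
have mGood : (seed_events xi setT).-sigma.-measurable Good.
  have -> : Good = \bigcap_(t in [set: 'I_T]) ~` Bad t.
    by apply/seteqP; split => w /= H t; [move=> _|]; exact: H.
  apply: (@fin_bigcap_measurable _ seeds) => // t _; exact: measurableC.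
pose res t w := prox_residual f g lam beta (x t w).
pose S (j : 'I_T) : set Omega := [set w | res j w <= eps].
have mS j : (seed_events xi setT).-sigma.-measurable (S j).
  have mr : measurable_fun [set: seeds] (res j : seeds -> R).
    apply: (measurable_fun_sub_sigma (@hist_seeds (j * K)%N)).
    apply: measurable_funM => //; apply: measurable_enorm_sub; first exact: mx.
    apply: (measurable_prox_point setting); exact: mx.
  have -> : S j = res j @^-1` `]-oo, eps]%classic.
    by apply/seteqP; split => w; rewrite /S /= in_itv.
  rewrite -[X in measurable X]setTI; exact: (mr measurableT _ (measurable_itv _)).
have cnt w : Good w -> \sum_j (w \in ~` S j)%:R <= 1 / 6 * T%:R :> R.
  move=> Gw.
  rewrite (eq_bigr (fun j : 'I_T => (eps < res j w)%R%:R)) => [|j _]; last first.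
    congr (nat_of_bool _)%:R; rewrite in_setC ltNge; congr (~~ _).
    by apply/idP/idP; rewrite /S inE.
  apply: (@count_large_residuals R (res ^~ w) eps) => //.
    by move=> j; rewrite mulr_ge0 ?enorm_ge0 // ltW.
  apply: le_trans (sum_residual_le setting (x := x ^~ w) (Psi_min := Psi_min) (e := eS) _ _ _) _ => //.
    by move=> t tT; have := Gw (Ordinal tT); rewrite /Bad /= => /negP; rewrite -leNgt.
  (* Constants: in [4 * beta * (Delta + T * (e_star * (1 + beta / m)))] the choice of [T] and that
     of [e_star] each leave at most [T * eps ^+ 2 / 12]. *)
  rewrite /x /= -DeltaE.
  have TD := T_outer_ge b0 D0 e0; rewrite -/T in TD.
  have eSE : eS * (1 + beta / m) * (48 * beta) = eps ^+ 2.
    rewrite /eS /e_star; field.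
    by rewrite !gt_eqF // addr_gt0.
  move: (eS * (1 + beta / m)) eSE => c eSE.
  have Tc := congr1 ( *%R T%:R) eSE; rewrite /= in Tc; lra.
have [mE PE] := sampled_event T0 mxi unif indep mGood mS cnt.
exists [set w | Good w /\ S (J w) w]; split=> //; last by move=> w [].
rewrite -(fineK (fin_num_measure P _ mE)) lee_fin; apply: le_trans PE; lra.
Qed.

End guarantee.

(** The order of quantifiers renders the asymptotic notation: [C0] is absolute, while [C] and [q]
    depend on the fixed problem parameters and precede the dimension, the functions and [eps].
    [projC] may be any selection of nearest points, even one that varies with the outcome. *)
Theorem theorem3 (R : realType) :
  exists C0 : R, 0 < C0 /\
  forall l Gf Lg Gg sbd sout lam beta Delta : R,
  0 < l -> 0 < Gf -> 0 < Lg -> 0 < sbd -> 0 < sout ->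
  Gf / sout < lam -> l + lam * Lg < beta ->
  let m := beta - l - lam * Lg in
  let GH := G_H Gf Gg lam beta in
  let hfeas := lam * sout - Gf in
  let Rad := sbd / Lg in
  exists (C : R) (q : nat), 0 < C /\
  forall (d : nat) (f g : 'rV[R]_d -> R) (U : set 'rV[R]_d) (x0 : 'rV[R]_d)
    (Psi_min eps : R),
  (* (i) *)
  feasible g !=set0 -> closed (feasible g) ->
  feasible g `<=` interior (@unit_ball R d) -> unit_ball x0 ->
  (* (ii), (iii) *)
  open U -> convex_set U -> @unit_ball R d `<=` U ->
  weakly_convex U l f -> lipschitz_fun U Gf f ->
  C1_on U g -> lipschitz_map U Lg (grad g) ->
  is_max unit_ball (fun x => enorm (grad g x)) Gg ->
  (* (iv) *)
  (forall z, unit_ball z -> g z = 0 -> sbd <= enorm (grad g z)) ->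
  (forall x, unit_ball x -> 0 < g x ->
     sout <= edist_set 0 [set grad g x + n | n in limiting_normal unit_ball x]) ->
  is_min unit_ball (Psi f g lam) Psi_min ->
  Delta = Psi f g lam x0 - Psi_min ->
  0 < eps -> eps < Num.min hfeas (Num.min (beta * Rad) 1) ->
  let T := T_outer beta Delta eps in
  let K_admissible (K : nat) :=
    (2 <= K)%N /\ U_ K m GH (1 / (6 * T%:R)) <= e_star m beta eps in
  [/\ T%:R <= C0 * (1 + beta * Delta / eps ^+ 2),
      exists K : nat,
        [/\ K_admissible K,
            K%:R <= polylog C q eps * eps ^- 2 &
            (T * K)%:R <= polylog C q eps * eps ^- 4],
      forall x, unit_ball x ->
        strongly_convex unit_ball m (prox_obj f g lam beta x) /\
        argmin unit_ball (prox_obj f g lam beta x)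
          = [set prox_point f g lam beta x] &
      forall K : nat, K_admissible K ->
      forall (dO dX : measure_display) (Omega : measurableType dO)
        (Xi : measurableType dX) (P : probability Omega R)
        (vt : 'rV[R]_d -> Xi -> 'rV[R]_d) (v : 'rV[R]_d -> 'rV[R]_d)
        (xi : nat -> Omega -> Xi) (J : Omega -> 'I_T)
        (projC : Omega -> 'rV[R]_d -> 'rV[R]_d),
      stochastic_oracle P f Gf vt xi v ->
      uniform_index P J -> index_indep_of_seeds P J xi ->
      (forall w x, eproj (feasible g) x (projC w x)) ->
      let out w := run (fun n z => vt z (xi n w)) (projC w)
                       (penalized_psm g lam beta m K T x0 (J w)) 0 0 in
      let xJ w := (out w).1.1 in
      let xhat w := (out w).1.2 in
      [/\ forall w, (out w).2 = ((T * K)%N, 1%N),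
          forall w, feasible g (xhat w) &
          exists E : set Omega,
          [/\ measurable E, ((2 / 3)%:E <= P E)%E &
              forall w, E w ->
              [/\ eproj (feasible g) (xJ w) = [set xhat w],
                  prox_residual f g lam beta (xJ w) <= eps &
                  exists (y u : 'rV[R]_d) (mu : R),
                  [/\ feasible g y, limiting_subdiff f y u, 0 <= mu <= lam,
                      enorm (xhat w - y) <= 2 * eps / beta &
                      enorm (u + mu *: grad g y) <= eps /\ mu * g y = 0]]]]].
Proof.
exists 48; split=> // l Gf Lg Gg sbd sout lam beta Delta l0 Gf0 Lg0 sbd0 sout0.
move=> lam_gt beta_gt m GH hfeas Rad.
have lam0 : 0 < lam by apply: lt_trans lam_gt; exact: divr_gt0.
have b0 : 0 < beta by have := mulr_gt0 lam0 Lg0; lra.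
have m0 : 0 < m by rewrite /m; lra.
have [C C0 HC] := inner_budget GH Delta m0 b0.
(* One logarithmic factor suffices: the logarithms of [T] and of [K] both grow like
   [1 + ln (1 / eps)]. *)
exists C, 1%N; split=> // d f g U x0 Psi_min eps _ _ Cint Bx0 oU cU BU wf lipf C1g lipg
  [_ Ggub] Hbd Hout [_ Pmin] DeltaE e0.
rewrite !lt_min => /and3P [e_feas e_rad e1] T K_admissible.
have S : penalized_setting f g U l Gf Lg lam beta.
  by split => //; exact/weakly_convexP.
have Fmin y : unit_ball y -> Psi_min <= Psi f g lam y.
  by move=> By; apply: Pmin; exists y.
have D0 : 0 <= Delta by rewrite DeltaE subr_ge0 Fmin.
have Gg_max x : unit_ball x -> enorm (grad g x) <= Gg.
  by move=> Bx; apply: Ggub; exists x.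
split.
- exact: T_outer_le.
- apply: HC => //; first exact: T_outer_ge2.
  by rewrite ger0_norm //; exact: T_outer_le.
- move=> x Bx; split; last exact: (argmin_prox_obj S).
  exact/strongly_convexP/(prox_obj_semiconvex S).
move=> K [K2 UK] dO dX Omega Xi P vt v xi J projC oracle unif indep Hproj out xJ xhat.
have K0 : (0 < K)%N by exact: leq_trans K2.
have outE w : out w =
    ((psm_iterate g lam beta m K (oracle_answer vt xi w) x0 (J w),
      projC w (psm_iterate g lam beta m K (oracle_answer vt xi w) x0 (J w))),
     ((T * K)%N, 1%N)).
  exact: (run_penalized_psm _ _ _ _ _ _ _ _ (ltn_ord (J w))).
split=> [w|w|]; first by rewrite outE.
  by rewrite /xhat outE; have [] := Hproj w (out w).1.1; rewrite outE.
have [E [mE PE HE]] := small_residual_probability S Gg_max oracle Bx0 Fmin DeltaE e0 K0 UK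
  unif indep.
(* [E] controls the residual only; uniqueness and stationarity follow from it at each outcome
   separately. *)
exists E; split=> // w Ew; have res := HE w Ew.
have [uniq [y [u [mu st]]]] := stationary_of_small_residual S Cint sbd0 Hbd Hout res
  e_feas e_rad (Hproj w _).
by rewrite /xJ /xhat outE; split=> //; exists y, u, mu.
Qed.
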